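(* Let $\Omega\subset\mathbb C$ be a Jordan domain and let $\Omega'\supset\overline\Omega$ be a simply connected domain. Then the sets $\mathcal G_T$ and $\mathcal G_S$ are dense in $(\mathcal S,d_2)$. Moreover, let $\Phi\in\mathcal S$, let $\lambda\in(\lambda_{\max}(\Phi),1)$, let $m$ be a positive integer with $m>\log N/(2\log(1/\lambda))$, and put $M=2mN$. If $y_1,\dots,y_m\in\Omega$, if $B\subseteq\mathbb R^M$ is a ball, if $C<\infty$, and if $\Phi_t\in\mathcal S$ for $t\in B$ are such that the map $F:B\times Z\to\mathbb C^m=\mathbb R^{2m}$, $$F(t,(\mathtt i,\mathtt j))=\bigl(S^{\Phi_t}_{\mathtt i}(y_l)-S^{\Phi_t}_{\mathtt j}(y_l)\bigr)_{l=1}^m,$$ satisfies $$\mathcal L^M(\{t\in B:|F(t,w)|\le u\})\le Cu^{2m}$$ for all $u>0$ and $w\in Z$, and $|F(t,w)-F(t,w')|\le C\varrho_{\lambda^2}(w,w')$ for all $t\in B$ and $w,w'\in Z$, then $\Phi_t\in\mathcal G_S$ for $\mathcal L^M$-almost every $t\in B$.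
   Context: A domain is a nonempty connected open set; a Jordan domain is a bounded planar domain whose boundary is a Jordan curve. Fix $\mathcal I=\{1,\dots,N\}$ with $N\ge2$. $\mathcal S$ is the set of planar conformal iterated function systems on $\Omega$ with extension domain $\Omega'$: tuples $\Phi=(\varphi_i)_{i\in\mathcal I}$ of holomorphic maps $\varphi_i:\Omega'\to\mathbb C$ with nonvanishing derivative, $\varphi_i(\overline\Omega)\subset\Omega$, and $|\varphi_i'|<1$ on $\overline\Omega$. With $\|h\|=\sup_{x\in\overline\Omega}|h(x)|$, $d_2(\Phi,\Psi)=\max_i(\|\varphi_i-\psi_i\|+\|\varphi_i'-\psi_i'\|+\|\varphi_i''-\psi_i''\|)$ and $\lambda_{\max}(\Phi)=\max_i\|\varphi_i'\|$. $\mathcal L^M$ is Lebesgue measure on $\mathbb R^M$. Words: $\mathcal I^*$ finite words, $\mathcal I^{\mathbb N}$ infinite words, $|\mathtt i|$ the length (possibly $\infty$), $\mathtt i|_n$ the length-$n$ prefix, $\mathtt i\wedge\mathtt j$ the longest common prefix. For $\mathtt i=i_1\cdots i_n$ put $f_{\mathtt i}=\varphi_{i_n}\circ\cdots\circ\varphi_{i_1}$, $T^\Phi_{\mathtt i}=T_{\mathtt i}=f_{\mathtt i}''/f_{\mathtt i}'$, $S^\Phi_{\mathtt i}=S_{\mathtt i}=(f_{\mathtt i}''/f_{\mathtt i}')'-\frac12(f_{\mathtt i}''/f_{\mathtt i}')^2$; for infinite $\mathtt i$ these are the uniform limits on $\overline\Omega$ of the prefix projections (which exist). Let $Z=\{(\mathtt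 i,\mathtt j)\in(\mathcal I^{\mathbb N}\cup\mathcal I^* )^2:|\mathtt i|=|\mathtt j|\ge1,\ i_1\ne j_1\}$, $\mathcal G_T=\{\Phi\in\mathcal S:\inf_{(\mathtt i,\mathtt j)\in Z}\|T_{\mathtt i}-T_{\mathtt j}\|>0\}$, $\mathcal G_S=\{\Phi\in\mathcal S:\inf_{(\mathtt i,\mathtt j)\in Z}\|S_{\mathtt i}-S_{\mathtt j}\|>0\}$. For $\beta\in(0,1)$ and $w=(\mathtt i,\mathtt j)$, $w'=(\mathtt i',\mathtt j')$ in $Z$, $\varrho_\beta(w,w')=\beta^{\min\{|\mathtt i\wedge\mathtt i'|,|\mathtt j\wedge\mathtt j'|\}}$ if $w\ne w'$ and $\varrho_\beta(w,w)=0$. *)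

(* Defs.v *)
From HB Require Import structures.
From mathcomp Require Import all_boot all_order all_algebra.
From mathcomp Require Import complex.
From mathcomp Require Import all_classical all_reals all_analysis.

Set Implicit Arguments.
Unset Strict Implicit.
Unset Printing Implicit Defensive.

Import Order.TTheory GRing.Theory Num.Theory.
Import numFieldNormedType.Exports.

Local Open Scope classical_set_scope.
Local Open Scope ring_scope.

(* The alias makes the topology and the normed-module structure that every
   numClosedFieldType carries available on R[i]. *)
Definition Cplx (R : realType) : numClosedFieldType := R[i].

(* The library norm `|z| is itself an element of R[i]; this is the same number
   as an element of R. *)
Definition cnorm (R : realType) (z : Cplx R) : R := Normc.normc z.

(* Complex derivative: the increments range over Cplx R. *)
Definition cderiv (R : realType) (f : Cplx R -> Cplx R) : Cplx R -> Cplx R :=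
  derive1 f.

(* Maps on a subset of the plane are total functions here; all notions below
   only depend on their values near the relevant subset. *)
Definition holomorphic_on (R : realType) (A : set (Cplx R))
    (f : Cplx R -> Cplx R) : Prop :=
  forall z, A z -> derivable f z 1.

Definition domain (R : realType) (A : set (Cplx R)) : Prop :=
  [/\ A !=set0, open A & connected A].

Definition boundary (R : realType) (A : set (Cplx R)) : set (Cplx R) :=
  closure A `\` interior A.

Definition Jordan_curve (R : realType) (J : set (Cplx R)) : Prop :=
  exists gamma : R -> Cplx R,
    [/\ {within `[0, 1], continuous gamma},
        gamma 0 = gamma 1,
        {in `[0, 1[ &, injective gamma}
      & J = gamma @` `[0, 1]].

Definition Jordan_domain (R : realType) (A : set (Cplx R)) : Prop :=
  [/\ domain A, bounded_set A & Jordan_curve (boundary A)].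

(* Open connected subsets of the plane are path connected, so only the
   contractibility of loops (with fixed base point) is left to require. *)
Definition simply_connected_domain (R : realType) (A : set (Cplx R)) : Prop :=
  domain A /\
  forall gamma : R -> Cplx R,
    {within `[0, 1], continuous gamma} ->
    (forall x, 0 <= x <= 1 -> A (gamma x)) ->
    gamma 0 = gamma 1 ->
    exists H : R * R -> Cplx R,
      [/\ {within `[0, 1] `*` `[0, 1], continuous H},
          forall s x, 0 <= s <= 1 -> 0 <= x <= 1 -> A (H (s, x)),
          forall x, 0 <= x <= 1 -> H (0, x) = gamma x,
          forall x, 0 <= x <= 1 -> H (1, x) = gamma 0
        & forall s, 0 <= s <= 1 ->
            H (s, 0) = gamma 0 /\ H (s, 1) = gamma 0].

Definition supnorm (R : realType) (Om : set (Cplx R))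
    (h : Cplx R -> Cplx R) : \bar R :=
  ereal_sup [set (cnorm (h x))%:E | x in closure Om].

(* The alphabet {1, ..., N} is 'I_N = {0, ..., N - 1}. *)
Definition cifs (R : realType) (N : nat) (Om Om' : set (Cplx R)) :
    set ('I_N -> Cplx R -> Cplx R) :=
  [set Phi | forall i : 'I_N,
    [/\ holomorphic_on Om' (Phi i),
        forall z, Om' z -> cderiv (Phi i) z != 0,
        forall z, closure Om z -> Om (Phi i z)
      & forall z, closure Om z -> cnorm (cderiv (Phi i) z) < 1]].

Definition dist2 (R : realType) (N : nat) (Om : set (Cplx R))
    (Phi Psi : 'I_N -> Cplx R -> Cplx R) : \bar R :=
  \big[maxe/0%E]_(i < N)
    (supnorm Om (Phi i \- Psi i)%R
     + supnorm Om (cderiv (Phi i) \- cderiv (Psi i))%R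
     + supnorm Om (cderiv (cderiv (Phi i)) \- cderiv (cderiv (Psi i)))%R)%E.

Definition lambda_max (R : realType) (N : nat) (Om : set (Cplx R))
    (Phi : 'I_N -> Cplx R -> Cplx R) : \bar R :=
  \big[maxe/0%E]_(i < N) supnorm Om (cderiv (Phi i)).

Definition dense_in (R : realType) (X : Type) (d : X -> X -> \bar R)
    (S G : set X) : Prop :=
  G `<=` S /\
  forall x, S x -> forall e : R, 0 < e -> exists2 y, G y & (d x y < e%:E)%E.

Inductive word (N : nat) : Type :=
  | FinWord of seq 'I_N
  | InfWord of (nat -> 'I_N).

(* Positions start at 0; None stands for a position beyond the end. *)
Definition letter (N : nat) (w : word N) (k : nat) : option 'I_N :=
  match w with
  | FinWord s => onth s k
  | InfWord a => Some (a k)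
  end.

(* None is the length of an infinite word. *)
Definition wlen (N : nat) (w : word N) : option nat :=
  match w with
  | FinWord s => Some (size s)
  | InfWord _ => None
  end.

Definition wprefix (N : nat) (w : word N) (n : nat) : seq 'I_N :=
  match w with
  | FinWord s => take n s
  | InfWord a => mkseq a n
  end.

(* Longest common prefix: cut at the first position where the two words
   differ (the end of a word counts as a difference). *)
Definition wedge (N : nat) (i j : word N) : word N :=
  match pselect (exists k, letter i k != letter j k) with
  | left e => FinWord (wprefix i (ex_minn e))
  | right _ => i
  end.

Definition Zset (N : nat) : set (word N * word N) :=
  [set w | [/\ wlen w.1 = wlen w.2,
               wlen w.1 <> Some 0%N
             & letter w.1 0 <> letter w.2 0]].

Definition minlen (a b : option nat) : option nat :=
  match a, b with
  | Some m, Some n => Some (minn m n)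
  | None, c | c, None => c
  end.

Definition powlen (R : realType) (beta : R) (a : option nat) : R :=
  if a is Some n then beta ^+ n else 0.

Definition rho (R : realType) (N : nat) (beta : R)
    (w w' : word N * word N) : R :=
  if `[< w = w' >] then 0
  else powlen beta (minlen (wlen (wedge w.1 w'.1)) (wlen (wedge w.2 w'.2))).

(* f_{i_1...i_n} = phi_{i_n} o ... o phi_{i_1}: the first letter acts first. *)
Definition fcomp (R : realType) (N : nat) (Phi : 'I_N -> Cplx R -> Cplx R)
    (s : seq 'I_N) : Cplx R -> Cplx R :=
  foldl (fun g i => Phi i \o g) id s.

Definition preschwarzian (R : realType) (f : Cplx R -> Cplx R) :
    Cplx R -> Cplx R :=
  fun z => cderiv (cderiv f) z / cderiv f z.

Definition schwarzian (R : realType) (f : Cplx R -> Cplx R) :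
    Cplx R -> Cplx R :=
  fun z => cderiv (preschwarzian f) z - 2^-1 * preschwarzian f z ^+ 2.

(* A uniform limit on A of the sequence g (the zero function if there is none);
   only its values on A are determined. *)
Definition unif_lim (R : realType) (A : set (Cplx R))
    (g : nat -> Cplx R -> Cplx R) : Cplx R -> Cplx R :=
  xget (fun=> 0) [set h : Cplx R -> Cplx R | {uniform A, g @ \oo --> h}].

Definition wproj (R : realType) (N : nat)
    (P : (Cplx R -> Cplx R) -> Cplx R -> Cplx R) (Om : set (Cplx R))
    (Phi : 'I_N -> Cplx R -> Cplx R) (w : word N) : Cplx R -> Cplx R :=
  match w with
  | FinWord s => P (fcomp Phi s)
  | InfWord a =>
      unif_lim (closure Om) (fun n => P (fcomp Phi (mkseq a n)))
  end.

Definition Tproj (R : realType) (N : nat) (Om : set (Cplx R))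
    (Phi : 'I_N -> Cplx R -> Cplx R) (w : word N) : Cplx R -> Cplx R :=
  wproj (@preschwarzian R) Om Phi w.

Definition Sproj (R : realType) (N : nat) (Om : set (Cplx R))
    (Phi : 'I_N -> Cplx R -> Cplx R) (w : word N) : Cplx R -> Cplx R :=
  wproj (@schwarzian R) Om Phi w.

Definition GT (R : realType) (N : nat) (Om Om' : set (Cplx R)) :
    set ('I_N -> Cplx R -> Cplx R) :=
  [set Phi | cifs Om Om' Phi /\
    (0 < ereal_inf [set supnorm Om (Tproj Om Phi w.1 \- Tproj Om Phi w.2)%R
                   | w in @Zset N])%E].

Definition GS (R : realType) (N : nat) (Om Om' : set (Cplx R)) :
    set ('I_N -> Cplx R -> Cplx R) :=
  [set Phi | cifs Om Om' Phi /\
    (0 < ereal_inf [set supnorm Om (Sproj Om Phi w.1 \- Sproj Om Phi w.2)%R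
                   | w in @Zset N])%E].

(* Euclidean norms on R^M and on C^m = R^(2m); the library norm on matrices is
   the max norm. *)
Definition enorm (R : realType) (M : nat) (t : 'rV[R]_M) : R :=
  Num.sqrt (\sum_(k < M) t ord0 k ^+ 2).

Definition cenorm (R : realType) (m : nat) (v : 'rV[Cplx R]_m) : R :=
  Num.sqrt (\sum_(l < m) cnorm (v ord0 l) ^+ 2).

(* Open and closed balls are both allowed. *)
Definition euclidean_ball (R : realType) (M : nat) (B : set 'rV[R]_M) : Prop :=
  exists (c : 'rV[R]_M) (r : R), 0 < r /\
    (B = [set t | enorm (t - c) < r] \/ B = [set t | enorm (t - c) <= r]).

Definition box (R : realType) (M : nat) (a b : 'rV[R]_M) : set 'rV[R]_M :=
  [set t | forall k : 'I_M, a ord0 k < t ord0 k <= b ord0 k].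

Definition box_vol (R : realType) (M : nat) (a b : 'rV[R]_M) : R :=
  \prod_(k < M) Num.max 0 (b ord0 k - a ord0 k).

(* Lebesgue (outer) measure on R^M, defined on every subset: infimum of the
   total volume of countable covers by half-open boxes.  On Lebesgue measurable
   sets it is the Lebesgue measure. *)
Definition lebesgueM (R : realType) (M : nat) (A : set 'rV[R]_M) : \bar R :=
  ereal_inf [set s | exists a b : nat -> 'rV[R]_M,
    A `<=` \bigcup_k box (a k) (b k) /\
    s = (\sum_(0 <= k <oo) (box_vol (a k) (b k))%:E)%E].

Definition Fdiff (R : realType) (N m : nat) (Om : set (Cplx R))
    (y : 'I_m -> Cplx R) (Phi : 'I_N -> Cplx R -> Cplx R)
    (w : word N * word N) : 'rV[Cplx R]_m :=
  \row_(l < m) (Sproj Om Phi w.1 (y l) - Sproj Om Phi w.2 (y l)).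

(* Main.v *)
Require Import Defs.
From HB Require Import structures.
From mathcomp Require Import all_boot all_order all_algebra.
From mathcomp Require Import complex.
From mathcomp Require Import all_classical all_reals all_analysis.
From mathcomp Require Import ring lra.

Set Implicit Arguments.
Unset Strict Implicit.
Unset Printing Implicit Defensive.

Import Order.TTheory GRing.Theory Num.Theory.
Import numFieldNormedType.Exports.

Local Open Scope classical_set_scope.
Local Open Scope ring_scope.

(* Density.  For each letter k let b_k maximize Re Phi_k on the closure of Om, put
   z_k = Phi_k(b_k), and replace Phi_k by theta_k o Phi_k, where theta_k' = exp(q_k)
   and q_k(z) = c_k nu^-3 exp(nu^2 (z - z_k)).  On the half plane Re z <= Re z_k, which
   contains the image of Phi_k, |q_k| <= c_k nu^-3 and |q_k'| <= c_k nu^-1, so for large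
   nu the change is small in d_2; but q_k''(z_k) = c_k nu, and the pre-Schwarzian of
   theta_k is q_k'.  On a compact subset of Om containing the images of all the maps,
   Re Phi_k stays strictly below Re z_k since Phi_k is nonconstant there, so q_k'' o Phi_k
   is bounded uniformly in nu.  In the cocycle T_{k s} = (T_s o Phi_k) Phi_k' + T_k only
   the first letter therefore contributes a derivative of size nu, at b_k, and amplitudes
   c_k growing fast enough in k separate the first letters.  The resulting gap for T'
   gives one for S = T' - T^2/2 because T is bounded, and one for T by a Taylor bound
   uniform over all words.

   Almost every parameter.  If Phi_t is not in G_S, then for every n some pair w in Z
   has |F(t, w)| <= lam^{2n}.  Truncating w at length n changes F by at most
   C lam^{2n}, so t lies in one of at most n N^{2n} sets, each of measure at most
   C (const lam^{2n})^{2m}; and N lam^{2m} < 1. *)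

(** * Plane calculus *)

(** The metric d_2 sees two derivatives of the maps, so it controls T but not T'. A perturbation
    that is small in d_2 can make T' as large as desired, and the separation is produced there. The
    scaling reflects this: each derivative of q_k gains a factor nu^2, so q_k and q_k' tend to 0
    while q_k'' grows like nu. The obstacle is that one gap must serve all pairs of words while the
    later letters are perturbed too. Their contribution stays bounded because one letter already
    moves the orbit into a compact part of Om, where the exponential decay beats the factor nu. At
    b_k a smaller letter j may be near its own peak, and the factor |Phi_k'(b_k)|^2 may be small. So
    a pair of letters is tested at the peak of the larger one, and c_k times that factor has to
    exceed c_j by a margin. In the measure estimate C^m has real dimension 2m: N^{2n} pairs against
    (lam^{2n})^{2m} leave (N lam^{2m})^{2n}, which also absorbs the factor n counting the word
    lengths. *)

Definition mkc (R : realType) (x y : R) : Cplx R := Complex x y.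
Definition re (R : realType) (z : Cplx R) : R := complex.Re z.
Definition im (R : realType) (z : Cplx R) : R := complex.Im z.

Lemma is_derive_comp_num (K : numFieldType) (f g : K -> K) (z a b : K) :
  is_derive (g z) 1 f a -> is_derive z 1 g b -> is_derive z 1 (f \o g) (a * b).
Proof.
move=> [fd fa] [gd gb].
move: (fd) (gd) => /derivable1_diffP fd' /derivable1_diffP gd'.
split; first exact/derivable1_diffP/differentiable_comp.
(* Derivatives are differentials evaluated at 1, and linearity of the differential of [f] pulls the
   factor [b] out. *)
rewrite -fa -gb -!derive1E derive1E'; last exact/differentiable_comp.
rewrite diff_comp// !derive1E'//= -[X in 'd _ _ X = _]mulr1.
by rewrite [LHS]linearZ mulrC.
Qed.

(* The argument types fix the topology and normed-module structure on R[i] once and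
   for all; otherwise they would be inferred anew for each explicit lambda. *)
Definition has_cderiv (R : realType) (f : Cplx R -> Cplx R) (z l : Cplx R) : Prop :=
  is_derive z 1 f l.

Section ComplexPlane.
Context {R : realType}.
Implicit Types (z w : Cplx R) (x y : R).

Lemma reD z w : re (z + w) = re z + re w. Proof. by case: z w => [? ?] []. Qed.
Lemma imD z w : im (z + w) = im z + im w. Proof. by case: z w => [? ?] []. Qed.
Lemma reN z : re (- z) = - re z. Proof. by case: z. Qed.
Lemma imN z : im (- z) = - im z. Proof. by case: z. Qed.
Lemma reM z w : re (z * w) = re z * re w - im z * im w.
Proof. by case: z w => [? ?] []. Qed.
Lemma imM z w : im (z * w) = re z * im w + im z * re w.
Proof. by case: z w => [? ?] []. Qed.
Lemma re1 : re (1 : Cplx R) = 1. Proof. by []. Qed.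
Lemma im1 : im (1 : Cplx R) = 0. Proof. by []. Qed.
Lemma re0 : re (0 : Cplx R) = 0. Proof. by []. Qed.
Lemma im0 : im (0 : Cplx R) = 0. Proof. by []. Qed.

Definition reimE := (reD, imD, reN, imN, reM, imM, re1, im1, re0, im0).

Lemma cplx_ext z w : re z = re w -> im z = im w -> z = w.
Proof. by case: z w => [a b] [c d] /= -> ->. Qed.

Lemma mkcE z : z = mkc (re z) (im z). Proof. by case: z. Qed.

Lemma cnormE z : `|z| = (real_complex R (cnorm z) : Cplx R).
Proof. by rewrite [LHS](@normc_def R z); case: z. Qed.

Lemma cnorm_ge0 z : 0 <= cnorm z.
Proof. by case: z => a b; exact: sqrtr_ge0. Qed.

Lemma cnorm0 : cnorm (0 : Cplx R) = 0. Proof. exact: Normc.normc0. Qed.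
Lemma cnorm1 : cnorm (1 : Cplx R) = 1. Proof. exact: Normc.normc1. Qed.
Lemma cnormD z w : cnorm (z + w) <= cnorm z + cnorm w.
Proof. exact: le_normcD. Qed.
Lemma cnormN z : cnorm (- z) = cnorm z. Proof. exact: normcN. Qed.
Lemma cnormM z w : cnorm (z * w) = cnorm z * cnorm w.
Proof. exact: Normc.normcM. Qed.
Lemma cnormV z : cnorm z^-1 = (cnorm z)^-1. Proof. exact: Normc.normcV. Qed.
Lemma cnormX z n : cnorm (z ^+ n) = cnorm z ^+ n.
Proof. by elim: n => [|n IH]; rewrite ?expr0 ?cnorm1// !exprS cnormM IH. Qed.
Lemma cnorm_nat n : cnorm (n%:R : Cplx R) = n%:R.
Proof. by rewrite [LHS](normcMn 1 n) -[Normc.normc 1]/(cnorm 1) cnorm1. Qed.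
Lemma cnormB z w : cnorm (z - w) = cnorm (w - z).
Proof. by rewrite -cnormN opprB. Qed.

Lemma cnorm_eq0 z : (cnorm z == 0) = (z == 0).
Proof.
by apply/eqP/eqP => [/Normc.eq0_normc//|->]; rewrite cnorm0.
Qed.

Lemma cnorm_gt0 z : (0 < cnorm z) = (z != 0).
Proof. by rewrite lt_def cnorm_ge0 andbT cnorm_eq0. Qed.

Lemma cnormBD z w : cnorm z - cnorm w <= cnorm (z - w).
Proof. by rewrite lerBlDr -[in leLHS](subrK w z) cnormD. Qed.

Lemma cnorm_triangle z1 z2 z3 : cnorm (z1 - z3) <= cnorm (z1 - z2) + cnorm (z2 - z3).
Proof. by rewrite -[z1 - z3](subrKA z2) cnormD. Qed.

Lemma re_le z : `|re z| <= cnorm z.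
Proof.
case: z => a b /=; rewrite -sqrtr_sqr ler_wsqrtr// lerDl; exact: sqr_ge0.
Qed.

Lemma im_le z : `|im z| <= cnorm z.
Proof.
case: z => a b /=; rewrite -sqrtr_sqr ler_wsqrtr// lerDr; exact: sqr_ge0.
Qed.

Lemma cnorm_le z : cnorm z <= `|re z| + `|im z|.
Proof.
case: z => a b /=; rewrite -[leRHS]ger0_norm; last exact: addr_ge0.
rewrite -sqrtr_sqr ler_wsqrtr// sqrrD !real_normK ?num_real//.
rewrite lerD2r lerDl; exact: mulrn_wge0 (mulr_ge0 _ _).
Qed.

Lemma cnorm_mkc0 x : cnorm (mkc x 0) = `|x|.
Proof. by rewrite /cnorm /= expr0n addr0 sqrtr_sqr. Qed.

Lemma cnorm_mkc0x x : cnorm (mkc 0 x) = `|x|.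
Proof. by rewrite /cnorm /= expr0n add0r sqrtr_sqr. Qed.

Lemma cplx_gt0 (e : Cplx R) : 0 < e -> 0 < re e /\ e = mkc (re e) 0.
Proof. by case: e => a b; rewrite ltcE /= => /andP[/eqP -> ?]. Qed.

Lemma mkc_gt0 x : 0 < x -> 0 < mkc x 0.
Proof. by move=> x0; rewrite /mkc ltcE /= eqxx. Qed.

Lemma cnorm_lt_mkc z x : (`|z| < mkc x 0) = (cnorm z < x).
Proof. by rewrite cnormE; exact: ltcR. Qed.

(** Radii in the norm topology of R[i] are elements of R[i]; a positive element for its partial
    order is real, so real radii give the same neighbourhoods. *)
Lemma nbhs_cplxP z (P : set (Cplx R)) :
  nbhs z P <-> exists2 e, 0 < e & forall w, cnorm (w - z) < e -> P w.
Proof.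
split=> [/nbhs_ballP[e /= /cplx_gt0[e0 ee] eP]|[e e0 eP]].
  exists (re e) => // w wz; apply: eP; rewrite /ball /= distrC ee.
  by rewrite cnorm_lt_mkc.
apply/nbhs_ballP; exists (mkc e 0) => /=; first exact: mkc_gt0.
by move=> w; rewrite /ball /= distrC cnorm_lt_mkc; exact: eP.
Qed.

Lemma cvg_cplxP (T : Type) (F : set_system T) {FF : Filter F} (f : T -> Cplx R) l :
  f @ F --> l <-> forall e, 0 < e -> \forall x \near F, cnorm (f x - l) < e.
Proof.
split=> [fl e e0|fl].
  by apply: (fl [set w | cnorm (w - l) < e]); apply/nbhs_cplxP; exists e.
move=> P /nbhs_cplxP[e e0 eP]; apply: filterS (fl _ e0) => x /=; exact: eP.
Qed.

Lemma dnbhs0_cplxP (P : set (Cplx R)) :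
  (\forall h \near 0^', P h) <->
  exists2 d, 0 < d & forall h, h != 0 -> cnorm h < d -> P h.
Proof.
split=> [|[d d0 dP]].
  rewrite /dnbhs => /nbhs_cplxP[d d0 dP].
  by exists d => // h h0 hd; apply: dP => //; rewrite subr0.
rewrite /dnbhs; apply/nbhs_cplxP; exists d => // h; rewrite subr0 => ? ?; exact: dP.
Qed.

(** Division-free form in which [h = 0] is allowed, so that later estimates need no case
    distinction. *)
Lemma has_cderivP (f : Cplx R -> Cplx R) z l :
  has_cderiv f z l <->
  forall e, 0 < e -> exists2 d, 0 < d &
    forall h, cnorm h < d -> cnorm (f (z + h) - f z - l * h) <= e * cnorm h.
Proof.
have E l' h : h != 0 -> h^-1 *: (f (h *: 1 + z) - f z) - l' =
    (f (z + h) - f z - l' * h) / h.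
  by move=> h0; rewrite /GRing.scale /= mulr1 [h + z]addrC; field.
split=> [[df <-] e e0|H].
  have /cvg_cplxP/(_ _ e0)/dnbhs0_cplxP[d d0 H] := df.
  exists d => // h hd; have [->|h0] := eqVneq h 0.
    by rewrite addr0 subrr mulr0 subrr cnorm0 mulr0.
  have := H _ h0 hd.
  rewrite [X in cnorm X](_ : _ = (f (z + h) - f z - 'D_1 f z * h) / h); last exact: E.
  move=> /ltW.
  by rewrite cnormM cnormV ler_pdivrMr // cnorm_gt0.
have : h^-1 *: ((f \o shift z) (h *: 1) - f z) @[h --> 0^'] --> l.
  apply/cvg_cplxP => e e0; have [d d0 dP] := H _ (divr_gt0 e0 (ltr0n _ 2)).
  apply/dnbhs0_cplxP; exists d => // h h0 hd.
  rewrite [X in cnorm X](_ : _ = (f (z + h) - f z - l * h) / h); last exact: E.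
  rewrite cnormM cnormV.
  rewrite ltr_pdivrMr ?cnorm_gt0//; apply: le_lt_trans (dP _ hd) _.
  by rewrite ltr_pM2r ?cnorm_gt0// ltr_pdivrMr// mulr_natr mulr2n ltrDl.
by move=> H'; split; [apply/cvg_ex; exists l | exact: cvg_lim].
Qed.

Lemma cderivE (f : Cplx R -> Cplx R) z l : has_cderiv f z l -> cderiv f z = l.
Proof. by move=> dfl; rewrite /cderiv derive1E; exact: derive_val. Qed.

Lemma derivable_has_cderiv (f : Cplx R -> Cplx R) z :
  derivable f z 1 -> has_cderiv f z (cderiv f z).
Proof. by move=> df; rewrite /has_cderiv /cderiv derive1E; exact: derivableP. Qed.

Lemma has_cderiv_near (f g : Cplx R -> Cplx R) z l :
  (\forall w \near z, f w = g w) -> has_cderiv f z l -> has_cderiv g z l.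
Proof.
move=> fg /has_cderivP df; apply/has_cderivP => e e0.
have [d d0 dP] := df _ e0; move/nbhs_cplxP: fg => [d' d'0 fg].
exists (Num.min d d'); first by rewrite lt_min d0.
move=> h; rewrite lt_min => /andP[hd hd'].
have fgz : f z = g z by apply: fg; rewrite subrr cnorm0.
have fgh : f (z + h) = g (z + h) by apply: fg; rewrite [z + h]addrC addrK.
by rewrite -fgz -fgh; exact: dP.
Qed.

Lemma cder_comp (f g : Cplx R -> Cplx R) z a b :
  has_cderiv f (g z) a -> has_cderiv g z b -> has_cderiv (fun w => f (g w)) z (a * b).
Proof. exact: is_derive_comp_num. Qed.

Lemma derivable_continuous (f : Cplx R -> Cplx R) z :
  derivable f z 1 -> {for z, continuous f}.
Proof. by move=> /derivable1_diffP/differentiable_continuous. Qed.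

Lemma continuous_cplxP (f : Cplx R -> Cplx R) z :
  {for z, continuous f} <->
  forall e, 0 < e -> exists2 d, 0 < d &
    forall w, cnorm (w - z) < d -> cnorm (f w - f z) < e.
Proof.
have cvgP := @cvg_cplxP _ (nbhs z) (nbhs_filter z) f (f z).
split=> [/cvgP H e /H /nbhs_cplxP//|H].
by apply/cvgP => e e0; apply/nbhs_cplxP; exact: H.
Qed.

Lemma continuous_cplx_lipschitz (h : Cplx R -> R) :
  (forall z w, `|h z - h w| <= cnorm (z - w)) -> continuous h.
Proof.
move=> hl z; apply/(@cvgrPdist_lt R R^o _ (nbhs z) (nbhs_filter z) h (h z)) => e e0.
apply/nbhs_cplxP; exists e => // w wz.
by apply: le_lt_trans (hl _ _) _; rewrite cnormB.
Qed.

Lemma continuous_re : continuous (@re R).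
Proof.
by apply: continuous_cplx_lipschitz => z w; rewrite -reN -reD re_le.
Qed.

Lemma continuous_im : continuous (@im R).
Proof.
by apply: continuous_cplx_lipschitz => z w; rewrite -imN -imD im_le.
Qed.

Lemma continuous_cnorm : continuous (@cnorm R).
Proof.
apply: continuous_cplx_lipschitz => z w; rewrite ler_norml lerNl opprB.
by rewrite cnormBD cnormB cnormBD.
Qed.

Lemma cvg_mkc (T : Type) (F : set_system T) {FF : Filter F} (f g : T -> R) a b :
  f @ F --> a -> g @ F --> b -> (fun t => mkc (f t) (g t)) @ F --> mkc a b.
Proof.
move=> /cvgrPdist_lt fa /cvgrPdist_lt gb; apply/cvg_cplxP => e e0.
have e2 : 0 < e / 2 by rewrite divr_gt0.
near=> t; apply: le_lt_trans (cnorm_le _) _; rewrite !reimE /re /im /=.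
rewrite (splitr e) ltrD// distrC.
- by near: t; exact: fa.
- by near: t; exact: gb.
Unshelve. all: by end_near. Qed.

Lemma continuous_mkc (T : topologicalType) (f g : T -> R) :
  continuous f -> continuous g -> continuous (fun t => mkc (f t) (g t)).
Proof. by move=> cf cg t; apply: cvg_mkc; [exact: cf | exact: cg]. Qed.

End ComplexPlane.

Lemma is_derive_mul_num (K : numFieldType) (f g : K -> K) (z a b : K) :
  is_derive z 1 f a -> is_derive z 1 g b ->
  is_derive z 1 (fun w => f w * g w) (a * g z + f z * b).
Proof.
move=> fa gb; apply: is_derive_eq (is_deriveM fa gb) _.
by rewrite addrC /GRing.scale /= [g z * a]mulrC.
Qed.

Lemma is_derive_inv_num (K : numFieldType) (f : K -> K) (z a : K) :
  f z != 0 -> is_derive z 1 f a ->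
  is_derive z 1 (fun w => (f w)^-1) (- a / f z ^+ 2).
Proof.
move=> fz0 [fd fa]; split; first exact: derivableV.
by rewrite deriveV// fa /GRing.scale /= mulrC mulrN mulNr.
Qed.

Definition ccont (R : realType) (f : Cplx R -> Cplx R) (z : Cplx R) : Prop :=
  {for z, continuous f}.

Lemma for_continuousD_num (K : numFieldType) (f g : K -> K) (z : K) :
  {for z, continuous f} -> {for z, continuous g} -> {for z, continuous (f + g)}.
Proof. exact: continuousD. Qed.

Lemma for_continuousM_num (K : numFieldType) (f g : K -> K) (z : K) :
  {for z, continuous f} -> {for z, continuous g} -> {for z, continuous (f * g)}.
Proof. exact: continuousM. Qed.

Section PointwiseContinuity.
Context {R : realType}.
Implicit Types (f g : Cplx R -> Cplx R) (z : Cplx R).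

Lemma ccontD f g z : ccont f z -> ccont g z -> ccont (fun w => f w + g w) z.
Proof. exact: for_continuousD_num. Qed.

Lemma ccontM f g z : ccont f z -> ccont g z -> ccont (fun w => f w * g w) z.
Proof. exact: for_continuousM_num. Qed.

Lemma has_cderiv_ccont f z a : has_cderiv f z a -> ccont f z.
Proof. by move=> [df _]; exact: derivable_continuous. Qed.

End PointwiseContinuity.

Section DerivativeRules.
Context {R : realType}.
Implicit Types (f g : Cplx R -> Cplx R) (z a b : Cplx R).

Lemma cder_eq f z a b : has_cderiv f z a -> a = b -> has_cderiv f z b.
Proof. by move=> ? <-. Qed.

Lemma cder_cst (c : Cplx R) z : has_cderiv (fun=> c) z 0.
Proof. exact: is_derive_cst. Qed.

Lemma cder_id z : has_cderiv (fun w : Cplx R => w) z 1.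
Proof. exact: is_derive_id. Qed.

Lemma cderD f g z a b : has_cderiv f z a -> has_cderiv g z b ->
  has_cderiv (fun w => f w + g w) z (a + b).
Proof. by move=> ? ?; exact: is_deriveD. Qed.

Lemma cderN f z a : has_cderiv f z a -> has_cderiv (fun w => - f w) z (- a).
Proof. by move=> ?; exact: is_deriveN. Qed.

Lemma cderB f g z a b : has_cderiv f z a -> has_cderiv g z b ->
  has_cderiv (fun w => f w - g w) z (a - b).
Proof. by move=> ? ?; exact: is_deriveB. Qed.

Lemma cderM f g z a b : has_cderiv f z a -> has_cderiv g z b ->
  has_cderiv (fun w => f w * g w) z (a * g z + f z * b).
Proof. exact: is_derive_mul_num. Qed.

Lemma cderZ f z c a : has_cderiv f z a -> has_cderiv (fun w => c * f w) z (c * a).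
Proof.
move=> fa; apply: cder_eq (cderM (cder_cst c z) fa) _.
by rewrite mul0r add0r.
Qed.

Lemma cderV f z a : f z != 0 -> has_cderiv f z a ->
  has_cderiv (fun w => (f w)^-1) z (- a / f z ^+ 2).
Proof. exact: is_derive_inv_num. Qed.

Lemma cder_div f g z a b : g z != 0 -> has_cderiv f z a -> has_cderiv g z b ->
  has_cderiv (fun w => f w / g w) z ((a * g z - f z * b) / g z ^+ 2).
Proof.
move=> gz0 fa gb; apply: cder_eq (cderM fa (cderV gz0 gb)) _.
by field.
Qed.

Lemma cder_ex f z a : has_cderiv f z a -> derivable f z 1.
Proof. by case. Qed.

End DerivativeRules.

(** * Compactness, limits and uniform convergence in the plane *)

Section PlaneTopology.
Context {R : realType}.
Implicit Types (A K U : set (Cplx R)) (z w : Cplx R).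

Lemma open_cplxP U : open U <->
  forall z, U z -> exists2 e, 0 < e & forall w, cnorm (w - z) < e -> U w.
Proof.
rewrite openE; split=> H z /H; first by move=> /nbhs_cplxP.
by move=> ?; apply/nbhs_cplxP.
Qed.

Lemma closure_cplxP A z : closure A z <->
  forall e, 0 < e -> exists2 w, A w & cnorm (w - z) < e.
Proof.
split=> [H e e0|H B /nbhs_cplxP[e e0 eB]].
  have [|w [Aw wz]] := H [set w | cnorm (w - z) < e]; last by exists w.
  by apply/nbhs_cplxP; exists e.
by have [w Aw wz] := H _ e0; exists w; split=> //; exact: eB.
Qed.

Lemma bounded_cplxP A : bounded_set A ->
  exists r : R, forall z, A z -> cnorm z <= r.
Proof.
move=> [[a b] [ab MA]]; move: ab MA; rewrite complex_real => /eqP -> MA.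
exists (a + 1) => z Az.
have aa : ((a +i* 0)%C : Cplx R) < mkc (a + 1) 0 by rewrite ltcE /= eqxx ltrDl ltr01.
by have := MA _ aa z Az; rewrite /= cnormE lecE => /andP[].
Qed.

(** Heine-Borel, transported from the real line: the closure is a closed subset of the image of a
    compact real square under the continuous map [q]. *)
Lemma compact_closure A : bounded_set A -> compact (closure A).
Proof.
move=> /bounded_cplxP[r rA].
pose q (p : R * R) := mkc p.1 p.2.
have cq : compact (q @` (`[- r, r] `*` `[- r, r])).
  apply: continuous_compact; last by apply: compact_setX; exact: segment_compact.
  apply: continuous_subspaceT => -[x y].
  by apply: cvg_mkc; [exact: cvg_fst | exact: cvg_snd].
apply: subclosed_compact cq _; first exact: closed_closure.
move=> z /closure_cplxP Az; exists (re z, im z); last by rewrite /q -mkcE.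
have zr : cnorm z <= r.
  apply/ler_addgt0Pr => e e0; have [w Aw wz] := Az _ e0.
  rewrite -(subrK w z); apply: le_trans (cnormD _ _) _.
  by rewrite addrC lerD ?rA// cnormB ltW.
by split; rewrite /= in_itv /= -ler_norml; apply: le_trans zr; [exact: re_le|exact: im_le].
Qed.

Lemma compact_max (K : set (Cplx R)) (f : Cplx R -> R) : K !=set0 -> compact K ->
  (forall z, K z -> {for z, continuous f}) ->
  exists2 c, K c & forall z, K z -> f z <= f c.
Proof.
move=> K0 cK cf; have [|c /set_mem Kc cmax] := compact_EVT_max K0 cK (f := f).
  apply: continuous_in_subspaceT => z /set_mem; exact: cf.
by exists c => // z Kz; apply: cmax; exact: mem_set.
Qed.

Lemma compact_bound (K : set (Cplx R)) (f : Cplx R -> Cplx R) : compact K ->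
  (forall z, K z -> {for z, continuous f}) ->
  exists2 M, 0 <= M & forall z, K z -> cnorm (f z) <= M.
Proof.
move=> cK cf; have [K0|/set0P/negP/negPn/eqP ->] := pselect (K !=set0); last first.
  by exists 0.
have [|c Kc cmax] := compact_max K0 cK (f := fun z => cnorm (f z)).
  move=> z Kz; apply: (@continuous_comp _ _ _ f (@cnorm R)); first exact: cf.
  exact: continuous_cnorm.
by exists (cnorm (f c)) => //; exact: cnorm_ge0.
Qed.

(** Compactness in its near-covering form, with the radius as the parameter tending to 0 from the
    right: each point has a radius that serves a neighbourhood of it, hence a single radius serves
    all of [K]. *)
Lemma compact_inner_radius K U : compact K -> open U -> K `<=` U ->
  exists2 d, 0 < d & forall z, K z -> forall w, cnorm (w - z) < d -> U w.
Proof.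
move=> /compact_near_coveringP cK /open_cplxP oU KU.
have cov : \forall d \near 0^'+,
    K `<=` (fun z => forall w, cnorm (w - z) < d -> U w).
  apply: cK => z /KU/oU[e e0 eU].
  exists ([set w | cnorm (w - z) < e / 2], [set d | d < e / 2]).
    split => /=; first by apply/nbhs_cplxP; exists (e / 2) => //; rewrite divr_gt0.
    by apply: nbhs_right_lt; rewrite divr_gt0.
  move=> [z' d] /= [z'z de] w wz'; apply: eU.
  apply: le_lt_trans (cnorm_triangle _ z' _) _.
  by rewrite (splitr e) ltrD// (lt_trans wz').
have [d [/= d0 dU]] := filter_ex (filterI (@nbhs_right_gt R 0) cov).
by exists d.
Qed.

(** Completeness of R is applied to real and imaginary parts separately; the rate [a] passes to the
    limit because it bounds all later terms at once. *)
Lemma cauchy_limit (u : nat -> Cplx R) (a : nat -> R) :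
  a @ \oo --> 0 -> (forall n p, cnorm (u (n + p)%N - u n) <= a n) ->
  exists l, forall n, cnorm (u n - l) <= a n.
Proof.
move=> a0 ua.
have cv (h : Cplx R -> R) : (forall z, `|h z| <= cnorm z) -> {morph h : z w / z - w} ->
    cvgn (fun n => h (u n)).
  move=> hle hB; apply/cauchy_cvgP/cauchy_ballP => e e0; near_simpl.
  move: (a0) => /cvgrPdist_lt/(_ (e / 2))[|k _ ka]; first by rewrite divr_gt0.
  have kh n : (k <= n)%N -> `|h (u k) - h (u n)| < e / 2.
    move=> kn; rewrite -hB; apply: le_lt_trans (hle _) _; rewrite cnormB -(subnKC kn).
    apply: le_lt_trans (ua _ _) _; apply: le_lt_trans (ler_norm _) _.
    by have := ka k (leqnn k); rewrite /= sub0r normrN.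
  exists ([set n | (k <= n)%N], [set n | (k <= n)%N]) => /=; first by split; exists k.
  move=> [m n] /= [km kn]; rewrite /ball /= -(subrKA (h (u k))) (splitr e).
  by apply: le_lt_trans (ler_normD _ _) _; rewrite ltrD ?kh// distrC kh.
have cr := cv (@re R) re_le (fun z w => _); have ci := cv (@im R) im_le (fun z w => _).
have {}cr : cvgn (fun n => re (u n)) by apply: cr => z w; rewrite reD reN.
have {}ci : cvgn (fun n => im (u n)) by apply: ci => z w; rewrite imD imN.
pose l := mkc (lim ((fun n => re (u n)) @ \oo)) (lim ((fun n => im (u n)) @ \oo)).
have ul : u @ \oo --> l.
  rewrite (_ : u = fun n => mkc (re (u n)) (im (u n))); last first.
    by apply/funext => n; rewrite -mkcE.
  exact: cvg_mkc.
exists l => n; apply/ler_addgt0Pr => e e0.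
move/cvg_cplxP : ul => /(_ _ e0)[k _ kl].
rewrite -(subrKA (u (n + k)%N)); apply: le_trans (cnormD _ _) _.
rewrite lerD//; first by rewrite cnormB.
by apply: ltW; apply: kl => /=; rewrite leq_addl.
Qed.

Lemma uniform_cplxP A (g : nat -> Cplx R -> Cplx R) (h : Cplx R -> Cplx R) :
  {uniform A, g @ \oo --> h} <->
  forall e, 0 < e -> \forall n \near \oo, forall z, A z -> cnorm (g n z - h z) < e.
Proof.
split=> [gh e e0|gh P /uniform_nbhs[E [entE EP]]].
  apply: (gh [set k | forall z, A z -> cnorm (k z - h z) < e]); apply/uniform_nbhs.
  exists [set xy | ball xy.1 (mkc e 0) xy.2]; split.
    by apply: entourage_ball (PosNum (mkc_gt0 e0)).
  move=> k /= H z Az; rewrite -cnorm_lt_mkc; have := H z Az.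
  by rewrite /ball /= distrC.
move: entE; rewrite -entourage_ballE => -[e /= /cplx_gt0[e0 ee] eE].
apply: filterS (gh _ e0) => n gn; apply: EP => z Az; apply: eE => /=.
by rewrite /ball /= distrC ee cnorm_lt_mkc; exact: gn.
Qed.

End PlaneTopology.

(** * Cauchy theory for squares *)

Section RealIntegral.
Context {R : realType}.
Implicit Types (f g G H : R -> R) (a b x y : R).

Lemma der0_segment f x y : x <= y ->
  (forall t, x <= t <= y -> is_derive t (1 : R) f 0) -> f x = f y.
Proof.
move=> xy df; have [|| c _] := @MVT_segment R f (fun=> 0) x y xy.
- by move=> t; rewrite in_itv /= => /andP[xt ty]; apply: df; rewrite !ltW.
- apply: continuous_in_subspaceT => t /set_mem; rewrite /= in_itv /= => /df [dft _].
  exact/differentiable_continuous/derivable1_diffP.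
by rewrite mul0r => /eqP; rewrite subr_eq0 => /eqP.
Qed.

Lemma ftc1_is_derive g a x : continuous g -> a < x ->
  is_derive x (1 : R) (fun u => (\int[lebesgue_measure]_(t in `[a, u]) g t)%R) (g x).
Proof.
move=> cg ax; have xx : x < x + 1 by rewrite ltrDl.
have [||dF FE] := @continuous_FTC1_closed R g a x (x + 1) xx _ ax.
- apply: continuous_compact_integrable; first exact: segment_compact.
  exact: continuous_subspaceT.
- exact: cg.
by apply: DeriveDef; [exact: dF | rewrite -derive1E; exact: FE].
Qed.

(** The integral from [a] is a primitive only to the right of [a]. Normalising it to vanish at 0
    makes it independent of [a], so [a] may move with the point and the local primitives glue to one
    on the whole line. *)
Lemma continuous_primitive g : continuous g ->
  exists G, forall x, is_derive x (1 : R) G (g x).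
Proof.
move=> cg.
pose I a u := (\int[lebesgue_measure]_(t in `[a, u]) g t)%R.
have dI a x : a < x -> is_derive x (1 : R) (I a) (g x) by exact: ftc1_is_derive.
pose J a x := I a x - I a 0.
have JE a a' x : a < a' -> a' < 0 -> a' < x -> J a x = J a' x.
  move=> aa' a'0 a'x; pose h u := I a u - I a' u.
  have dh t : a' < t -> is_derive t (1 : R) h 0.
    move=> a't; rewrite -(subrr (g t)); apply: is_deriveB; apply: dI => //.
    exact: lt_trans a't.
  suff hE : h x = h 0 by rewrite /J; move: hE; rewrite /h; lra.
  have [x0|/ltW x0] := lerP x 0; [|symmetry].
    apply: der0_segment x0 _ => t /andP[xt _]; apply: dh; exact: lt_le_trans xt.
  apply: der0_segment x0 _ => t /andP[xt _]; apply: dh; exact: lt_le_trans xt.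
exists (fun x => J (- (`|x| + 1)) x) => x.
(* For [y] within 1 of [x] this fixed base point lies to the left of the moving one, - (|y| + 1), so
   both normalised integrals agree near [x]. *)
pose a := - (`|x| + 2).
have ax : a < x by rewrite /a; have := ler_norm (- x); rewrite normrN; lra.
have dJ : is_derive x (1 : R) (J a) (g x).
  by rewrite -[g x]subr0; apply: is_deriveB; exact: dI.
apply: near_eq_is_derive dJ.
near=> y.
have yx : `|y - x| < 1 by near: y; apply/nbhs_normP; exists 1 => //= z; rewrite /= distrC.
have yx2 : `|y| < `|x| + 1.
  by have := ler_distD 0 y x; have := ler_normB x y; have := lerB_dist y x; lra.
have y0 : 0 <= `|y| :> R by exact: normr_ge0.
have yN : - y <= `|y| :> R by rewrite -normrN ler_norm.
apply: JE; rewrite /a; lra.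
Unshelve. all: by end_near. Qed.

(* Only integrals of continuous functions are needed, so any primitive will do. *)
Definition prim g : R -> R :=
  xget (fun=> 0) [set G | forall x, is_derive x (1 : R) G (g x)].

Definition rint g a b : R := prim g b - prim g a.

Lemma prim_derive g x : continuous g -> is_derive x (1 : R) (prim g) (g x).
Proof.
move=> cg; have [G dG] := continuous_primitive cg.
exact: (xgetI (fun=> 0) (dG : [set H | forall x, is_derive x (1 : R) H (g x)] G)).
Qed.

Lemma rintE g G a b : (forall x, is_derive x (1 : R) G (g x)) ->
  rint g a b = G b - G a.
Proof.
move=> dG; have dp : forall x, is_derive x (1 : R) (prim g) (g x).
  exact: (xgetI (fun=> 0) (dG : [set H | forall x, is_derive x (1 : R) H (g x)] G)).
have : (prim g - G) a = (prim g - G) b.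
  apply: is_derive_0_is_cst => x; rewrite -(subrr (g x)); exact: is_deriveB.
by rewrite /rint !fctE /=; lra.
Qed.

Lemma rint_add g a b c : rint g a b + rint g b c = rint g a c.
Proof. by rewrite /rint; lra. Qed.

Lemma rint_swap g a b : rint g b a = - rint g a b.
Proof. by rewrite /rint; lra. Qed.

Lemma rintD f g a b : continuous f -> continuous g ->
  rint (fun x => f x + g x) a b = rint f a b + rint g a b.
Proof.
move=> cf cg.
have dG x : is_derive x (1 : R) (prim f + prim g) (f x + g x).
  by apply: is_deriveD; exact: prim_derive.
by rewrite (rintE _ _ dG) !fctE /rint /=; lra.
Qed.

Lemma rintZ (c : R) g a b : continuous g ->
  rint (fun x => c * g x) a b = c * rint g a b.
Proof.
move=> cg.
have dG x : is_derive x (1 : R) (c *: prim g) (c * g x).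
  by apply: is_deriveZ; exact: prim_derive.
by rewrite (rintE _ _ dG) /rint mulrBr.
Qed.

Lemma rint_cst (c : R) a b : rint (fun=> c) a b = c * (b - a).
Proof.
have dG x : is_derive x (1 : R) (c *: (id : R -> R)) c.
  by rewrite -[c in X in is_derive _ _ _ X]mulr1; exact: is_deriveZ.
by rewrite (rintE _ _ dG) mulrBr.
Qed.

Lemma rint_shift (s : R) g a b : continuous g ->
  rint (fun x => g (x + s)) a b = rint g (a + s) (b + s).
Proof.
move=> cg.
have dG x : is_derive x (1 : R) (prim g \o (fun x => x + s)) (g (x + s)).
  rewrite -[g _]mulr1; apply: is_derive1_comp; first exact: prim_derive.
  by rewrite -[X in is_derive _ _ _ X]addr0; apply: is_deriveD.
by rewrite (rintE _ _ dG).
Qed.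

Lemma rint_ge g (m a b : R) : continuous g -> a <= b ->
  (forall x, a <= x <= b -> m <= g x) -> m * (b - a) <= rint g a b.
Proof.
move=> cg ab mg; rewrite /rint.
have [||c] := @MVT_segment R (prim g) g a b ab.
- by move=> x _; exact: prim_derive.
- apply: continuous_subspaceT => x; have [dp _] := prim_derive x cg.
  exact/differentiable_continuous/derivable1_diffP.
rewrite in_itv /= => /mg mc ->; rewrite ler_wpM2r// subr_ge0//.
Qed.

Lemma rint_ub g (M a b : R) : continuous g -> a <= b ->
  (forall x, a <= x <= b -> g x <= M) -> rint g a b <= M * (b - a).
Proof.
move=> cg ab gM; rewrite -lerN2 -[leLHS]mulNr -[leRHS]mulN1r -rintZ//.
apply: rint_ge => // [x|x /gM]; last by rewrite mulN1r lerN2.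
by apply: cvgM; [exact: cvg_cst|exact: cg].
Qed.

Lemma rint_le g (M a b : R) : continuous g ->
  (forall x, Num.min a b <= x <= Num.max a b -> `|g x| <= M) ->
  `|rint g a b| <= M * `|b - a|.
Proof.
move=> cg; wlog ab : a b / a <= b => [hw|].
  have [ab|ba] := orP (le_total a b); first exact: hw ab.
  by rewrite (minC a) (maxC a) rint_swap normrN (distrC b); exact: hw ba.
rewrite (min_idPl ab) (max_idPr ab) => gM.
rewrite (ger0_norm (_ : 0 <= b - a)) ?subr_ge0// ler_norml; apply/andP; split.
  rewrite -mulNr; apply: rint_ge => // x /gM; rewrite ler_norml => /andP[] //.
have cNg : continuous (fun x => (-1) * g x) by move=> x; apply: cvgM; [exact: cvg_cst|exact: cg].
have := @rint_ge _ (- M) a b cNg ab; rewrite rintZ// !mulNr mul1r lerN2; apply.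
by move=> x /gM; rewrite ler_norml mulN1r lerN2 => /andP[].
Qed.

End RealIntegral.

(** * Integrals along segments and around rectangles *)

Definition ci (R : realType) : Cplx R := mkc 0 1.

Definition cint (R : realType) (g : R -> Cplx R) (a b : R) : Cplx R :=
  mkc (rint (fun t => re (g t)) a b) (rint (fun t => im (g t)) a b).

(* The four sides of the rectangle, counterclockwise. *)
Definition oint (R : realType) (g : Cplx R -> Cplx R) (x1 x2 y1 y2 : R) : Cplx R :=
  cint (fun t => g (mkc t y1)) x1 x2 + ci R * cint (fun t => g (mkc x2 t)) y1 y2
  - cint (fun t => g (mkc t y2)) x1 x2 - ci R * cint (fun t => g (mkc x1 t)) y1 y2.

Definition rect (R : realType) (x1 x2 y1 y2 : R) : set (Cplx R) :=
  [set z | x1 <= re z <= x2 /\ y1 <= im z <= y2].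

Definition edge (R : realType) (x1 x2 y1 y2 : R) : set (Cplx R) :=
  [set z | rect x1 x2 y1 y2 z /\ [\/ re z = x1, re z = x2, im z = y1 | im z = y2]].

Definition line_continuous (R : realType) (g : R -> Cplx R) : Prop := continuous g.

Definition sides_continuous (R : realType) (g : Cplx R -> Cplx R) (x1 x2 y1 y2 : R) :=
  [/\ line_continuous (fun t : R => g (mkc t y1)), line_continuous (fun t : R => g (mkc t y2)),
      line_continuous (fun t : R => g (mkc x1 t)) & line_continuous (fun t : R => g (mkc x2 t))].

Section LineIntegral.
Context {R : realType}.
Implicit Types (g h : R -> Cplx R) (a b : R).

Lemma continuous_reP g : line_continuous g -> continuous (fun t => re (g t)).
Proof. by move=> cg t; apply: continuous_comp; [exact: cg|exact: continuous_re]. Qed.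

Lemma continuous_imP g : line_continuous g -> continuous (fun t => im (g t)).
Proof. by move=> cg t; apply: continuous_comp; [exact: cg|exact: continuous_im]. Qed.

Lemma continuous_reimP g : continuous (fun t => re (g t)) ->
  continuous (fun t => im (g t)) -> line_continuous g.
Proof.
move=> cr ci; rewrite (_ : g = fun t => mkc (re (g t)) (im (g t))); last first.
  by apply/funext => t; rewrite -mkcE.
exact: continuous_mkc.
Qed.

Lemma continuousD_line g h : line_continuous g -> line_continuous h ->
  line_continuous (fun t => g t + h t).
Proof.
move=> cg ch; apply: continuous_reimP => t; under eq_fun do rewrite reimE.
  by apply: cvgD; [exact: continuous_reP|exact: continuous_reP].
by apply: cvgD; [exact: continuous_imP|exact: continuous_imP].
Qed.

Lemma continuousM_line g h : line_continuous g -> line_continuous h ->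
  line_continuous (fun t => g t * h t).
Proof.
move=> cg ch; apply: continuous_reimP => t; under eq_fun do rewrite reimE.
  apply: cvgB; apply: cvgM.
  - exact: continuous_reP. - exact: continuous_reP.
  - exact: continuous_imP. - exact: continuous_imP.
apply: cvgD; apply: cvgM.
- exact: continuous_reP. - exact: continuous_imP.
- exact: continuous_imP. - exact: continuous_reP.
Qed.

Lemma continuous_cst_line (c : Cplx R) : line_continuous (fun _ : R => c).
Proof. by move=> t; exact: cvg_cst. Qed.

Lemma continuous_hline (y : R) : line_continuous (fun t : R => mkc t y).
Proof. by apply: continuous_mkc => t; [exact: cvg_id|exact: cvg_cst]. Qed.

Lemma continuous_vline (x : R) : line_continuous (fun t : R => mkc x t).
Proof. by apply: continuous_mkc => t; [exact: cvg_cst|exact: cvg_id]. Qed.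

Lemma cint_add g a b c : cint g a b + cint g b c = cint g a c.
Proof. by apply: cplx_ext; rewrite reimE /re /im /= rint_add. Qed.

Lemma cint_swap g a b : cint g b a = - cint g a b.
Proof. by apply: cplx_ext; rewrite reimE /re /im /= rint_swap. Qed.

Lemma cintD g h a b : line_continuous g -> line_continuous h ->
  cint (fun t => g t + h t) a b = cint g a b + cint h a b.
Proof.
move=> cg ch; apply: cplx_ext; rewrite reimE /re /im /= -rintD.
- by congr rint; apply/funext => t; rewrite -/(re _) reD.
- exact: continuous_reP. - exact: continuous_reP.
- by congr rint; apply/funext => t; rewrite -/(im _) imD.
- exact: continuous_imP. - exact: continuous_imP.
Qed.

Lemma cintZ (c : Cplx R) g a b : line_continuous g ->
  cint (fun t => c * g t) a b = c * cint g a b.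
Proof.
move=> cg; have cr := continuous_reP cg; have ci := continuous_imP cg.
have cZ (k : R) (f : R -> R) : continuous f -> continuous (fun t => k * f t).
  by move=> cf t; apply: cvgM; [exact: cvg_cst|exact: cf].
apply: cplx_ext; rewrite reimE /re /im /= -/(re _) -/(im _).
  rewrite -mulNr -!rintZ// -rintD; [|exact: cZ|exact: cZ].
  by congr rint; apply/funext => t; rewrite reM mulNr.
rewrite -!rintZ// -rintD; [|exact: cZ|exact: cZ].
by congr rint; apply/funext => t; rewrite imM.
Qed.

Lemma cint_cst (c : Cplx R) a b : cint (fun=> c) a b = c * mkc (b - a) 0.
Proof.
by apply: cplx_ext; rewrite reimE /re /im /= rint_cst mulr0 ?subr0 ?add0r.
Qed.

Lemma cint_shift (s : R) g a b : line_continuous g ->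
  cint (fun x => g (x + s)) a b = cint g (a + s) (b + s).
Proof.
move=> cg; rewrite /cint (@rint_shift _ s (fun t => re (g t))) ?(@rint_shift _ s (fun t => im (g t)))//.
- exact: continuous_imP.
- exact: continuous_reP.
Qed.

(** The factor 2 comes from estimating the real and imaginary parts separately; no later argument
    depends on the sharp constant. *)
Lemma cint_le g (M : R) a b : line_continuous g ->
  (forall x, Num.min a b <= x <= Num.max a b -> cnorm (g x) <= M) ->
  cnorm (cint g a b) <= 2 * M * `|b - a|.
Proof.
move=> cg gM; apply: le_trans (cnorm_le _) _; rewrite /re /im /= -mulrA mulr_natl mulr2n.
apply: lerD; apply: rint_le.
- exact: continuous_reP.
- by move=> x /gM; apply: le_trans; exact: re_le.
- exact: continuous_imP.
- by move=> x /gM; apply: le_trans; exact: im_le.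
Qed.

End LineIntegral.

Section RectangleIntegral.
Context {R : realType}.
Implicit Types (g h : Cplx R -> Cplx R) (x y : R).

Lemma oint_splitx g x1 x2 x3 y1 y2 :
  oint g x1 x3 y1 y2 = oint g x1 x2 y1 y2 + oint g x2 x3 y1 y2.
Proof.
by rewrite /oint -!(cint_add _ x1 x2 x3); ring.
Qed.

Lemma oint_splity g x1 x2 y1 y2 y3 :
  oint g x1 x2 y1 y3 = oint g x1 x2 y1 y2 + oint g x1 x2 y2 y3.
Proof.
by rewrite /oint -!(cint_add _ y1 y2 y3); ring.
Qed.

Lemma continuous_sides g x1 x2 y1 y2 : continuous g -> sides_continuous g x1 x2 y1 y2.
Proof.
move=> cg; split=> t.
- by apply: (@continuous_comp _ _ _ (fun t : R => mkc t y1) g); [exact: continuous_hline|exact: cg].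
- by apply: (@continuous_comp _ _ _ (fun t : R => mkc t y2) g); [exact: continuous_hline|exact: cg].
- by apply: (@continuous_comp _ _ _ (fun t : R => mkc x1 t) g); [exact: continuous_vline|exact: cg].
- by apply: (@continuous_comp _ _ _ (fun t : R => mkc x2 t) g); [exact: continuous_vline|exact: cg].
Qed.

Lemma sidesD g h x1 x2 y1 y2 : sides_continuous g x1 x2 y1 y2 ->
  sides_continuous h x1 x2 y1 y2 -> sides_continuous (fun z => g z + h z) x1 x2 y1 y2.
Proof. 
case=> c1 c2 c3 c4 [d1 d2 d3 d4].
by split; [exact: (continuousD_line c1 d1)|exact: (continuousD_line c2 d2)
  |exact: (continuousD_line c3 d3)|exact: (continuousD_line c4 d4)]. Qed.

Lemma sidesM g h x1 x2 y1 y2 : sides_continuous g x1 x2 y1 y2 ->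
  sides_continuous h x1 x2 y1 y2 -> sides_continuous (fun z => g z * h z) x1 x2 y1 y2.
Proof. 
case=> c1 c2 c3 c4 [d1 d2 d3 d4].
by split; [exact: (continuousM_line c1 d1)|exact: (continuousM_line c2 d2)
  |exact: (continuousM_line c3 d3)|exact: (continuousM_line c4 d4)]. Qed.

Lemma sides_cst (c : Cplx R) x1 x2 y1 y2 : sides_continuous (fun=> c) x1 x2 y1 y2.
Proof. by split; exact: continuous_cst_line. Qed.

Lemma sidesZ (c : Cplx R) g x1 x2 y1 y2 : sides_continuous g x1 x2 y1 y2 ->
  sides_continuous (fun z => c * g z) x1 x2 y1 y2.
Proof. by move=> sg; exact: (@sidesM (fun=> c) g _ _ _ _ (@sides_cst c _ _ _ _) sg). Qed.

Lemma sidesB g h x1 x2 y1 y2 : sides_continuous g x1 x2 y1 y2 ->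
  sides_continuous h x1 x2 y1 y2 -> sides_continuous (fun z => g z - h z) x1 x2 y1 y2.
Proof.
move=> sg sh; have [c cE] : exists c : Cplx R, forall z, c * z = - z.
  by exists (-1) => z; exact: mulN1r.
have -> : (fun z => g z - h z) = (fun z => g z + c * h z).
  by apply/funext => z; rewrite cE.
exact: sidesD sg (sidesZ c sh).
Qed.

Lemma ointD g h x1 x2 y1 y2 : sides_continuous g x1 x2 y1 y2 ->
  sides_continuous h x1 x2 y1 y2 ->
  oint (fun z => g z + h z) x1 x2 y1 y2 = oint g x1 x2 y1 y2 + oint h x1 x2 y1 y2.
Proof. by case=> ? ? ? ? [? ? ? ?]; rewrite /oint !cintD//; ring. Qed.

Lemma ointZ (c : Cplx R) g x1 x2 y1 y2 : sides_continuous g x1 x2 y1 y2 ->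
  oint (fun z => c * g z) x1 x2 y1 y2 = c * oint g x1 x2 y1 y2.
Proof. by case=> ? ? ? ?; rewrite /oint !cintZ//; ring. Qed.

Lemma ointB g h x1 x2 y1 y2 : sides_continuous g x1 x2 y1 y2 ->
  sides_continuous h x1 x2 y1 y2 ->
  oint (fun z => g z - h z) x1 x2 y1 y2 = oint g x1 x2 y1 y2 - oint h x1 x2 y1 y2.
Proof.
move=> sg sh; have [c cE] : exists c : Cplx R, forall z, c * z = - z.
  by exists (-1) => z; exact: mulN1r.
have -> : (fun z => g z - h z) = (fun z => g z + c * h z).
  by apply/funext => z; rewrite cE.
by rewrite (ointD sg (sidesZ c sh)) (ointZ c sh) cE.
Qed.

Lemma oint_cst (c : Cplx R) x1 x2 y1 y2 : oint (fun=> c) x1 x2 y1 y2 = 0.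
Proof. by rewrite /oint !cint_cst; ring. Qed.

Lemma rint_id (a b : R) : rint (fun t => t) a b = (b ^+ 2 - a ^+ 2) / 2.
Proof.
have dG x : is_derive x (1 : R) (2^-1 *: (id ^+ 2 : R -> R)) x.
  by apply: is_derive_eq; rewrite /GRing.scale /= expr1; lra.
by rewrite (rintE _ _ dG) !fctE /GRing.scale /=; lra.
Qed.

Lemma oint_id x1 x2 y1 y2 : oint (fun z => z) x1 x2 y1 y2 = 0.
Proof.
rewrite /oint /cint /re /im /= !rint_id !rint_cst /ci.
by apply: cplx_ext; rewrite !reimE /re /im /=; field.
Qed.

Lemma oint_le g (M : R) x1 x2 y1 y2 : sides_continuous g x1 x2 y1 y2 ->
  x1 <= x2 -> y1 <= y2 -> (forall z, edge x1 x2 y1 y2 z -> cnorm (g z) <= M) ->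
  cnorm (oint g x1 x2 y1 y2) <= 4 * M * (x2 - x1 + (y2 - y1)).
Proof.
case=> c1 c2 c3 c4 x12 y12 gM.
have ciN (z : Cplx R) : cnorm (ci R * z) = cnorm z.
  by rewrite cnormM /ci cnorm_mkc0x normr1 mul1r.
have xE : `|x2 - x1| = x2 - x1 by rewrite ger0_norm// subr_ge0.
have yE : `|y2 - y1| = y2 - y1 by rewrite ger0_norm// subr_ge0.
have h1 : cnorm (cint (fun t => g (mkc t y1)) x1 x2) <= 2 * M * (x2 - x1).
  rewrite -xE; apply: cint_le => // x; rewrite (min_idPl x12) (max_idPr x12) => xx.
  by apply: gM; split; [rewrite /rect /= /re /im /= lexx y12 | constructor 3].
have h2 : cnorm (cint (fun t => g (mkc t y2)) x1 x2) <= 2 * M * (x2 - x1).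
  rewrite -xE; apply: cint_le => // x; rewrite (min_idPl x12) (max_idPr x12) => xx.
  by apply: gM; split; [rewrite /rect /= /re /im /= lexx y12 | constructor 4].
have h3 : cnorm (cint (fun t => g (mkc x1 t)) y1 y2) <= 2 * M * (y2 - y1).
  rewrite -yE; apply: cint_le => // x; rewrite (min_idPl y12) (max_idPr y12) => xx.
  by apply: gM; split; [rewrite /rect /= /re /im /= lexx x12 | constructor 1].
have h4 : cnorm (cint (fun t => g (mkc x2 t)) y1 y2) <= 2 * M * (y2 - y1).
  rewrite -yE; apply: cint_le => // x; rewrite (min_idPl y12) (max_idPr y12) => xx.
  by apply: gM; split; [rewrite /rect /= /re /im /= lexx x12 | constructor 2].
rewrite /oint; apply: le_trans (cnormD _ _) _; rewrite cnormN ciN.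
apply: le_trans (lerD (cnormD _ _) (lexx _)) _; rewrite cnormN.
apply: le_trans (lerD (lerD (cnormD _ _) (lexx _)) (lexx _)) _; rewrite ciN.
by apply: le_trans (lerD (lerD (lerD h1 h4) h2) h3) _; lra.
Qed.

(** The chosen primitives belong to functions that may differ off the rectangle, so they cannot be
    compared directly; instead [oint_le] with bound 0 is applied to the difference. *)
Lemma oint_eq g h x1 x2 y1 y2 : sides_continuous g x1 x2 y1 y2 ->
  sides_continuous h x1 x2 y1 y2 -> x1 <= x2 -> y1 <= y2 ->
  (forall z, rect x1 x2 y1 y2 z -> g z = h z) ->
  oint g x1 x2 y1 y2 = oint h x1 x2 y1 y2.
Proof.
move=> sg sh x12 y12 gh; apply/eqP; rewrite -subr_eq0 -ointB// -cnorm_eq0.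
have := oint_le (M := 0) (sidesB sg sh) x12 y12.
rewrite mulr0 mul0r => le0; rewrite eq_le cnorm_ge0 andbT; apply: le0.
by move=> z [/gh -> _]; rewrite subrr cnorm0.
Qed.

End RectangleIntegral.

(** * Goursat's theorem for rectangles *)

Section Goursat.
Context {R : realType}.
Implicit Types (g h : Cplx R -> Cplx R) (x y a b c s t : R).

Lemma nested_segments (a d : nat -> R) : (forall n, 0 <= d n) ->
  (forall n, a n <= a n.+1 /\ a n.+1 + d n.+1 <= a n + d n) ->
  exists x, forall n, a n <= x <= a n + d n.
Proof.
move=> d0 ad.
have am m k : a m <= a (m + k)%N.
  by elim: k => [|k IH]; rewrite ?addn0// addnS (le_trans IH)// (ad _).1.
have bm m k : a (m + k)%N + d (m + k)%N <= a m + d m.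
  by elim: k => [|k IH]; rewrite ?addn0// addnS (le_trans (ad _).2).
have ab m n : a m <= a n + d n.
  have [mn|/ltnW nm] := leqP m n.
    by apply: le_trans (am m (n - m)%N) _; rewrite subnKC// lerDl.
  by apply: le_trans _ (bm n (m - n)%N); rewrite subnKC// lerDl.
have hub n : ubound (range a) (a n + d n) by move=> _ [m _ <-].
exists (sup (range a)) => n; apply/andP; split.
  apply: ub_le_sup; last by exists n.
  by exists (a 0%N + d 0%N).
by apply: ge_sup; [exists (a 0%N); exists 0%N | exact: hub].
Qed.

Lemma half_step x x' a s b : x <= a -> a + s <= b -> 0 <= s ->
  x' = a \/ x' = a + s / 2 -> x <= x' /\ x' + s / 2 <= b.
Proof. by move=> ? ? ? [|] ->; split; lra. Qed.

Lemma dist_segment x y a s : a <= x <= a + s -> a <= y <= a + s -> `|x - y| <= s.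
Proof. by move=> ? ?; rewrite ler_norml; lra. Qed.

(** Pigeonhole: the four quarter integrals add up to the whole one, so one of them has at least a
    quarter of its modulus. *)
Lemma oint_quarter g a c s t : exists a' c',
  [/\ a' = a \/ a' = a + s / 2, c' = c \/ c' = c + t / 2 &
    cnorm (oint g a (a + s) c (c + t)) <=
      4 * cnorm (oint g a' (a' + s / 2) c' (c' + t / 2))].
Proof.
set A := cnorm _.
have aE : a + s / 2 + s / 2 = a + s by lra.
have cE : c + t / 2 + t / 2 = c + t by lra.
pose Q i j := cnorm (oint g (a + i) (a + i + s / 2) (c + j) (c + j + t / 2)).
have AQ : A <= Q 0 0 + Q (s / 2) 0 + Q 0 (t / 2) + Q (s / 2) (t / 2).
  rewrite /A /Q !addr0 aE cE (oint_splitx g a (a + s / 2)).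
  rewrite (oint_splity g a _ c (c + t / 2)) (oint_splity g (a + s / 2) _ c (c + t / 2)).
  apply: le_trans (cnormD _ _) _; apply: le_trans (lerD (cnormD _ _) (cnormD _ _)) _.
  by lra.
have [h|h1] := lerP A (4 * Q 0 0).
  by exists a, c; split; [left|left|move: h; rewrite /Q !addr0].
have [h|h2] := lerP A (4 * Q (s / 2) 0).
  by exists (a + s / 2), c; split; [right|left|move: h; rewrite /Q !addr0].
have [h|h3] := lerP A (4 * Q 0 (t / 2)).
  by exists a, (c + t / 2); split; [left|right|move: h; rewrite /Q !addr0].
have [h|h4] := lerP A (4 * Q (s / 2) (t / 2)).
  by exists (a + s / 2), (c + t / 2); split; [right|right|move: h; rewrite /Q].
by lra.
Qed.

(** Increments stay in [D] because a function composed with the retraction onto a rectangle is in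
    general not complex differentiable across the boundary. *)
Definition derivable_within (D : set (Cplx R)) g :=
  forall z, D z -> exists l, forall e, 0 < e -> exists2 d, 0 < d &
    forall w, D w -> cnorm (w - z) < d ->
      cnorm (g w - g z - l * (w - z)) <= e * cnorm (w - z).

Lemma oint_affine (p l z0 : Cplx R) a b c d :
  oint (fun w => p + l * (w - z0)) a b c d = 0.
Proof.
have ci : continuous (fun w : Cplx R => w) by move=> w; exact: cvg_id.
have si := continuous_sides a b c d ci.
have -> : (fun w => p + l * (w - z0)) = (fun w => (p - l * z0) + l * w).
  by apply/funext => w; ring.
by rewrite (ointD (@sides_cst _ _ _ _ _ _) (sidesZ l si)) (ointZ l si) oint_cst oint_id mulr0 addr0.
Qed.

Lemma goursat_within g x1 x2 y1 y2 : continuous g -> x1 <= x2 -> y1 <= y2 ->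
  derivable_within (rect x1 x2 y1 y2) g -> oint g x1 x2 y1 y2 = 0.
Proof.
move=> cg x12 y12 dg.
pose s := x2 - x1; pose t := y2 - y1.
have s0 : 0 <= s by rewrite subr_ge0.
have t0 : 0 <= t by rewrite subr_ge0.
have x2E : x2 = x1 + s by rewrite /s; lra.
have y2E : y2 = y1 + t by rewrite /t; lra.
apply/eqP; rewrite -cnorm_eq0 eq_le cnorm_ge0 andbT leNgt; apply/negP => A0.
set A := cnorm _ in A0.
have [nxt nxtP] : {f : (R * R) * (R * R) -> R * R & forall q,
    [/\ (f q).1 = q.1.1 \/ (f q).1 = q.1.1 + q.2.1 / 2,
        (f q).2 = q.1.2 \/ (f q).2 = q.1.2 + q.2.2 / 2 &
    cnorm (oint g q.1.1 (q.1.1 + q.2.1) q.1.2 (q.1.2 + q.2.2)) <=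
      4 * cnorm (oint g (f q).1 ((f q).1 + q.2.1 / 2) (f q).2 ((f q).2 + q.2.2 / 2))]}.
  apply: (@choice _ _ (fun q p => [/\ p.1 = q.1.1 \/ p.1 = q.1.1 + q.2.1 / 2,
        p.2 = q.1.2 \/ p.2 = q.1.2 + q.2.2 / 2 &
    cnorm (oint g q.1.1 (q.1.1 + q.2.1) q.1.2 (q.1.2 + q.2.2)) <=
      4 * cnorm (oint g p.1 (p.1 + q.2.1 / 2) p.2 (p.2 + q.2.2 / 2))])).
  move=> [[a c] [s' t']] /=; have [a' [c' H]] := oint_quarter g a c s' t'.
  by exists (a', c').
pose S n := s / 2 ^+ n; pose T n := t / 2 ^+ n.
have SS n : S n.+1 = S n / 2 by rewrite /S exprS invfM mulrA mulrAC.
have TT n : T n.+1 = T n / 2 by rewrite /T exprS invfM mulrA mulrAC.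
have S0 n : 0 <= S n by rewrite divr_ge0// exprn_ge0.
have T0 n : 0 <= T n by rewrite divr_ge0// exprn_ge0.
pose u := fix F n := if n is m.+1 then nxt (F m, (S m, T m)) else (x1, y1).
have uS n : [/\ (u n.+1).1 = (u n).1 \/ (u n.+1).1 = (u n).1 + S n / 2,
  (u n.+1).2 = (u n).2 \/ (u n.+1).2 = (u n).2 + T n / 2 &
  cnorm (oint g (u n).1 ((u n).1 + S n) (u n).2 ((u n).2 + T n)) <=
  4 * cnorm (oint g (u n.+1).1 ((u n.+1).1 + S n.+1) (u n.+1).2 ((u n.+1).2 + T n.+1))].
  by have := nxtP (u n, (S n, T n)); rewrite /= SS TT.
have [a aP] : exists a, forall n, (u n).1 <= a <= (u n).1 + S n.
  apply: nested_segments => // n; have [+ _ _] := uS n; rewrite SS.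
  by have := S0 n; move=> ? [->|->]; lra.
have [c cP] : exists c, forall n, (u n).2 <= c <= (u n).2 + T n.
  apply: nested_segments => // n; have [_ + _] := uS n; rewrite TT.
  by have := T0 n; move=> ? [->|->]; lra.
have S0E : S 0%N = s by rewrite /S expr0 divr1.
have T0E : T 0%N = t by rewrite /T expr0 divr1.
have uin n : [/\ x1 <= (u n).1, (u n).1 + S n <= x2, y1 <= (u n).2 & (u n).2 + T n <= y2].
  elim: n => [|n [h1 h2 h3 h4]]; first by rewrite /= S0E T0E -x2E -y2E.
  have [ha hc _] := uS n; rewrite SS TT.
  have [? ?] := half_step h1 h2 (S0 n) ha.
  by have [? ?] := half_step h3 h4 (T0 n) hc; split.
have AU n : A <= 4 ^+ n * cnorm (oint g (u n).1 ((u n).1 + S n) (u n).2 ((u n).2 + T n)).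
  elim: n => [|n IH]; first by rewrite expr0 mul1r /= S0E T0E -x2E -y2E.
  apply: le_trans IH _; rewrite exprSr -mulrA ler_wpM2l ?exprn_ge0//.
  by have [_ _] := uS n.
pose z := mkc a c.
have zQ : rect x1 x2 y1 y2 z.
  have := aP 0%N; have := cP 0%N; rewrite /= S0E T0E => ? ?.
  by rewrite /rect /= /re /im /= x2E y2E.
have [l lP] := dg z zQ.
(* At stage n the bound 4^n * 4 * e * ((s + t + 1) / 2^n)^2 equals 4A/5, which contradicts A <=
   4A/5. The summand 1 keeps the scale positive for degenerate rectangles. *)
pose e := A / (5 * (s + t + 1) ^+ 2).
have st0 : 0 < s + t + 1 by lra.
have e0 : 0 < e by rewrite divr_gt0// mulr_gt0// exprn_gt0.
have [d d0 dP] := lP _ e0.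
have [n nd] : exists n, (s + t + 1) / 2 ^+ n < d.
  exists (Num.truncn ((s + t + 1) / d)).+1.
  rewrite ltr_pdivrMr ?exprn_gt0// mulrC -ltr_pdivrMr//.
  apply: lt_le_trans (truncnS_gt _) _.
  by rewrite -natrX ler_nat ltnW// ltn_expl.
have STn : S n + T n <= (s + t + 1) / 2 ^+ n.
  by rewrite /S /T -mulrDl ler_wpM2r ?invr_ge0 ?exprn_ge0//; lra.
(* The affine part integrates to 0 around every rectangle, so only the remainder of [g] at the
   common point [z] counts. *)
pose E w := g w - (g z + l * (w - z)).
have cA : continuous (fun w => g z + l * (w - z)).
  move=> w; apply: has_cderiv_ccont.
  exact: (cderD (cder_cst (g z) w) (cderZ l (cderB (cder_id w) (cder_cst z w)))).
have cE : continuous E.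
  move=> w; apply: (ccontD (cg w)).
  exact: has_cderiv_ccont (cderN (cderD (cder_cst (g z) w)
    (cderZ l (cderB (cder_id w) (cder_cst z w))))).
have [ha1 ha2 hb1 hb2] := uin n.
have oE : oint g (u n).1 ((u n).1 + S n) (u n).2 ((u n).2 + T n) =
    oint E (u n).1 ((u n).1 + S n) (u n).2 ((u n).2 + T n).
  have sE := continuous_sides (u n).1 ((u n).1 + S n) (u n).2 ((u n).2 + T n) cE.
  have sA := continuous_sides (u n).1 ((u n).1 + S n) (u n).2 ((u n).2 + T n) cA.
  rewrite -[RHS]addr0 -(oint_affine (g z) l z (u n).1 ((u n).1 + S n) (u n).2 ((u n).2 + T n)).
  rewrite -(ointD sE sA).
  apply: (congr1 (fun f => oint f _ _ _ _)).
  by apply/funext => w; rewrite /E subrK.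
have uu1 : (u n).1 <= (u n).1 + S n by rewrite lerDl.
have uu2 : (u n).2 <= (u n).2 + T n by rewrite lerDl.
have := oint_le (M := e * ((s + t + 1) / 2 ^+ n))
   (continuous_sides (u n).1 ((u n).1 + S n) (u n).2 ((u n).2 + T n) cE) uu1 uu2.
rewrite -oE => H.
have {}H : cnorm (oint g (u n).1 ((u n).1 + S n) (u n).2 ((u n).2 + T n)) <=
   4 * (e * ((s + t + 1) / 2 ^+ n)) * ((s + t + 1) / 2 ^+ n).
  apply: le_trans (H _) _.
    move=> w [[/andP[w1 w2] /andP[w3 w4]] _].
    have wz : cnorm (w - z) <= S n + T n.
      apply: le_trans (cnorm_le _) _; rewrite !reimE.
      apply: lerD; first by apply: dist_segment (aP n); rewrite w1 w2.
      by apply: dist_segment (cP n); rewrite w3 w4.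
    have wQ : rect x1 x2 y1 y2 w.
      split; apply/andP; split.
      - exact: le_trans w1. - exact: le_trans ha2.
      - exact: le_trans w3. - exact: le_trans hb2.
    have wd : cnorm (w - z) <= (s + t + 1) / 2 ^+ n by exact: le_trans STn.
    apply: (@le_trans _ _ (e * cnorm (w - z))).
      by rewrite /E opprD addrA; apply: dP wQ _; exact: le_lt_trans nd.
    by rewrite ler_wpM2l// ltW.
  have L0 : 0 <= (s + t + 1) / 2 ^+ n by rewrite divr_ge0 ?exprn_ge0// ltW.
  rewrite (addrAC _ (S n)) subrr add0r (addrAC _ (T n)) subrr add0r.
  apply: ler_wpM2l STn; apply: mulr_ge0 => //; apply: mulr_ge0 => //; exact: ltW.
have {}H : A <= 4 ^+ n * (4 * (e * ((s + t + 1) / 2 ^+ n)) * ((s + t + 1) / 2 ^+ n)).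
  by apply: le_trans (AU n) _; rewrite ler_wpM2l// exprn_ge0.
have n2 : (2 : R) ^+ n != 0 by rewrite expf_neq0.
have E4 : 4 ^+ n * (4 * (e * ((s + t + 1) / 2 ^+ n)) * ((s + t + 1) / 2 ^+ n)) = A * (4 / 5).
  have -> : (4 : R) ^+ n = 2 ^+ n * 2 ^+ n by rewrite -exprMn -natrM.
  by rewrite /e; field; rewrite n2 (gt_eqF st0).
by move: H A0; rewrite E4; clear; lra.
Qed.

(* Retracting the plane onto the rectangle turns a function derivable on the closed
   rectangle into a globally continuous one. *)
Definition clamp a b x := Num.max a (Num.min b x).

Lemma clamp_id a b x : a <= x <= b -> clamp a b x = x.
Proof. by move=> /andP[ax xb]; rewrite /clamp (min_idPr xb) (max_idPr ax). Qed.

Lemma clamp_in a b x : a <= b -> a <= clamp a b x <= b.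
Proof. by move=> ab; rewrite /clamp le_max lexx /= ge_max ab ge_min lexx. Qed.

Lemma clamp_lip a b x y : `|clamp a b x - clamp a b y| <= `|x - y|.
Proof.
wlog xy : x y / x <= y => [hw|].
  by have [/hw//|/hw] := orP (le_total x y); rewrite distrC (distrC y).
rewrite (distrC x) (ger0_norm (_ : 0 <= y - x)) ?subr_ge0//.
have clE u : clamp a b u = if b < u then (if a < b then b else a)
                                   else (if a < u then u else a).
  by rewrite /clamp /Order.max /Order.min; case: (b < u).
rewrite ler_norml !clE; do ?case: ltP => ?; lra.
Qed.

Definition clampr x1 x2 y1 y2 (z : Cplx R) : Cplx R :=
  mkc (clamp x1 x2 (re z)) (clamp y1 y2 (im z)).

Lemma clampr_id x1 x2 y1 y2 z : rect x1 x2 y1 y2 z -> clampr x1 x2 y1 y2 z = z.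
Proof. by case=> h1 h2; rewrite /clampr !clamp_id// -mkcE. Qed.

Lemma clampr_in x1 x2 y1 y2 z : x1 <= x2 -> y1 <= y2 ->
  rect x1 x2 y1 y2 (clampr x1 x2 y1 y2 z).
Proof. by move=> ? ?; split; exact: clamp_in. Qed.

Lemma clampr_lip x1 x2 y1 y2 z w :
  cnorm (clampr x1 x2 y1 y2 z - clampr x1 x2 y1 y2 w) <= 2 * cnorm (z - w).
Proof.
apply: le_trans (cnorm_le _) _; rewrite !reimE /re /im /= mulr_natl mulr2n.
apply: lerD; apply: le_trans (clamp_lip _ _ _ _) _.
  by have := re_le (z - w); rewrite !reimE.
by have := im_le (z - w); rewrite !reimE.
Qed.

Lemma continuous_clampr g x1 x2 y1 y2 : x1 <= x2 -> y1 <= y2 ->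
  (forall z, rect x1 x2 y1 y2 z -> {for z, continuous g}) ->
  continuous (fun z => g (clampr x1 x2 y1 y2 z)).
Proof.
move=> x12 y12 cg z; apply/continuous_cplxP => e e0.
have /continuous_cplxP/(_ _ e0)[d d0 dP] := cg _ (clampr_in z x12 y12).
exists (d / 2); first by rewrite divr_gt0.
move=> w wz; apply: dP; apply: le_lt_trans (clampr_lip _ _ _ _ _ _) _.
by rewrite mulrC -ltr_pdivlMr.
Qed.

Lemma goursat g x1 x2 y1 y2 : x1 <= x2 -> y1 <= y2 ->
  sides_continuous g x1 x2 y1 y2 ->
  (forall z, rect x1 x2 y1 y2 z -> derivable g z 1) -> oint g x1 x2 y1 y2 = 0.
Proof.
move=> x12 y12 sg dg.
have cg : continuous (fun z => g (clampr x1 x2 y1 y2 z)).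
  exact: (continuous_clampr x12 y12 (fun z zQ => derivable_continuous (dg z zQ))).
have gE z : rect x1 x2 y1 y2 z -> g z = g (clampr x1 x2 y1 y2 z).
  by move=> zQ; rewrite clampr_id.
rewrite (oint_eq sg (continuous_sides x1 x2 y1 y2 cg) x12 y12 gE).
apply: (goursat_within cg x12 y12) => z zQ.
have /derivable_has_cderiv/has_cderivP dgz := dg z zQ.
exists (cderiv g z) => e e0; have [d d0 dP] := dgz _ e0; exists d => // w wQ wz.
by have := dP _ wz; rewrite !clampr_id// (addrC z) subrK.
Qed.

End Goursat.

(** * Cauchy's formula on squares *)

Definition osq (R : realType) (g : Cplx R -> Cplx R) (c : Cplx R) (s : R) : Cplx R :=
  oint g (re c - s) (re c + s) (im c - s) (im c + s).

Definition square (R : realType) (c : Cplx R) (s : R) : set (Cplx R) :=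
  rect (re c - s) (re c + s) (im c - s) (im c + s).

Section CauchyFormula.
Context {R : realType}.
Implicit Types (f g F : Cplx R -> Cplx R) (c w z h : Cplx R) (s d : R).

Lemma ccont_line g (l : R -> Cplx R) : line_continuous l ->
  (forall t, ccont g (l t)) -> line_continuous (fun t => g (l t)).
Proof. by move=> cl cg t; apply: (@continuous_comp _ _ _ l g); [exact: cl|exact: cg]. Qed.

Lemma punctured_sides g w x1 x2 y1 y2 : (forall z, z != w -> ccont g z) ->
  x1 != re w -> x2 != re w -> y1 != im w -> y2 != im w ->
  sides_continuous g x1 x2 y1 y2.
Proof.
move=> cg hx1 hx2 hy1 hy2; split; apply: ccont_line.
- exact: continuous_hline.
- by move=> t; apply: cg; apply: contra hy1 => /eqP <-.
- exact: continuous_hline.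
- by move=> t; apply: cg; apply: contra hy2 => /eqP <-.
- exact: continuous_vline.
- by move=> t; apply: cg; apply: contra hx1 => /eqP <-.
- exact: continuous_vline.
- by move=> t; apply: cg; apply: contra hx2 => /eqP <-.
Qed.

(** Four rectangles missing [w] are cut off and Goursat kills each of them. Continuity is asked on
    the whole punctured plane because [rint] works with continuous functions on the full line
    carrying a side. *)
Lemma oint_shrink g w x1 x2 y1 y2 d : 0 < d ->
  x1 <= re w - d -> re w + d <= x2 -> y1 <= im w - d -> im w + d <= y2 ->
  (forall z, z != w -> ccont g z) ->
  (forall z, rect x1 x2 y1 y2 z -> z != w -> derivable g z 1) ->
  oint g x1 x2 y1 y2 = osq g w d.
Proof.
move=> d0 hx1 hx2 hy1 hy2 cg dg; rewrite /osq.
set a1 := re w - d in hx1 *; set a2 := re w + d in hx2 *.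
set b1 := im w - d in hy1 *; set b2 := im w + d in hy2 *.
have a1w : a1 < re w by rewrite /a1; lra.
have a2w : re w < a2 by rewrite /a2; lra.
have b1w : b1 < im w by rewrite /b1; lra.
have b2w : im w < b2 by rewrite /b2; lra.
have x1w := le_lt_trans hx1 a1w; have x2w := lt_le_trans a2w hx2.
have y1w := le_lt_trans hy1 b1w; have y2w := lt_le_trans b2w hy2.
have a12 := lt_trans a1w a2w.
have zero u1 u2 v1 v2 : u1 <= u2 -> v1 <= v2 ->
    x1 <= u1 -> u2 <= x2 -> y1 <= v1 -> v2 <= y2 ->
    u1 != re w -> u2 != re w -> v1 != im w -> v2 != im w ->
    (forall z, rect u1 u2 v1 v2 z -> z != w) -> oint g u1 u2 v1 v2 = 0.
  move=> u12 v12 hu1 hu2 hv1 hv2 n1 n2 n3 n4 zw.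
  apply: (goursat u12 v12 (punctured_sides cg n1 n2 n3 n4)) => z zQ.
  apply: dg; last exact: zw.
  case: zQ => /andP[? ?] /andP[? ?]; split; apply/andP; split;
    [exact: le_trans hu1 _|exact: le_trans _ hu2|exact: le_trans hv1 _|exact: le_trans _ hv2].
rewrite (oint_splitx g x1 a1 x2) (zero x1 a1 y1 y2) ?add0r //; first last.
- move=> z [/andP[_ za] _]; apply/eqP => zw; move: za; rewrite zw; lra.
- by rewrite gt_eqF. - by rewrite lt_eqF. - by rewrite lt_eqF. - by rewrite lt_eqF.
- by apply/ltW/(lt_trans a1w). - by apply/ltW/(lt_trans y1w).
rewrite (oint_splitx g a1 a2 x2) (zero a2 x2 y1 y2) ?addr0 //; first last.
- move=> z [/andP[za _] _]; apply/eqP => zw; move: za; rewrite zw; lra.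
- by rewrite gt_eqF. - by rewrite lt_eqF. - by rewrite gt_eqF. - by rewrite gt_eqF.
- by apply/ltW/(lt_trans x1w). - by apply/ltW/(lt_trans y1w).
rewrite (oint_splity g a1 a2 y1 b1 y2) (zero a1 a2 y1 b1) ?add0r //; first last.
- move=> z [_ /andP[_ za]]; apply/eqP => zw; move: za; rewrite zw; lra.
- by rewrite lt_eqF. - by rewrite lt_eqF. - by rewrite gt_eqF. - by rewrite lt_eqF.
- by apply/ltW/(lt_trans b1w). - exact: ltW.
rewrite (oint_splity g a1 a2 b1 b2 y2) (zero a1 a2 b2 y2) ?addr0 //.
- exact: ltW. - by apply/ltW/(lt_trans y1w).
- by rewrite lt_eqF. - by rewrite gt_eqF. - by rewrite gt_eqF. - by rewrite gt_eqF.
- move=> z [_ /andP[za _]]; apply/eqP => zw; move: za; rewrite zw; lra.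
Qed.

Lemma re_inv z : re z^-1 = re z / (re z ^+ 2 + im z ^+ 2). Proof. by case: z. Qed.
Lemma im_inv z : im z^-1 = - (im z / (re z ^+ 2 + im z ^+ 2)). Proof. by case: z. Qed.

Lemma cder_kernel w z : z != w -> has_cderiv (fun z => (z - w)^-1) z (- 1 / (z - w) ^+ 2).
Proof.
move=> zw; apply: cder_eq (cderV _ (cderB (cder_id z) (cder_cst w z))) _.
  by rewrite subr_eq0.
by rewrite subr0.
Qed.

Lemma ccont_kernel w z : z != w -> ccont (fun z => (z - w)^-1) z.
Proof. by move=> /cder_kernel/has_cderiv_ccont. Qed.

(* The value is 2 pi i, but only its nonvanishing matters: dividing by it replaces
   the winding number computation. *)
Definition cauchy_const (r : R) : Cplx R := osq (fun z => (z - 0)^-1) 0 r.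

Lemma im_oint g x1 x2 y1 y2 : im (oint g x1 x2 y1 y2) =
  rint (fun t => im (g (mkc t y1))) x1 x2 + rint (fun t => re (g (mkc x2 t))) y1 y2
  - rint (fun t => im (g (mkc t y2))) x1 x2 - rint (fun t => re (g (mkc x1 t))) y1 y2.
Proof.
have iM z : im (ci R * z) = re z by rewrite imM /ci /re /im /= mul0r add0r mul1r.
by rewrite /oint !(imD, imN) !iM.
Qed.

(** Each side contributes at least 1 to the imaginary part: up to sign the integrand there is r /
    (t^2 + r^2) >= 1 / (2r), over a length 2r. *)
Lemma cauchy_const_neq0 (r : R) : 0 < r -> cauchy_const r != 0.
Proof.
move=> r0; apply/eqP => /(congr1 (@im R)); rewrite im0; apply/eqP; rewrite gt_eqF//.
have rN : - r != 0 by rewrite oppr_eq0 gt_eqF.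
have [c1 c2 c3 c4] : sides_continuous (fun z : Cplx R => (z - 0)^-1) (0 - r) (0 + r) (0 - r) (0 + r).
  by apply: (punctured_sides (@ccont_kernel 0)); rewrite ?re0 ?im0 ?sub0r ?add0r// gt_eqF.
have k1 := continuous_imP c1; have k2 := continuous_imP c2.
have k3 := continuous_reP c3; have k4 := continuous_reP c4.
rewrite /cauchy_const /osq im_oint re0 im0.
have rle : - r <= r by lra.
have key (t u : R) : - r <= t <= r -> u ^+ 2 = r ^+ 2 -> 1 / (2 * r) <= r / (t ^+ 2 + u ^+ 2).
  move=> /andP[t1 t2] ur; have r2 : 0 < r ^+ 2 by rewrite exprn_gt0.
  rewrite ur ler_pdivrMr ?mulr_gt0// mulrAC ler_pdivlMr ?ltr_wpDl ?sqr_ge0//.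
  by nra.
have q1 := rint_ge (m := 1 / (2 * r)) k1 (_ : 0 - r <= 0 + r) _.
have q2 := rint_ub (M := - (1 / (2 * r))) k2 (_ : 0 - r <= 0 + r) _.
have q3 := rint_ub (M := - (1 / (2 * r))) k3 (_ : 0 - r <= 0 + r) _.
have q4 := rint_ge (m := 1 / (2 * r)) k4 (_ : 0 - r <= 0 + r) _.
move: q1 q2 q3 q4; rewrite !sub0r !add0r => q1 q2 q3 q4.
have {}q1 := q1 rle _. have {}q2 := q2 rle _. have {}q3 := q3 rle _. have {}q4 := q4 rle _.
have E : 1 / (2 * r) * (r - - r) = 1 by field; rewrite gt_eqF.
move: q1 q2 q3 q4; rewrite !mulNr E => q1 q2 q3 q4.
have {}q1 : 1 <= rint (fun t => im (mkc t (- r) - 0)^-1) (- r) r.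
  apply: q1 => x xr; rewrite im_inv subr0 /re /im /= -mulNr opprK; apply: key => //.
  by rewrite sqrrN.
have {}q2 : rint (fun t => im (mkc t r - 0)^-1) (- r) r <= - 1.
  apply: q2 => x xr; rewrite im_inv subr0 /re /im /= lerN2; exact: key.
have {}q3 : rint (fun t => re (mkc (- r) t - 0)^-1) (- r) r <= - 1.
  apply: q3 => x xr; rewrite re_inv subr0 /re /im /= mulNr lerN2 addrC; apply: key => //.
  by rewrite sqrrN.
have {}q4 : 1 <= rint (fun t => re (mkc r t - 0)^-1) (- r) r.
  by apply: q4 => x xr; rewrite re_inv subr0 /re /im /= addrC; apply: key.
lra.
Qed.

Lemma osq_kernel_center w (r : R) : 0 < r ->
  osq (fun z => (z - w)^-1) w r = cauchy_const r.
Proof.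
move=> r0; rewrite /cauchy_const /osq.
have rN : - r != 0 by rewrite oppr_eq0 gt_eqF.
have [c1 c2 c3 c4] : sides_continuous (fun z : Cplx R => (z - w)^-1)
    (re w - r) (re w + r) (im w - r) (im w + r).
  apply: (punctured_sides (@ccont_kernel w)).
  - by rewrite lt_eqF// ltrBlDr ltrDl. - by rewrite gt_eqF// ltrDl.
  - by rewrite lt_eqF// ltrBlDr ltrDl. - by rewrite gt_eqF// ltrDl.
have E x y : (mkc (x + re w) (y + im w) - w)^-1 = (mkc x y - 0)^-1.
  by congr (_^-1); apply: cplx_ext; rewrite !reimE /re /im /= ?subr0 ?oppr0 ?addr0 addrK.
have hE y : y != 0 -> cint (fun t => (mkc t (y + im w) - w)^-1) (re w - r) (re w + r) =
    cint (fun t => (mkc t y - 0)^-1) (- r) r.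
  move=> y0; rewrite -(funext (fun x => E x y)).
  rewrite (cint_shift (re w) (g := fun t => (mkc t (y + im w) - w)^-1)).
    by congr cint; lra.
  apply: (ccont_line (g := fun z => (z - w)^-1) (l := fun t => mkc t (y + im w))); first exact: continuous_hline.
  move=> t; apply: (@ccont_kernel w); apply: contra y0 => /eqP/(congr1 (@im R)).
  by rewrite /im /= => h; apply/eqP; lra.
have vE x : x != 0 -> cint (fun t => (mkc (x + re w) t - w)^-1) (im w - r) (im w + r) =
    cint (fun t => (mkc x t - 0)^-1) (- r) r.
  move=> x0; rewrite -(funext (fun y => E x y)).
  rewrite (cint_shift (im w) (g := fun t => (mkc (x + re w) t - w)^-1)).
    by congr cint; lra.
  apply: (ccont_line (g := fun z => (z - w)^-1) (l := fun t => mkc (x + re w) t)); first exact: continuous_vline.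
  move=> t; apply: (@ccont_kernel w); apply: contra x0 => /eqP/(congr1 (@re R)).
  by rewrite /re /= => h; apply/eqP; lra.
have r0' : r != 0 by rewrite gt_eqF.
rewrite /oint !re0 !im0 !sub0r !add0r -(hE (- r))// -(hE r)//.
by rewrite -(vE (- r))// -(vE r)// ![_ + re w]addrC ![_ + im w]addrC.
Qed.

End CauchyFormula.

Section CauchyEstimates.
Context {R : realType}.
Implicit Types (f g F : Cplx R -> Cplx R) (c w z h : Cplx R) (s d : R).

Lemma square_near c s w d : cnorm (w - c) <= s - d ->
  [/\ re c - s <= re w - d, re w + d <= re c + s,
      im c - s <= im w - d & im w + d <= im c + s].
Proof.
move=> wc; have := re_le (w - c); have := im_le (w - c); rewrite !reimE.
by rewrite !ler_norml => /andP[? ?] /andP[? ?]; split; lra.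
Qed.

Lemma square_ball c s z : square c s z -> cnorm (z - c) <= 2 * s.
Proof.
move=> [/andP[? ?] /andP[? ?]]; apply: le_trans (cnorm_le _) _; rewrite !reimE.
by rewrite mulr_natl mulr2n; apply: lerD; rewrite ler_norml; lra.
Qed.

Lemma square_in c s z : cnorm (z - c) <= s -> square c s z.
Proof.
rewrite -[s in _ <= s]subr0 => /square_near; rewrite !subr0 !addr0 => -[? ? ? ?].
by split; apply/andP; split.
Qed.

Lemma ccont_pow_kernel F w z n : ccont F z -> z != w ->
  ccont (fun z => F z * (z - w)^-1 ^+ n) z.
Proof.
move=> cF zw; elim: n => [|n IH].
  have -> : (fun z => F z * (z - w)^-1 ^+ 0) = F by apply/funext => u; rewrite expr0 mulr1.
  exact: cF.
have -> : (fun z => F z * (z - w)^-1 ^+ n.+1) = (fun z => F z * (z - w)^-1 ^+ n * (z - w)^-1).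
  by apply/funext => u; rewrite exprSr mulrA.
exact: ccontM IH (ccont_kernel zw).
Qed.

Lemma sides_pow_kernel F c s w n : (forall z, ccont F z) -> 0 < s -> cnorm (w - c) < s ->
  sides_continuous (fun z => F z * (z - w)^-1 ^+ n)
    (re c - s) (re c + s) (im c - s) (im c + s).
Proof.
move=> cF s0 wc; apply: (@punctured_sides _ _ w) => [z zw|||| ].
- exact: ccont_pow_kernel.
all: have := re_le (w - c); have := im_le (w - c); rewrite !reimE !ler_norml => /andP[? ?] /andP[? ?].
- by rewrite lt_eqF//; lra. - by rewrite gt_eqF//; lra.
- by rewrite lt_eqF//; lra. - by rewrite gt_eqF//; lra.
Qed.

(** Both the integral of F(z)/(z - w) and F(w) times the kernel integral shrink to a square of half
    side [r] about [w]. There the difference of the integrands is a difference quotient, bounded by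
    |F'(w)| + 1, so the two integrals differ by at most a multiple of [r]. *)
Lemma cauchy_formula F c s w : 0 < s -> (forall z, ccont F z) ->
  (forall z, square c s z -> derivable F z 1) -> cnorm (w - c) < s / 2 ->
  osq (fun z => F z * (z - w)^-1 ^+ 1) c s = F w * cauchy_const (s / 2).
Proof.
move=> s0 cF dF wc; have s20 : 0 < s / 2 by rewrite divr_gt0.
have wQ : square c s w by apply: square_in; lra.
have /derivable_has_cderiv/has_cderivP/(_ 1 ltr01)[d d0 dP] := dF w wQ.
pose M := cnorm (cderiv F w) + 1.
have M0 : 0 < M by rewrite ltr_wpDl// cnorm_ge0.
apply/eqP; rewrite -subr_eq0 -cnorm_eq0 eq_le cnorm_ge0 andbT.
apply/ler_addgt0Pr => e e0; rewrite add0r.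
(* [s / 2] keeps the small square inside both large ones; [d / 3] puts its points, at distance at
   most 2r from [w], in the range of the difference quotient bound; the last entry makes the final
   bound 16 M r at most [e]. *)
pose r := Num.min (s / 2) (Num.min (d / 3) (e / (16 * M))).
have r0 : 0 < r by rewrite !lt_min s20 !divr_gt0// mulr_gt0.
have rs : r <= s / 2 by rewrite ge_min lexx.
have rd : r <= d / 3 by rewrite !ge_min lexx orbT.
have re' : r <= e / (16 * M) by rewrite !ge_min lexx !orbT.
have [q1 q2 q3 q4] : [/\ re c - s <= re w - r, re w + r <= re c + s,
      im c - s <= im w - r & im w + r <= im c + s].
  by apply: square_near; lra.
have [p1 p2 p3 p4] : [/\ re w - s / 2 <= re w - r, re w + r <= re w + s / 2,
      im w - s / 2 <= im w - r & im w + r <= im w + s / 2] by split; lra.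
rewrite /osq (oint_shrink (w := w) r0 q1 q2 q3 q4); first last.
- move=> z zQ zw; apply: (@cder_ex _ _ _ _ (cderM (derivable_has_cderiv (dF z zQ)) _)).
  have -> : (fun z => (z - w)^-1 ^+ 1) = (fun z => (z - w)^-1) by apply/funext => u; rewrite expr1.
  exact: cder_kernel.
- by move=> z zw; apply: ccont_pow_kernel.
rewrite -(osq_kernel_center w s20) /osq.
rewrite (oint_shrink (g := fun z => (z - w)^-1) (w := w) r0 p1 p2 p3 p4); first last.
- by move=> z zQ zw; apply: (@cder_ex _ _ _ _ (cder_kernel zw)).
- by move=> z zw; apply: ccont_kernel.
rewrite /osq.
have sk n (G : Cplx R -> Cplx R) : (forall z, ccont G z) ->
   sides_continuous (fun z => G z * (z - w)^-1 ^+ n) (re w - r) (re w + r) (im w - r) (im w + r).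
  by move=> cG; apply: sides_pow_kernel => //; rewrite subrr cnorm0.
have cG z : ccont (fun z => F z + - F w) z.
  exact: ccontD (cF z) (has_cderiv_ccont (cder_cst (- F w) z)).
have s1 := sk 1%N _ cF.
have s2 := sk 1%N _ cG.
have s3 := sk 1%N _ (fun z => has_cderiv_ccont (cder_cst (1 : Cplx R) z)).
have kE : (fun z => (z - w)^-1) = (fun z => 1 * (z - w)^-1 ^+ 1).
  by apply/funext => z; rewrite expr1 mul1r.
rewrite kE -(ointZ (F w) s3) -(ointB s1 (sidesZ (F w) s3)).
have -> : (fun z => F z * (z - w)^-1 ^+ 1 - F w * (1 * (z - w)^-1 ^+ 1)) =
    (fun z => (F z + - F w) * (z - w)^-1 ^+ 1).
  by apply/funext => z; rewrite mul1r mulrDl mulNr.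
have l1 : re w - r <= re w + r by lra.
have l2 : im w - r <= im w + r by lra.
apply: le_trans (oint_le (M := M) s2 l1 l2 _) _.
  move=> z [/square_ball zr _]; have zd : cnorm (z - w) < d by lra.
  have [->|zw] := eqVneq z w; first by rewrite subrr mul0r cnorm0 ltW.
  rewrite expr1 cnormM cnormV ler_pdivrMr; last by rewrite cnorm_gt0 subr_eq0.
  have := dP _ zd; rewrite (addrC w) subrK mul1r => H.
  rewrite -(subrK (cderiv F w * (z - w)) (F z + - F w)).
  by apply: le_trans (cnormD _ _) _; rewrite cnormM /M; lra.
have -> : 4 * M * (re w + r - (re w - r) + (im w + r - (im w - r))) = r * (16 * M) by ring.
by rewrite -ler_pdivlMr ?mulr_gt0.
Qed.

Lemma edge_far c s w z : cnorm (w - c) < s / 2 -> 0 < s ->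
  edge (re c - s) (re c + s) (im c - s) (im c + s) z ->
  z != w /\ cnorm (z - w)^-1 <= 2 / s.
Proof.
move=> wc s0 [_ ez].
have zc : s <= cnorm (z - c).
  have := re_le (z - c); have := im_le (z - c); rewrite !reimE => h1 h2.
  case: ez => h; move: h1 h2; rewrite h => h1 h2.
  - apply: le_trans h2; rewrite addrAC subrr add0r normrN ger0_norm//; lra.
  - apply: le_trans h2; rewrite addrAC subrr add0r ger0_norm//; lra.
  - apply: le_trans h1; rewrite addrAC subrr add0r normrN ger0_norm//; lra.
  - apply: le_trans h1; rewrite addrAC subrr add0r ger0_norm//; lra.
have zw : s / 2 <= cnorm (z - w).
  by have := cnorm_triangle z w c; lra.
have s20 : 0 < s / 2 by rewrite divr_gt0.
split; first by rewrite -subr_eq0 -cnorm_gt0 (lt_le_trans s20).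
by rewrite cnormV -[2 / s]invf_div lef_pV2 ?posrE// (lt_le_trans s20).
Qed.

Lemma osq_linear_error (P Q S : Cplx R -> Cplx R) c s h (M : R) : 0 < s ->
  sides_continuous P (re c - s) (re c + s) (im c - s) (im c + s) ->
  sides_continuous Q (re c - s) (re c + s) (im c - s) (im c + s) ->
  sides_continuous S (re c - s) (re c + s) (im c - s) (im c + s) ->
  (forall z, edge (re c - s) (re c + s) (im c - s) (im c + s) z ->
     cnorm (P z - Q z - h * S z) <= M) ->
  cnorm (osq P c s - osq Q c s - h * osq S c s) <= 16 * s * M.
Proof.
move=> s0 sP sQ sS PM; rewrite /osq -(ointZ h sS) -(ointB sP sQ).
rewrite -(ointB (sidesB sP sQ) (sidesZ h sS)).
have l1 : re c - s <= re c + s by lra.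
have l2 : im c - s <= im c + s by lra.
apply: le_trans (oint_le (sidesB (sidesB sP sQ) (sidesZ h sS)) l1 l2 PM) _.
by rewrite !(addrAC _ s) !opprD !opprK; lra.
Qed.

Lemma kernel_step w h z : z != w -> z != w + h ->
  (z - (w + h))^-1 = (z - w)^-1 + h * (z - w)^-1 * (z - (w + h))^-1.
Proof.
rewrite -subr_eq0 -(subr_eq0 z (w + h)) => zw zwh.
have {2}-> : h = (z - w) - (z - (w + h)) by ring.
by move: (z - w) (z - (w + h)) zw zwh => u v u0 v0; field; rewrite u0 v0.
Qed.

Definition cauchy_pow F c s n w := osq (fun z => F z * (z - w)^-1 ^+ n) c s.

(** Differentiation under the integral sign made explicit. With u = 1/(z - w) and v = 1/(z - w - h),
    the resolvent identity v = u + h u v gives the exact remainders F u^2 v h^2 and F u^2 v (2u + v)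
    h^2, and on the boundary both |u| and |v| are at most 2/s. *)
Lemma cauchy_pow_expand F c s w h (A : R) : 0 < s -> (forall z, ccont F z) ->
  (forall z, square c s z -> cnorm (F z) <= A) ->
  cnorm (w - c) < s / 2 -> cnorm (w + h - c) < s / 2 ->
  cnorm (cauchy_pow F c s 1 (w + h) - cauchy_pow F c s 1 w - h * cauchy_pow F c s 2 w)
    <= 16 * s * (A * (2 / s) ^+ 3 * cnorm h ^+ 2) /\
  cnorm (cauchy_pow F c s 2 (w + h) - cauchy_pow F c s 2 w - h * (2 * cauchy_pow F c s 3 w))
    <= 16 * s * (A * (3 * (2 / s) ^+ 4) * cnorm h ^+ 2).
Proof.
move=> s0 cF FA wc whc.
have wc' : cnorm (w - c) < s by lra.
have whc' : cnorm (w + h - c) < s by lra.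
have sk n u := @sides_pow_kernel F c s u n cF s0.
have s20 : 0 <= 2 / s by rewrite divr_ge0// ltW.
have main z : edge (re c - s) (re c + s) (im c - s) (im c + s) z ->
    exists u v : Cplx R, [/\ (z - w)^-1 = u, (z - (w + h))^-1 = v, v = u + h * u * v,
      cnorm u <= 2 / s & cnorm v <= 2 / s].
  move=> ez; exists (z - w)^-1, (z - (w + h))^-1.
  have [zw uk] := edge_far wc s0 ez; have [zwh vk] := edge_far whc s0 ez.
  by split=> //; exact: kernel_step.
split.
  apply: osq_linear_error => //; [exact: sk|exact: sk|exact: sk|].
  move=> z ez; have [u [v [-> -> vE uk vk]]] := main z ez.
  have -> : F z * v ^+ 1 - F z * u ^+ 1 - h * (F z * u ^+ 2) = F z * (u * u * v) * h ^+ 2.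
    rewrite {1}vE {1}vE; ring.
  rewrite cnormM cnormX ler_wpM2r ?sqr_ge0// cnormM ler_pM ?cnorm_ge0//.
    by apply: FA; case: ez.
  by rewrite !cnormM !exprS expr0 mulr1 mulrA !ler_pM ?mulr_ge0 ?cnorm_ge0.
rewrite /cauchy_pow -(ointZ 2 (sk 3%N w wc')) -/(osq _ c s).
apply: osq_linear_error => //; [exact: sk|exact: sk|exact: (sidesZ 2 (sk 3%N w wc'))|].
move=> z ez; have [u [v [-> -> vE uk vk]]] := main z ez.
have -> : F z * v ^+ 2 - F z * u ^+ 2 - h * (2 * (F z * u ^+ 3)) =
    F z * (u * u * v * (2 * u + v)) * h ^+ 2.
  have -> : F z * v ^+ 2 - F z * u ^+ 2 - h * (2 * (F z * u ^+ 3)) =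
    F z * ((v - u) * (v + u) - 2 * h * u ^+ 3) by ring.
  have -> : v - u = h * u * v by rewrite {1}vE; ring.
  have -> : h * u * v * (v + u) - 2 * h * u ^+ 3 = h * u * ((v - u) * (v + 2 * u)) by ring.
  have -> : v - u = h * u * v by rewrite {1}vE; ring.
  by ring.
rewrite cnormM cnormX ler_wpM2r ?sqr_ge0// cnormM ler_pM ?cnorm_ge0//.
  by apply: FA; case: ez.
have -> : 3 * (2 / s) ^+ 4 = 2 / s * (2 / s) * (2 / s) * (3 * (2 / s)) by ring.
rewrite !cnormM !ler_pM ?mulr_ge0 ?cnorm_ge0//.
apply: le_trans (cnormD _ _) _; rewrite cnormM.
rewrite cnorm_nat; by lra.
Qed.

End CauchyEstimates.

(** * Regularity of holomorphic functions *)

Section HolomorphicRegularity.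
Context {R : realType}.
Implicit Types (f g F : Cplx R -> Cplx R) (c w z h : Cplx R) (s d : R).

Lemma quadratic_has_cderiv f w l (C d : R) : 0 < d ->
  (forall h, cnorm h < d -> cnorm (f (w + h) - f w - l * h) <= C * cnorm h ^+ 2) ->
  has_cderiv f w l.
Proof.
move=> d0 H; apply/has_cderivP => e e0.
pose C' := `|C| + 1; have C0 : 0 < C' by rewrite ltr_wpDl.
exists (Num.min d (e / C')); first by rewrite lt_min d0 divr_gt0.
move=> h; rewrite lt_min => /andP[hd he]; apply: le_trans (H _ hd) _.
rewrite expr2 mulrA ler_wpM2r ?cnorm_ge0//.
apply: (@le_trans _ _ (C' * cnorm h)).
  by rewrite ler_wpM2r ?cnorm_ge0// /C'; have := ler_norm C; lra.
by rewrite mulrC -ler_pdivlMr// ltW.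
Qed.

Lemma bounded_setP (A : set (Cplx R)) (r : R) : (forall z, A z -> cnorm z <= r) ->
  bounded_set A.
Proof.
move=> Ar; exists (mkc r 0); split; first by rewrite complex_real.
move=> [a b]; rewrite ltcE /= => /andP[/eqP -> ra] z Az /=.
by rewrite cnormE lecE /= eqxx (le_trans (Ar _ Az)) ?ltW.
Qed.

Lemma square_bound F c s : (forall z, ccont F z) ->
  exists A, forall z, square c s z -> cnorm (F z) <= A.
Proof.
move=> cF; have bS : bounded_set (square c s).
  apply: (@bounded_setP _ (2 * s + cnorm c)) => z /square_ball zs.
  by rewrite -(subrK c z); apply: le_trans (cnormD _ _) _; rewrite lerD2r.
have [A _ AP] := compact_bound (compact_closure bS) (fun z _ => cF z).
by exists A => z zS; apply: AP; exact: subset_closure.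
Qed.

(** Cauchy's representation yields the first two derivatives at once. The Taylor remainder has a
    constant depending only on [s] and on the bound [A], which is what uniformity over words will
    require. *)
Lemma cauchy_square F c s (A : R) : 0 < s -> (forall z, ccont F z) ->
  (forall z, square c s z -> derivable F z 1) ->
  (forall z, square c s z -> cnorm (F z) <= A) ->
  let I := (cauchy_const (s / 2))^-1 in
  forall w, cnorm (w - c) < s / 2 ->
  [/\ has_cderiv F w (I * cauchy_pow F c s 2 w),
      has_cderiv (fun w => I * cauchy_pow F c s 2 w) w (I * (2 * cauchy_pow F c s 3 w)) &
      forall h, cnorm (w + h - c) < s / 2 ->
        cnorm (F (w + h) - F w - (I * cauchy_pow F c s 2 w) * h) <=
        cnorm I * (16 * s * (A * (2 / s) ^+ 3 * cnorm h ^+ 2))].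
Proof.
move=> s0 cF dF FA I w wc; have s20 : 0 < s / 2 by rewrite divr_gt0.
have FE u : cnorm (u - c) < s / 2 -> F u = I * cauchy_pow F c s 1 u.
  move=> uc; rewrite /cauchy_pow cauchy_formula// mulrC mulfK//.
  exact: cauchy_const_neq0.
have near h : cnorm h < s / 2 - cnorm (w - c) -> cnorm (w + h - c) < s / 2.
  by rewrite addrAC => ?; apply: le_lt_trans (cnormD _ _) _; lra.
have r0 : 0 < s / 2 - cnorm (w - c) by rewrite subr_gt0.
have T h : cnorm (w + h - c) < s / 2 ->
    cnorm (F (w + h) - F w - (I * cauchy_pow F c s 2 w) * h) <=
    cnorm I * (16 * s * (A * (2 / s) ^+ 3 * cnorm h ^+ 2)).
  move=> whc; rewrite (FE _ wc) (FE _ whc).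
  have [H _] := cauchy_pow_expand s0 cF FA wc whc.
  have -> : I * cauchy_pow F c s 1 (w + h) - I * cauchy_pow F c s 1 w -
      I * cauchy_pow F c s 2 w * h = I * (cauchy_pow F c s 1 (w + h) -
      cauchy_pow F c s 1 w - h * cauchy_pow F c s 2 w) by ring.
  by rewrite cnormM ler_wpM2l ?cnorm_ge0.
split; last exact: T.
  apply: (@quadratic_has_cderiv _ _ _ (cnorm I * (16 * s * (A * (2 / s) ^+ 3))) _ r0) => h hr.
  by apply: le_trans (T _ (near _ hr)) _; rewrite !mulrA.
apply: cderZ; apply: (@quadratic_has_cderiv _ _ _ (16 * s * (A * (3 * (2 / s) ^+ 4))) _ r0) => h hr.
have [_ H] := cauchy_pow_expand s0 cF FA wc (near _ hr).
by rewrite (mulrC _ h); apply: le_trans H _; rewrite !mulrA.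
Qed.

Lemma derivable_near f F w : (\forall u \near w, F u = f u) -> derivable f w 1 ->
  derivable F w 1.
Proof.
move=> Ff /derivable_has_cderiv df; apply: (@cder_ex _ _ _ (cderiv f w)).
by apply: has_cderiv_near df; apply: filterS Ff => u ->.
Qed.

(** Replaces a function known only on a disc by a globally continuous one, as the integrals demand,
    by retracting the plane onto the square of half side r/3, which lies in the disc. The square of
    half side r/9 lies within 2r/9 of [c], hence in the region where both functions agree near each
    point. *)
Lemma cauchy_ball f c (r : R) : 0 < r ->
  (forall w, cnorm (w - c) < r -> derivable f w 1) ->
  exists F, [/\ forall z, ccont F z,
    forall z, square c (r / 9) z -> derivable F z 1,
    forall z, square c (r / 9) z -> F z = f z &
    forall w, cnorm (w - c) < r / 3 -> \forall u \near w, F u = f u].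
Proof.
move=> r0 df; pose s := r / 3; have s0 : 0 < s by rewrite divr_gt0.
have sr z : square c s z -> derivable f z 1.
  by move=> /square_ball zc; apply: df; rewrite /s in zc; lra.
have l1 : re c - s <= re c + s by lra.
have l2 : im c - s <= im c + s by lra.
pose F z := f (clampr (re c - s) (re c + s) (im c - s) (im c + s) z).
have FE z : square c s z -> F z = f z by move=> zQ; rewrite /F clampr_id.
have Fn w : cnorm (w - c) < s -> \forall u \near w, F u = f u.
  move=> wc; apply/nbhs_cplxP; exists (s - cnorm (w - c)); first by rewrite subr_gt0.
  by move=> u uw; apply/FE/square_in; have := cnorm_triangle u w c; lra.
have small z : square c (r / 9) z -> cnorm (z - c) < s.
  by move=> /square_ball zc; rewrite /s in s0 *; lra.
exists F; split=> [|z zQ|z zQ|]; last exact: Fn.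
- exact: (continuous_clampr l1 l2 (fun z zQ => derivable_continuous (sr z zQ))).
- apply: derivable_near (Fn _ (small _ zQ)) _; apply: df.
  by apply: lt_trans (small _ zQ) _; rewrite /s; lra.
- by apply/FE/square_in/ltW; exact: small.
Qed.

Lemma cauchy_local f c (r : R) : 0 < r ->
  (forall w, cnorm (w - c) < r -> derivable f w 1) ->
  derivable (cderiv f) c 1.
Proof.
move=> r0 df; have [F [cF dF Ff Fn]] := cauchy_ball r0 df.
have s0 : 0 < r / 9 by rewrite divr_gt0.
have [A FA] := square_bound c (r / 9) cF.
have CS := cauchy_square s0 cF dF FA.
have dc w : cnorm (w - c) < r / 9 / 2 ->
    cderiv f w = (cauchy_const (r / 9 / 2))^-1 * cauchy_pow F c (r / 9) 2 w.
  move=> wc; have [dFw _ _] := CS w wc; apply: cderivE.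
  by apply: has_cderiv_near dFw; apply: Fn; lra.
have cc : cnorm (c - c) < r / 9 / 2 by rewrite subrr cnorm0 divr_gt0.
have [_ d2 _] := CS c cc.
apply: (@cder_ex _ _ _ _ (has_cderiv_near _ d2)).
apply/nbhs_cplxP; exists (r / 9 / 2); first by rewrite divr_gt0.
by move=> w wc; rewrite dc.
Qed.

(** The order of quantifiers is the point: [C] and [d] depend on [r] alone, so a single increment
    [h] can serve the T-differences of all pairs of words. *)
Lemma cauchy_taylor (r : R) : 0 < r -> exists C d : R, [/\ 0 <= C, 0 < d &
  forall f c (A : R), (forall w, cnorm (w - c) < r -> derivable f w 1) ->
    (forall w, cnorm (w - c) < r -> cnorm (f w) <= A) ->
    forall h, cnorm h < d ->
      cnorm (f (c + h) - f c - cderiv f c * h) <= C * A * cnorm h ^+ 2].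
Proof.
move=> r0; have s0 : 0 < r / 9 by rewrite divr_gt0.
pose I := (cauchy_const (r / 9 / 2))^-1.
exists (cnorm I * (16 * (r / 9) * (2 / (r / 9)) ^+ 3)), (r / 9 / 2); split.
- have k0 : 0 <= 2 / (r / 9) by rewrite divr_ge0// ltW.
  by apply: mulr_ge0 (cnorm_ge0 _) _; apply: mulr_ge0 _ (exprn_ge0 _ k0); lra.
- by rewrite divr_gt0.
move=> f c A df fA h hd; have [F [cF dF Ff Fn]] := cauchy_ball r0 df.
have FA z : square c (r / 9) z -> cnorm (F z) <= A.
  by move=> zQ; rewrite Ff//; apply: fA; move: zQ => /square_ball; lra.
have cc : cnorm (c - c) < r / 9 / 2 by rewrite subrr cnorm0 divr_gt0.
have [dFc _ T] := cauchy_square s0 cF dF FA cc.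
have dfc : cderiv f c = I * cauchy_pow F c (r / 9) 2 c.
  by apply: cderivE; apply: has_cderiv_near dFc; apply: Fn; lra.
have hc : cnorm (c + h - c) < r / 9 / 2 by rewrite (addrC c) addrK.
have := T h hc; rewrite dfc !Ff.
- by move=> H; apply: le_trans H _; rewrite -/I le_eqVlt; apply/orP; left; apply/eqP; ring.
- by apply: square_in; rewrite subrr cnorm0 ltW.
- by apply: square_in; rewrite (addrC c) addrK ltW// (lt_le_trans hd); lra.
Qed.

Lemma holomorphic_cderiv (U : set (Cplx R)) f : open U -> holomorphic_on U f ->
  holomorphic_on U (cderiv f).
Proof.
move=> /open_cplxP oU hf z /oU[e e0 eU]; apply: (cauchy_local e0) => w wz.
exact/hf/eU.
Qed.

End HolomorphicRegularity.

(** * Primitives of entire functions *)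

Section EntirePrimitive.
Context {R : realType}.
Implicit Types (g F : Cplx R -> Cplx R) (z h : Cplx R).

Lemma oint_swapx g (x1 x2 y1 y2 : R) : oint g x2 x1 y1 y2 = - oint g x1 x2 y1 y2.
Proof. by rewrite /oint (cint_swap _ x1 x2) (cint_swap _ x1 x2); ring. Qed.

Lemma oint_swapy g (x1 x2 y1 y2 : R) : oint g x1 x2 y2 y1 = - oint g x1 x2 y1 y2.
Proof. by rewrite /oint (cint_swap _ y1 y2) (cint_swap _ y1 y2); ring. Qed.

Lemma entire_lines g : (forall z, derivable g z 1) ->
  (forall y, line_continuous (fun t => g (mkc t y))) /\
  (forall x, line_continuous (fun t => g (mkc x t))).
Proof.
move=> dg; have cg z : ccont g z by apply: derivable_continuous.
by split=> u; apply: ccont_line => //; [exact: continuous_hline|exact: continuous_vline].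
Qed.

Lemma oint_entire g (x1 x2 y1 y2 : R) : (forall z, derivable g z 1) ->
  oint g x1 x2 y1 y2 = 0.
Proof.
move=> dg; have [ch cv] := entire_lines dg.
wlog x12 : x1 x2 / x1 <= x2 => [hw|].
  have [/hw//|/hw] := orP (le_total x1 x2); rewrite oint_swapx => /eqP.
  by rewrite oppr_eq0 => /eqP.
wlog y12 : y1 y2 / y1 <= y2 => [hw|].
  have [/hw//|/hw] := orP (le_total y1 y2); rewrite oint_swapy => /eqP.
  by rewrite oppr_eq0 => /eqP.
apply: goursat => //.
Qed.

Lemma cnorm_ci z : cnorm (ci R * z) = cnorm z.
Proof. by rewrite cnormM /ci cnorm_mkc0x normr1 mul1r. Qed.

(* Integral along the L-shaped path: first horizontal, then vertical. *)
Definition entire_prim g z0 z : Cplx R :=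
  cint (fun t => g (mkc t (im z0))) (re z0) (re z) +
  ci R * cint (fun t => g (mkc (re z) t)) (im z0) (im z).

(** The L-shaped path may be restarted at [z]: the discrepancy is the integral around a rectangle,
    which vanishes for entire [g]. *)
Lemma entire_prim_diff g z0 z w : (forall z, derivable g z 1) ->
  entire_prim g z0 w - entire_prim g z0 z =
  cint (fun t => g (mkc t (im z))) (re z) (re w) +
  ci R * cint (fun t => g (mkc (re w) t)) (im z) (im w).
Proof.
move=> dg; have H := oint_entire (re z) (re w) (im z0) (im z) dg.
apply/eqP; rewrite -subr_eq0; apply/eqP; rewrite -[RHS]H /oint /entire_prim.
rewrite -(cint_add _ (re z0) (re z) (re w)) -(cint_add _ (im z0) (im z) (im w)).
ring.
Qed.

Lemma entire_prim_has_cderiv g z0 z : (forall z, derivable g z 1) ->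
  has_cderiv (entire_prim g z0) z (g z).
Proof.
move=> dg; have [ch cv] := entire_lines dg.
apply/has_cderivP => e e0.
(* Each of the two legs costs 2 * (e/4) times its length, which is at most |h|. On the second leg
   both coordinates have moved, by up to 2|h| in total, hence the radius [d / 2] below. *)
have /continuous_cplxP/(_ (e / 4))[|d d0 dP] : ccont g z by exact: derivable_continuous.
  by rewrite divr_gt0.
exists (d / 2); first by rewrite divr_gt0.
move=> h hd; rewrite (entire_prim_diff z0 z (z + h) dg).
set x := re z; set y := im z; set x' := re (z + h); set y' := im (z + h).
have x'x : x' - x = re h by rewrite /x' reD addrC addKr.
have y'y : y' - y = im h by rewrite /y' imD addrC addKr.
have hE : g z * h = g z * mkc (x' - x) 0 + ci R * (g z * mkc (y' - y) 0).
  rewrite x'x y'y {1}(mkcE h); apply: cplx_ext; rewrite !reimE /ci /re /im /=; ring.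
pose k := - g z.
have kc := @continuous_cst_line R k.
rewrite hE -!cint_cst.
have E1 : cint (fun t => g (mkc t y)) x x' - cint (fun=> g z) x x' =
    cint (fun t => g (mkc t y) + k) x x'.
  by rewrite (cintD _ _ (ch y) kc) !cint_cst /k mulNr.
have E2 : cint (fun t => g (mkc x' t)) y y' - cint (fun=> g z) y y' =
    cint (fun t => g (mkc x' t) + k) y y'.
  by rewrite (cintD _ _ (cv x') kc) !cint_cst /k mulNr.
rewrite opprD addrACA E1 -mulrBr E2.
have hx : `|x' - x| <= cnorm h by rewrite x'x re_le.
have hy : `|y' - y| <= cnorm h by rewrite y'y im_le.
have btw (a b t : R) : Num.min a b <= t <= Num.max a b -> `|t - a| <= `|b - a|.
  rewrite ge_min le_max => /andP[/orP[] h1 /orP[] h2].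
  - have -> : t = a by lra. by rewrite subrr normr0.
  - by rewrite !ger0_norm; lra.
  - by rewrite (ler0_norm (_ : t - a <= 0)) ?(ler0_norm (_ : b - a <= 0)); lra.
  - have -> : t = b by lra. by [].
have e4 w : cnorm (w - z) < d -> cnorm (g w + k) <= e / 4.
  by move=> /dP/ltW.
have n1 : cnorm (cint (fun t => g (mkc t y) + k) x x') <= 2 * (e / 4) * `|x' - x|.
  apply: cint_le; first exact: (continuousD_line (ch y) kc).
  move=> t /btw tx; apply: e4; apply: le_lt_trans (cnorm_le _) _.
  rewrite !reimE /re /im /= -/(re z) -/(im z) subrr normr0 addr0.
  by apply: le_lt_trans tx _; lra.
have n2 : cnorm (cint (fun t => g (mkc x' t) + k) y y') <= 2 * (e / 4) * `|y' - y|.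
  apply: cint_le; first exact: (continuousD_line (cv x') kc).
  move=> t /btw ty; apply: e4; apply: le_lt_trans (cnorm_le _) _.
  by rewrite !reimE [re (mkc _ _)]/= [im (mkc _ _)]/=; lra.
apply: le_trans (cnormD _ _) _; rewrite cnorm_ci.
apply: le_trans (lerD n1 n2) _.
have e2 : 0 <= 2 * (e / 4) by lra.
by have := ler_wpM2l e2 hx; have := ler_wpM2l e2 hy; lra.
Qed.

(** The bound on [g] is asked on a full vertical strip: the peak functions are controlled by the
    real part of their argument only. *)
Lemma entire_prim_le g z0 z (M : R) : (forall z, derivable g z 1) ->
  (forall w, Num.min (re z0) (re z) <= re w <= Num.max (re z0) (re z) -> cnorm (g w) <= M) ->
  cnorm (entire_prim g z0 z) <= 2 * M * (`|re z - re z0| + `|im z - im z0|).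
Proof.
move=> dg gM; have [ch cv] := entire_lines dg.
have rz : Num.min (re z0) (re z) <= re z <= Num.max (re z0) (re z).
  by rewrite ge_min le_max !lexx !orbT.
have n1 := cint_le (M := M) (a := re z0) (b := re z) (ch (im z0)) (fun t tt => gM (mkc t _) tt).
have n2 := cint_le (M := M) (a := im z0) (b := im z) (cv (re z)) (fun t _ => gM (mkc (re z) t) rz).
apply: le_trans (cnormD _ _) _; rewrite cnorm_ci mulrDr.
exact: lerD n1 n2.
Qed.

End EntirePrimitive.

(** * Complex exponential *)

Definition cexp (R : realType) (z : Cplx R) : Cplx R :=
  mkc (expR (re z) * cos (im z)) (expR (re z) * sin (im z)).

Section ComplexExponential.
Context {R : realType}.
Implicit Types (z w h : Cplx R).

Lemma is_derive_eps (f : R -> R) (x l : R) : is_derive x (1 : R) f l ->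
  forall e : R, 0 < e -> exists2 d, 0 < d &
    forall h : R, `|h| < d -> `|f (x + h) - f x - l * h| <= e * `|h|.
Proof.
move=> [df <-] e e0; have /cvgrPdist_lt/(_ _ e0) := df.
rewrite /dnbhs /within /= => /nbhs_normP[d /= d0 H].
exists d => // h hd; have [->|h0] := eqVneq h 0.
  by rewrite addr0 mulr0 !subr0 subrr normr0 mulr0.
have := H h; rewrite /= sub0r normrN => /(_ hd h0) /ltW.
rewrite distrC /GRing.scale /= mulr1 (addrC h) => H'.
rewrite -ler_pdivrMr ?normr_gt0// -normfV -normrM.
apply: le_trans H'; rewrite le_eqVlt; apply/orP; left; apply/eqP.
by congr `|_|; rewrite -[lim _]/('D_1 f x); field.
Qed.

Lemma cexp0 : cexp (0 : Cplx R) = 1.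
Proof. by rewrite /cexp re0 im0 expR0 cos0 sin0 mulr1 mulr0. Qed.

Lemma cexpD z w : cexp (z + w) = cexp z * cexp w.
Proof.
by apply: cplx_ext; rewrite !reimE /re /im /= -/(re _) -/(im _) !reimE expRD ?cosD ?sinD; ring.
Qed.

Lemma cnorm_cexp z : cnorm (cexp z) = expR (re z).
Proof.
rewrite /cnorm /= !exprMn -mulrDr cos2Dsin2 mulr1 sqrtr_sqr ger0_norm// expR_ge0//.
Qed.

Lemma cexp_neq0 z : cexp z != 0.
Proof. by rewrite -cnorm_gt0 cnorm_cexp expR_gt0. Qed.

Lemma cexp_has_cderiv0 : has_cderiv (@cexp R) 0 1.
Proof.
apply/has_cderivP => e e0.
(* The real part of the remainder will cost 3 and the imaginary part 5 units of (e/8)|h|. The 1 in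
   the minimum provides the crude bounds |exp x - 1| <= 2|x| and |sin y| <= 2|y|. *)
have e4 : 0 < Num.min 1 (e / 8) by rewrite lt_min ltr01 divr_gt0.
have dE : is_derive (0 : R) (1 : R) (@expR R) 1.
  by have := is_derive_expR (0 : R); rewrite expR0.
have dC : is_derive (0 : R) (1 : R) (@cos R) 0.
  by have := is_derive_cos (0 : R); rewrite sin0 oppr0.
have dS : is_derive (0 : R) (1 : R) (@sin R) 1.
  by have := is_derive_sin (0 : R); rewrite cos0.
have [d1 d10 P1] := is_derive_eps dE e4.
have [d2 d20 P2] := is_derive_eps dC e4.
have [d3 d30 P3] := is_derive_eps dS e4.
pose d := Num.min (Num.min d1 d2) (Num.min d3 (Num.min 1 (e / 8))).
exists d; first by rewrite !lt_min d10 d20 d30 -lt_min.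
move=> h; rewrite !lt_min => /and3P[/andP[h1 h2] h3 /andP[h4 h5]].
rewrite add0r cexp0 mul1r; set x := re h; set y := im h.
have xh : `|x| <= cnorm h by exact: re_le.
have yh : `|y| <= cnorm h by exact: im_le.
set k := Num.min 1 (e / 8) in e4 P1 P2 P3.
have k1 : k <= 1 by rewrite ge_min lexx.
have ke : k <= e / 8 by rewrite ge_min lexx orbT.
have := P1 x (le_lt_trans xh h1); rewrite add0r expR0 mul1r => E1.
have := P2 y (le_lt_trans yh h2); rewrite add0r cos0 mul0r subr0 => E2.
have := P3 y (le_lt_trans yh h3); rewrite add0r sin0 mul1r subr0 => E3.
have k0 := ltW e4; have x0 := normr_ge0 x; have y0 := normr_ge0 y.
have kx : k * `|x| <= e / 8 * cnorm h.
  by apply: ler_pM => //.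
have ky : k * `|y| <= e / 8 * cnorm h.
  by apply: ler_pM => //.
have kx1 : k * `|x| <= `|x| by rewrite ler_piMl.
have ky1 : k * `|y| <= `|y| by rewrite ler_piMl.
have E3' := le_trans E3 ky.
have B1 : `|expR x - 1| <= 2 * `|x|.
  rewrite -(subrK x (expR x - 1)); apply: le_trans (ler_normD _ _) _.
  by move: E1 kx1; clear; lra.
have B2 : `|sin y| <= 2 * `|y|.
  rewrite -(subrK y (sin y)); apply: le_trans (ler_normD _ _) _.
  by move: E3 ky1; clear; lra.
apply: le_trans (cnorm_le _) _; rewrite !reimE /cexp /re /im /= -/(re h) -/(im h) -/x -/y oppr0 addr0.
have x1 : `|x| <= 1 by apply: le_trans xh _; exact: ltW.
have R1 : `|expR x * cos y - 1 - x| <= 3 * (e / 8 * cnorm h).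
  have -> : expR x * cos y - 1 - x = (expR x - 1 - x) * cos y + (1 + x) * (cos y - 1) by ring.
  apply: le_trans (ler_normD _ _) _; rewrite !normrM.
  have c1 : `|expR x - 1 - x| * `|cos y| <= e / 8 * cnorm h.
    by apply: le_trans kx; apply: le_trans E1; rewrite ler_piMr// cos_max.
  have c2 : `|1 + x| * `|cos y - 1| <= 2 * (e / 8 * cnorm h).
    apply: ler_pM => //; last exact: le_trans ky.
    by apply: le_trans (ler_normD _ _) _; rewrite normr1; move: x1; clear; lra.
  by apply: le_trans (lerD c1 c2) _; clear; lra.
have R2 : `|expR x * sin y - y| <= 5 * (e / 8 * cnorm h).
  have -> : expR x * sin y - y = (expR x - 1) * sin y + (sin y - y) by ring.
  apply: le_trans (ler_normD _ _) _; rewrite normrM.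
  have c1 : `|expR x - 1| * `|sin y| <= 4 * (e / 8 * cnorm h).
    apply: (@le_trans _ _ (2 * `|x| * (2 * `|y|))); first exact: ler_pM.
    have : `|x| * `|y| <= e / 8 * cnorm h by apply: ler_pM => //; apply: le_trans xh _; exact: ltW.
    by rewrite mulrACA; clear; lra.
  by apply: le_trans (lerD c1 E3') _; clear; lra.
have := lerD R1 R2; clear; lra.
Qed.

Lemma cexp_has_cderiv z : has_cderiv (@cexp R) z (cexp z).
Proof.
have /has_cderivP H := cexp_has_cderiv0; apply/has_cderivP => e e0.
have n0 : 0 < cnorm (cexp z) by rewrite cnorm_gt0 cexp_neq0.
have [d d0 dP] := H _ (divr_gt0 e0 n0); exists d => // h /dP.
rewrite add0r cexp0 mul1r => H'; rewrite cexpD.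
have -> : cexp z * cexp h - cexp z - cexp z * h = cexp z * (cexp h - 1 - h) by ring.
by rewrite cnormM mulrC -ler_pdivlMr// mulrAC.
Qed.

Lemma cexp_near1 : exists2 d : R, 0 < d &
  forall h, cnorm h < d -> cnorm (cexp h - 1) <= 2 * cnorm h.
Proof.
have /has_cderivP/(_ 1 ltr01)[d d0 dP] := cexp_has_cderiv0.
exists d => // h /dP; rewrite add0r cexp0 !mul1r => H.
by rewrite -(subrK h (cexp h - 1)); apply: le_trans (cnormD _ _) _; lra.
Qed.

End ComplexExponential.

(** * Iterated function systems *)

Section CompositionRules.
Context {R : realType}.
Implicit Types (f g : Cplx R -> Cplx R) (U V W : set (Cplx R)) (z : Cplx R).

Definition conformal_on U f := holomorphic_on U f /\ forall z, U z -> cderiv f z != 0.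

Lemma quotient_rule_alg (a b a' b' : Cplx R) : a != 0 -> b != 0 ->
  (a' * b * b + a * b') / (a * b) = a' / a * b + b' / b.
Proof. by move=> a0 b0; field; rewrite a0 b0. Qed.

(** In T' of a composition the mixed term T_f(g) g'' cancels the cross term of T^2/2, because g'' =
    T_g g'. This is why S obeys a chain rule free of T. *)
Lemma schwarzian_rule_alg (a b c d e t1 t0 g2 : Cplx R) :
  t1 = a * b ^+ 2 + c * g2 + e -> t0 = c * b + d -> g2 = d * b ->
  t1 - 2^-1 * t0 ^+ 2 = (a - 2^-1 * c ^+ 2) * b ^+ 2 + (e - 2^-1 * d ^+ 2).
Proof. by move=> -> -> ->; field. Qed.

Lemma open_near U z : open U -> U z -> \forall w \near z, U w.
Proof. by rewrite openE => oU /oU. Qed.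

Lemma holo_has_cderiv U f z : holomorphic_on U f -> U z -> has_cderiv f z (cderiv f z).
Proof. by move=> hf /hf/derivable_has_cderiv. Qed.

Lemma preschwarzian_holo U f : open U -> conformal_on U f ->
  holomorphic_on U (preschwarzian f).
Proof.
move=> oU [hf f0] z Uz; have h1 := holomorphic_cderiv oU hf.
have h2 := holomorphic_cderiv oU h1.
exact: cder_ex (cder_div (f0 z Uz) (holo_has_cderiv h2 Uz) (holo_has_cderiv h1 Uz)).
Qed.

Lemma preschwarzianE U f z : conformal_on U f -> U z ->
  cderiv (cderiv f) z = preschwarzian f z * cderiv f z.
Proof. by move=> [_ f0] /f0 fz0; rewrite /preschwarzian mulfVK. Qed.

Lemma conformal_comp V W f g : open V -> open W -> conformal_on W f ->
  conformal_on V g -> (forall z, V z -> W (g z)) -> forall z, V z ->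
  has_cderiv (fun w => f (g w)) z (cderiv f (g z) * cderiv g z).
Proof.
move=> oV oW [hf _] [hg _] VW z Vz.
exact: cder_comp (holo_has_cderiv hf (VW z Vz)) (holo_has_cderiv hg Vz).
Qed.

Lemma conformal_on_comp V W f g : open V -> open W -> conformal_on W f ->
  conformal_on V g -> (forall z, V z -> W (g z)) -> conformal_on V (fun w => f (g w)).
Proof.
move=> oV oW cf cg VW; have dc := conformal_comp oV oW cf cg VW.
split=> z Vz; first exact: cder_ex (dc z Vz).
rewrite (cderivE (dc z Vz)); apply: mulf_neq0; last exact: cg.2.
by apply: cf.2; exact: VW.
Qed.

Lemma preschwarzian_comp V W f g z : open V -> open W -> conformal_on W f ->
  conformal_on V g -> (forall z, V z -> W (g z)) -> V z ->
  preschwarzian (fun w => f (g w)) z =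
    preschwarzian f (g z) * cderiv g z + preschwarzian g z.
Proof.
move=> oV oW cf cg VW Vz; have dc := conformal_comp oV oW cf cg VW.
have [hf f0] := cf; have [hg g0] := cg.
have hf1 := holomorphic_cderiv oW hf; have hg1 := holomorphic_cderiv oV hg.
have d2 := cderM (cder_comp (holo_has_cderiv hf1 (VW z Vz)) (holo_has_cderiv hg Vz))
  (holo_has_cderiv hg1 Vz).
have E2 : cderiv (cderiv (fun w => f (g w))) z =
    cderiv (cderiv f) (g z) * cderiv g z * cderiv g z +
    cderiv f (g z) * cderiv (cderiv g) z.
  apply: cderivE; apply: has_cderiv_near d2.
  by apply: filterS (open_near oV Vz) => w Vw; rewrite (cderivE (dc w Vw)).
rewrite {1}/preschwarzian E2 (cderivE (dc z Vz)) /preschwarzian.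
exact: (quotient_rule_alg _ _ (f0 _ (VW z Vz)) (g0 z Vz)).
Qed.

Lemma cderiv_preschwarzian_comp V W f g z : open V -> open W -> conformal_on W f ->
  conformal_on V g -> (forall z, V z -> W (g z)) -> V z ->
  cderiv (preschwarzian (fun w => f (g w))) z =
    cderiv (preschwarzian f) (g z) * cderiv g z ^+ 2 +
    preschwarzian f (g z) * cderiv (cderiv g) z + cderiv (preschwarzian g) z.
Proof.
move=> oV oW cf cg VW Vz.
have hTf := preschwarzian_holo oW cf; have hTg := preschwarzian_holo oV cg.
have hg1 := holomorphic_cderiv oV cg.1.
have d := cderD (cderM (cder_comp (holo_has_cderiv hTf (VW z Vz)) (holo_has_cderiv cg.1 Vz))
  (holo_has_cderiv hg1 Vz)) (holo_has_cderiv hTg Vz).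
rewrite expr2 mulrA; apply: cderivE; apply: has_cderiv_near d.
by apply: filterS (open_near oV Vz) => w Vw; rewrite (preschwarzian_comp oV oW cf cg VW Vw).
Qed.

Lemma schwarzian_comp V W f g z : open V -> open W -> conformal_on W f ->
  conformal_on V g -> (forall z, V z -> W (g z)) -> V z ->
  schwarzian (fun w => f (g w)) z =
    schwarzian f (g z) * cderiv g z ^+ 2 + schwarzian g z.
Proof.
move=> oV oW cf cg VW Vz.
exact: (schwarzian_rule_alg (cderiv_preschwarzian_comp oV oW cf cg VW Vz)
  (preschwarzian_comp oV oW cf cg VW Vz) (preschwarzianE cg Vz)).
Qed.

Lemma preschwarzian_id z : preschwarzian (id : Cplx R -> Cplx R) z = 0.
Proof.
have d1 w : cderiv (id : Cplx R -> Cplx R) w = 1 by exact: cderivE (cder_id w).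
rewrite /preschwarzian (_ : cderiv id = fun=> 1); last exact/funext.
by rewrite (cderivE (cder_cst _ _)) mul0r.
Qed.

Lemma cderiv_preschwarzian_id z : cderiv (preschwarzian (id : Cplx R -> Cplx R)) z = 0.
Proof.
rewrite (_ : preschwarzian id = fun=> 0); last by apply/funext => w; exact: preschwarzian_id.
exact: cderivE (cder_cst _ _).
Qed.

Lemma schwarzian_id z : schwarzian (id : Cplx R -> Cplx R) z = 0.
Proof.
by rewrite /schwarzian cderiv_preschwarzian_id preschwarzian_id expr0n mulr0 subr0.
Qed.

End CompositionRules.

Section WordCompositions.
Context {R : realType} {N : nat}.
Implicit Types (Phi : 'I_N -> Cplx R -> Cplx R) (s u : seq 'I_N) (Om : set (Cplx R)).

(** [foldl] composes from the outside, whereas the chain rules along words peel off the letter that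
    acts first; the induction therefore runs over an arbitrary accumulator [g]. *)
Lemma fcomp_cons Phi k s : fcomp Phi (k :: s) = (fun z => fcomp Phi s (Phi k z)).
Proof.
suff H (g : Cplx R -> Cplx R) : foldl (fun g i => Phi i \o g) g s = (fun z => fcomp Phi s (g z)).
  by rewrite /fcomp /= H.
elim: s g => [//|j s IH] g.
transitivity (fun z => fcomp Phi s ((Phi j \o g) z)); first exact: IH.
apply/funext => z; have := congr1 (@^~ (g z)) (IH (Phi j \o id)).
by move=> /= <-.
Qed.

(* An open neighbourhood of the closure of Om from which every word composition is
   holomorphic; the Phi_k themselves need not map Om' into itself. *)
Definition ifs_domain Om Om' Phi : set (Cplx R) :=
  [set z | Om' z /\ forall k, Om (Phi k z)].

Definition good_ifs Om Om' Phi :=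
  [/\ open Om, open Om', closure Om `<=` Om' & cifs Om Om' Phi].

Lemma ifs_domain_open Om Om' Phi : good_ifs Om Om' Phi -> open (ifs_domain Om Om' Phi).
Proof.
move=> [oO oOp _ cP]; rewrite openE => z [Opz Oz].
apply: filterI; first exact: open_near.
have ff := @filter_forall _ _ (fun k w => Om (Phi k w)) (nbhs z) (nbhs_filter z).
apply: ff => k.
have [hk _ _ _] := cP k; have [e e0 eO] := (nbhs_cplxP _ _).1 (open_near oO (Oz k)).
have /continuous_cplxP/(_ _ e0)[d d0 dP] := derivable_continuous (hk z Opz).
by apply/nbhs_cplxP; exists d => // w /dP/eO.
Qed.

Lemma ifs_domain_closure Om Om' Phi z : good_ifs Om Om' Phi -> closure Om z ->
  ifs_domain Om Om' Phi z.
Proof. by move=> [_ _ sub cP] Oz; split; [exact: sub|move=> k; have [_ _ h _] := cP k; exact: h]. Qed.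

Lemma ifs_domain_conformal Om Om' Phi k : good_ifs Om Om' Phi ->
  conformal_on (ifs_domain Om Om' Phi) (Phi k).
Proof.
move=> [_ _ _ cP]; have [hk dk _ _] := cP k.
by split=> z [Opz _]; [exact: hk|exact: dk].
Qed.

Lemma ifs_domain_map Om Om' Phi k z : good_ifs Om Om' Phi ->
  ifs_domain Om Om' Phi z -> ifs_domain Om Om' Phi (Phi k z).
Proof.
move=> gi [_ Oz]; apply: (ifs_domain_closure gi); exact/subset_closure/Oz.
Qed.

Lemma fcomp_conformal Om Om' Phi s : good_ifs Om Om' Phi ->
  conformal_on (ifs_domain Om Om' Phi) (fcomp Phi s).
Proof.
move=> gi; elim: s => [|k s IH].
  split=> z _; first exact: cder_ex (cder_id z).
  by rewrite (cderivE (cder_id z)) oner_neq0.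
rewrite fcomp_cons; have oV := ifs_domain_open gi.
apply: (conformal_on_comp oV oV IH (ifs_domain_conformal k gi)) => z.
exact: ifs_domain_map.
Qed.

Lemma preschwarzian_fcomp_cons Om Om' Phi k s z : good_ifs Om Om' Phi ->
  ifs_domain Om Om' Phi z ->
  preschwarzian (fcomp Phi (k :: s)) z =
    preschwarzian (fcomp Phi s) (Phi k z) * cderiv (Phi k) z + preschwarzian (Phi k) z.
Proof.
move=> gi Vz; rewrite fcomp_cons; have oV := ifs_domain_open gi.
by apply: (preschwarzian_comp oV oV (fcomp_conformal s gi) (ifs_domain_conformal k gi)) => // w;
  exact: ifs_domain_map.
Qed.

Lemma cderiv_preschwarzian_fcomp_cons Om Om' Phi k s z : good_ifs Om Om' Phi ->
  ifs_domain Om Om' Phi z ->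
  cderiv (preschwarzian (fcomp Phi (k :: s))) z =
    cderiv (preschwarzian (fcomp Phi s)) (Phi k z) * cderiv (Phi k) z ^+ 2 +
    preschwarzian (fcomp Phi s) (Phi k z) * cderiv (cderiv (Phi k)) z +
    cderiv (preschwarzian (Phi k)) z.
Proof.
move=> gi Vz; rewrite fcomp_cons; have oV := ifs_domain_open gi.
by apply: (cderiv_preschwarzian_comp oV oV (fcomp_conformal s gi) (ifs_domain_conformal k gi)) => // w;
  exact: ifs_domain_map.
Qed.

Lemma schwarzian_fcomp_cons Om Om' Phi k s z : good_ifs Om Om' Phi ->
  ifs_domain Om Om' Phi z ->
  schwarzian (fcomp Phi (k :: s)) z =
    schwarzian (fcomp Phi s) (Phi k z) * cderiv (Phi k) z ^+ 2 + schwarzian (Phi k) z.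
Proof.
move=> gi Vz; rewrite fcomp_cons; have oV := ifs_domain_open gi.
by apply: (schwarzian_comp oV oV (fcomp_conformal s gi) (ifs_domain_conformal k gi)) => // w;
  exact: ifs_domain_map.
Qed.

End WordCompositions.

(** * Contracting cocycles over words *)

Section Cocycles.
Context {R : realType} {N : nat}.
Context (Phi : 'I_N -> Cplx R -> Cplx R) (D : set (Cplx R))
  (X : seq 'I_N -> Cplx R -> Cplx R) (m x : 'I_N -> Cplx R -> Cplx R) (lam A : R).

(* Common form of the chain rules for T and S along words: X s is T_s or S_s, and m k
   is Phi_k' or its square. *)
Definition contracting_cocycle : Prop :=
  [/\ 0 <= lam < 1, forall k z, D z -> D (Phi k z),
      forall z, D z -> X [::] z = 0 /\ forall k s, X (k :: s) z = X s (Phi k z) * m k z + x k z,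
      forall k z, D z -> cnorm (m k z) <= lam & forall k z, D z -> cnorm (x k z) <= A].

Context (cX : contracting_cocycle).

Lemma cocycle_bound s z : 0 <= A -> D z -> cnorm (X s z) <= A / (1 - lam).
Proof.
move=> A0; have [/andP[l0 l1] DPhi XE mle xle] := cX.
have l1' : 0 < 1 - lam by rewrite subr_gt0.
have B0 : 0 <= A / (1 - lam) by rewrite divr_ge0// ltW.
elim: s z => [|k s IH] z Dz; have [X0 Xk] := XE z Dz; first by rewrite X0 cnorm0.
rewrite Xk; apply: le_trans (cnormD _ _) _; rewrite cnormM.
(* The bound is the fixed point of x -> lam x + A, so one more letter preserves it. *)
have -> : A / (1 - lam) = A / (1 - lam) * lam + A by field; rewrite gt_eqF.
by apply: lerD; [apply: ler_pM; rewrite ?cnorm_ge0 ?IH ?mle//; exact: DPhi | exact: xle].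
Qed.

(** Each letter of [s] multiplies the discrepancy by a factor of modulus at most [lam], and after
    all of [s] only a uniformly bounded term is left. *)
Lemma cocycle_cat s u z : 0 <= A -> D z ->
  cnorm (X (s ++ u) z - X s z) <= lam ^+ size s * (A / (1 - lam)).
Proof.
move=> A0; have [/andP[l0 l1] DPhi XE mle xle] := cX.
elim: s z => [|k s IH] z Dz /=; have [X0 Xk] := XE z Dz.
  by rewrite X0 subr0 expr0 mul1r; exact: cocycle_bound.
rewrite !Xk opprD addrACA subrr addr0 -mulrBl cnormM exprSr -mulrA (mulrC lam) mulrA.
by apply: ler_pM; rewrite ?cnorm_ge0 ?IH ?mle//; exact: DPhi.
Qed.

(** The geometric rate provides a uniform limit on [D], so [unif_lim] selects a genuine limit and
    never falls back on its default. *)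
Lemma cocycle_limit (a : nat -> 'I_N) z : 0 <= A -> D z ->
  (fun n => X (mkseq a n) z) @ \oo --> unif_lim D (fun n => X (mkseq a n)) z.
Proof.
move=> A0 Dz; have [/andP[l0 l1] _ _ _ _] := cX.
pose e n := A / (1 - lam) * lam ^+ n.
have e0 : e @ \oo --> 0.
  by apply: cvg_geometric; rewrite ger0_norm.
have [h hP] : {h : Cplx R -> Cplx R & forall w, D w -> forall n, cnorm (X (mkseq a n) w - h w) <= e n}.
  apply: (@choice _ _ (fun w l => D w -> forall n, cnorm (X (mkseq a n) w - l) <= e n)) => w.
  have [Dw|nDw] := pselect (D w); last by exists 0.
  have [|l lP] := cauchy_limit (u := fun n => X (mkseq a n) w) e0; last by exists l.
  move=> n p; rewrite /mkseq iotaD map_cat.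
  by apply: le_trans (cocycle_cat _ _ A0 Dw) _; rewrite size_map size_iota mulrC.
have uh : {uniform D, (fun n => X (mkseq a n)) @ \oo --> h}.
  apply/uniform_cplxP => d d0; move/cvgrPdist_lt : e0 => /(_ d d0).
  apply: filterS => n; rewrite sub0r normrN => en w Dw.
  apply: le_lt_trans (hP w Dw n) _; exact: le_lt_trans (ler_norm _) en.
have /uniform_cplxP U := xgetI (fun=> 0) (uh : [set h : Cplx R -> Cplx R |
   {uniform D, (fun n => X (mkseq a n)) @ \oo --> h}] h).
apply/cvg_cplxP => d d0; apply: filterS (U d d0) => n; exact.
Qed.

End Cocycles.

Section FiniteBounds.
Context {R : realType} {N : nat}.

Lemma compact_bounds (K : set (Cplx R)) (f : 'I_N -> Cplx R -> Cplx R) : compact K ->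
  (forall k z, K z -> ccont (f k) z) ->
  exists2 M, 0 <= M & forall k z, K z -> cnorm (f k z) <= M.
Proof.
move=> cK cf; have [M MP] : {M : 'I_N -> R & forall k z, K z -> cnorm (f k z) <= M k}.
  apply: (@choice _ _ (fun k M => forall z, K z -> cnorm (f k z) <= M)) => k.
  by have [M _ MP] := compact_bound cK (cf k); exists M.
exists (\big[Num.max/0]_k M k); first exact: bigmax_ge_id.
by move=> k z /MP /le_trans; apply; exact: le_bigmax.
Qed.

Lemma compact_contraction (K : set (Cplx R)) (f : 'I_N -> Cplx R -> Cplx R) : compact K ->
  (forall k z, K z -> ccont (f k) z) -> (forall k z, K z -> cnorm (f k z) < 1) ->
  exists2 M, 0 <= M < 1 & forall k z, K z -> cnorm (f k z) <= M.
Proof.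
move=> cK cf f1.
have [M MP] : {M : 'I_N -> R & forall k, M k < 1 /\ forall z, K z -> cnorm (f k z) <= M k}.
  apply: (@choice _ _ (fun k M => M < 1 /\ forall z, K z -> cnorm (f k z) <= M)) => k.
  have [K0|K0] := pselect (K !=set0); last first.
    by exists 0; split=> // z Kz; exfalso; apply: K0; exists z.
  have [|c Kc cmax] := compact_max (f := fun z => cnorm (f k z)) K0 cK.
    move=> z Kz; apply: (@continuous_comp _ _ _ (f k) (@cnorm R)); first exact: cf.
    exact: continuous_cnorm.
  by exists (cnorm (f k c)); split=> //; exact: f1.
exists (\big[Num.max/0]_k M k).
  rewrite bigmax_ge_id /=; apply/bigmax_ltP; split=> // k _; exact: (MP k).1.
by move=> k z Kz; apply: le_trans ((MP k).2 z Kz) _; exact: le_bigmax.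
Qed.

End FiniteBounds.

(** * From gaps at test points to membership in [GT] and [GS] *)

Section SeparationGap.
Context {R : realType} {N : nat}.
Implicit Types (Phi : 'I_N -> Cplx R -> Cplx R) (Om : set (Cplx R)).

Lemma supnorm_ge Om (h : Cplx R -> Cplx R) z : closure Om z ->
  ((cnorm (h z))%:E <= supnorm Om h)%E.
Proof. by move=> Oz; apply: ereal_sup_ubound; exists z. Qed.

(** Two test points are allowed because for T only the sum of the differences at two nearby points
    can be bounded below; one of them then carries half of it. Infinite words inherit the gap from
    their prefixes. *)
Lemma separation_gap (P : (Cplx R -> Cplx R) -> Cplx R -> Cplx R) Om Phi
    (b1 b2 : 'I_N -> 'I_N -> Cplx R) (tau : R) : 0 < tau ->
  (forall k j, closure Om (b1 k j) /\ closure Om (b2 k j)) ->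
  (forall a z, closure Om z -> (fun n => P (fcomp Phi (mkseq a n)) z) @ \oo -->
      unif_lim (closure Om) (fun n => P (fcomp Phi (mkseq a n))) z) ->
  (forall k j s u, k != j -> 2 * tau <=
     cnorm (P (fcomp Phi (k :: s)) (b1 k j) - P (fcomp Phi (j :: u)) (b1 k j)) +
     cnorm (P (fcomp Phi (k :: s)) (b2 k j) - P (fcomp Phi (j :: u)) (b2 k j))) ->
  (0 < ereal_inf [set supnorm Om (wproj P Om Phi w.1 \- wproj P Om Phi w.2)%R
                 | w in @Zset N])%E.
Proof.
move=> tau0 Ob lim gap.
apply: (@lt_le_trans _ _ tau%:E); first by rewrite lte_fin.
apply: le_ereal_inf_tmp => _ [[v w] Zvw <-].
suff [k [j H]] : exists k j, 2 * tau <=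
    cnorm ((wproj P Om Phi v \- wproj P Om Phi w) (b1 k j)) +
    cnorm ((wproj P Om Phi v \- wproj P Om Phi w) (b2 k j)).
  have [cb1 cb2] := Ob k j.
  have [h|h] := lerP tau (cnorm ((wproj P Om Phi v \- wproj P Om Phi w) (b1 k j))).
    by apply: le_trans (supnorm_ge _ cb1); rewrite lee_fin.
  by apply: le_trans (supnorm_ge _ cb2); rewrite lee_fin; lra.
case: v w Zvw => [s|a] [u|a'] [] //=.
  case: s => [|k s]; case: u => [|j u] //= _ _ kj.
  by exists k, j; apply: gap; apply/eqP => kE; apply: kj; rewrite kE.
move=> _ _ aa; exists (a 0%N), (a' 0%N); set k := a 0%N; set j := a' 0%N.
have kj : k != j by apply/eqP => kE; apply: aa; rewrite -/k kE.
have [cb1 cb2] := Ob k j.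
(* Two words at two points make four approximations by prefixes, each within e/4. Nonempty prefixes
   retain the distinct first letters. *)
apply/ler_addgt0Pr => e e0; have e4 : 0 < e / 4 by rewrite divr_gt0.
have near z b : closure Om z -> exists n0, forall n, (n0 <= n)%N ->
    cnorm (P (fcomp Phi (mkseq b n)) z - wproj P Om Phi (InfWord b) z) < e / 4.
  by move=> Oz; move: (lim b z Oz) => /cvg_cplxP/(_ _ e4)[n0 _ H]; exists n0.
have [n1 h1] := near _ a cb1; have [n2 h2] := near _ a cb2.
have [n3 h3] := near _ a' cb1; have [n4 h4] := near _ a' cb2.
pose n := maxn (maxn n1 n2) (maxn n3 n4).
have {}h1 := h1 n.+1 (leqW (leq_trans (leq_maxl _ _) (leq_maxl _ _))).
have {}h2 := h2 n.+1 (leqW (leq_trans (leq_maxr _ _) (leq_maxl _ _))).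
have {}h3 := h3 n.+1 (leqW (leq_trans (leq_maxl _ _) (leq_maxr _ _))).
have {}h4 := h4 n.+1 (leqW (leq_trans (leq_maxr _ _) (leq_maxr _ _))).
have := gap k j (map a (iota 1 n)) (map a' (iota 1 n)) kj.
rewrite -/(mkseq a n.+1) -/(mkseq a' n.+1) => G; apply: (le_trans G).
have tri (p q p' q' : Cplx R) : cnorm (p - p') < e / 4 -> cnorm (q - q') < e / 4 ->
    cnorm (p - q) <= cnorm (p' - q') + e / 2.
  move=> h h'; have := cnorm_triangle p p' q; have := cnorm_triangle p' q' q.
  by rewrite (cnormB q'); lra.
by have := lerD (tri _ _ _ _ h1 h3) (tri _ _ _ _ h2 h4); lra.
Qed.

End SeparationGap.

Section SeparationCriteria.
Context {R : realType} {N : nat}.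
Implicit Types (Phi : 'I_N -> Cplx R -> Cplx R) (Om : set (Cplx R)).

Definition contraction_bound Om Phi (lam : R) : Prop :=
  0 <= lam < 1 /\ forall k z, closure Om z -> cnorm (cderiv (Phi k) z) <= lam.

Lemma ifs_ccont Om Om' Phi z : good_ifs Om Om' Phi -> closure Om z ->
  forall k, [/\ ccont (Phi k) z, ccont (cderiv (Phi k)) z,
    ccont (preschwarzian (Phi k)) z, ccont (cderiv (preschwarzian (Phi k))) z &
    ccont (cderiv (cderiv (Phi k))) z].
Proof.
move=> gi Oz k; have oV := ifs_domain_open gi; have Vz := ifs_domain_closure gi Oz.
have cf := ifs_domain_conformal k gi; have h1 := holomorphic_cderiv oV cf.1.
have h2 := holomorphic_cderiv oV h1.
have hT := preschwarzian_holo oV cf; have hT1 := holomorphic_cderiv oV hT.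
split; [exact: has_cderiv_ccont (holo_has_cderiv cf.1 Vz)
  |exact: has_cderiv_ccont (holo_has_cderiv h1 Vz)
  |exact: has_cderiv_ccont (holo_has_cderiv hT Vz)
  |exact: has_cderiv_ccont (holo_has_cderiv hT1 Vz)
  |exact: has_cderiv_ccont (holo_has_cderiv h2 Vz)].
Qed.

Lemma ifs_contraction_bound Om Om' Phi : good_ifs Om Om' Phi -> bounded_set Om ->
  exists lam, contraction_bound Om Phi lam.
Proof.
move=> gi bO.
have [|lam l01 lP] := compact_contraction (f := fun k => cderiv (Phi k)) (compact_closure bO)
   (fun k z Oz => let: And5 _ c _ _ _ := ifs_ccont gi Oz k in c).
  by move=> k z; have [_ _ _ cP] := gi; have [_ _ _ h] := cP k; exact: h.
by exists lam.
Qed.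

Lemma closure_map Om Om' Phi k z : good_ifs Om Om' Phi -> closure Om z ->
  closure Om (Phi k z).
Proof. by move=> gi /(ifs_domain_closure gi)[_ H]; exact/subset_closure/H. Qed.

Lemma preschwarzian_cocycle Om Om' Phi lam (A : R) : good_ifs Om Om' Phi ->
  contraction_bound Om Phi lam ->
  (forall k z, closure Om z -> cnorm (preschwarzian (Phi k) z) <= A) ->
  contracting_cocycle Phi (closure Om) (fun s => preschwarzian (fcomp Phi s))
    (fun k => cderiv (Phi k)) (fun k => preschwarzian (Phi k)) lam A.
Proof.
move=> gi [l01 lP] AP; split; [exact: l01| by move=> k z; exact: closure_map gi | |exact: lP|exact: AP].
move=> z Oz; split; first exact: preschwarzian_id.
by move=> k s; exact: (preschwarzian_fcomp_cons k s gi (ifs_domain_closure gi Oz)).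
Qed.

Lemma schwarzian_cocycle Om Om' Phi lam (A : R) : good_ifs Om Om' Phi ->
  contraction_bound Om Phi lam ->
  (forall k z, closure Om z -> cnorm (schwarzian (Phi k) z) <= A) ->
  contracting_cocycle Phi (closure Om) (fun s => schwarzian (fcomp Phi s))
    (fun k z => cderiv (Phi k) z ^+ 2) (fun k => schwarzian (Phi k)) lam A.
Proof.
move=> gi [l01 lP] AP; split; [exact: l01| by move=> k z; exact: closure_map gi | | |exact: AP].
  move=> z Oz; split; first exact: schwarzian_id.
  by move=> k s; exact: (schwarzian_fcomp_cons k s gi (ifs_domain_closure gi Oz)).
move=> k z Oz; rewrite cnormX expr2; have /andP[l0 l1] := l01.
apply: (@le_trans _ _ (lam * lam)); first by apply: ler_pM; rewrite ?cnorm_ge0 ?lP.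
by rewrite ler_piMr// ltW.
Qed.

Lemma preschwarzian_bound Om Om' Phi : good_ifs Om Om' Phi -> bounded_set Om ->
  exists2 A : R, 0 <= A & forall k z, closure Om z -> cnorm (preschwarzian (Phi k) z) <= A.
Proof.
move=> gi bO; apply: (compact_bounds (compact_closure bO)) => k z Oz.
by have [_ _ h _ _] := ifs_ccont gi Oz k; exact: h.
Qed.

Lemma schwarzian_bound Om Om' Phi : good_ifs Om Om' Phi -> bounded_set Om ->
  exists2 A : R, 0 <= A & forall k z, closure Om z -> cnorm (schwarzian (Phi k) z) <= A.
Proof.
move=> gi bO; have [A A0 AP] := preschwarzian_bound gi bO.
have [B B0 BP] : exists2 B : R, 0 <= B & forall k z, closure Om z ->
    cnorm (cderiv (preschwarzian (Phi k)) z) <= B.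
  apply: (compact_bounds (compact_closure bO)) => k z Oz.
  by have [_ _ _ h _] := ifs_ccont gi Oz k; exact: h.
exists (B + A ^+ 2); first by rewrite addr_ge0// sqr_ge0.
move=> k z Oz; apply: le_trans (cnormD _ _) _; rewrite cnormN cnormM cnormX cnormV cnorm_nat.
apply: lerD; first exact: BP.
apply: (@le_trans _ _ (1 * A ^+ 2)); last by rewrite mul1r.
apply: ler_pM; rewrite ?sqr_ge0 ?invr_ge0//; first by lra.
by rewrite lerXn2r ?nnegrE ?cnorm_ge0// AP.
Qed.

Lemma Tlimit Om Om' Phi (a : nat -> 'I_N) z : good_ifs Om Om' Phi -> bounded_set Om ->
  closure Om z -> (fun n => preschwarzian (fcomp Phi (mkseq a n)) z) @ \oo -->
    unif_lim (closure Om) (fun n => preschwarzian (fcomp Phi (mkseq a n))) z.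
Proof.
move=> gi bO; have [lam lP] := ifs_contraction_bound gi bO.
have [A A0 AP] := preschwarzian_bound gi bO.
move=> Oz; exact: (cocycle_limit (preschwarzian_cocycle gi lP AP) A0 Oz).
Qed.

Lemma Slimit Om Om' Phi (a : nat -> 'I_N) z : good_ifs Om Om' Phi -> bounded_set Om ->
  closure Om z -> (fun n => schwarzian (fcomp Phi (mkseq a n)) z) @ \oo -->
    unif_lim (closure Om) (fun n => schwarzian (fcomp Phi (mkseq a n))) z.
Proof.
move=> gi bO; have [lam lP] := ifs_contraction_bound gi bO.
have [A A0 AP] := schwarzian_bound gi bO.
move=> Oz; exact: (cocycle_limit (schwarzian_cocycle gi lP AP) A0 Oz).
Qed.

Lemma GS_criterion Om Om' Phi (b : 'I_N -> 'I_N -> Cplx R) :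
  good_ifs Om Om' Phi -> bounded_set Om -> (forall k j, closure Om (b k j)) ->
  (forall k j s u, k != j -> 1 <= cnorm (schwarzian (fcomp Phi (k :: s)) (b k j) -
     schwarzian (fcomp Phi (j :: u)) (b k j))) ->
  GS Om Om' Phi.
Proof.
move=> gi bO Ob gap; have [_ _ _ cP] := gi; split; first exact: cP.
apply: (@separation_gap R N (@schwarzian R) Om Phi b b 1 ltr01).
- by move=> k j; split; exact: Ob.
- by move=> a z; exact: (Slimit gi bO).
- by move=> k j s u /(gap k j s u) H; rewrite mulr_natl mulr2n lerD.
Qed.

(** The approximating point supplied by the closure may be [b] itself; then [b] lies in the open set
    and can be shifted horizontally. *)
Lemma closure_punctured Om b (d : R) : open Om -> closure Om b -> 0 < d ->
  exists2 b', Om b' & b' != b /\ cnorm (b' - b) < d.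
Proof.
move=> /open_cplxP oO /closure_cplxP cb d0; have [w Ow wb] := cb d d0.
have [wE|wb'] := eqVneq w b; last by exists w.
have [e e0 eO] := oO w Ow; pose t := Num.min d e / 2.
have t0 : 0 < t by rewrite divr_gt0// lt_min d0.
have [td te] : t < d /\ t < e.
  have : Num.min d e <= d by rewrite ge_min lexx.
  have : Num.min d e <= e by rewrite ge_min lexx orbT.
  by rewrite /t in t0 *; lra.
have E : w + mkc t 0 - w = mkc t 0 by rewrite addrC addKr.
exists (w + mkc t 0); first by apply: eO; rewrite E cnorm_mkc0 gtr0_norm.
rewrite -subr_eq0 -wE E -cnorm_eq0 cnorm_mkc0 gtr0_norm// gt_eqF//.
Qed.

Lemma cnorm_near (p q : Cplx R) (d M : R) : cnorm (p - q) < d -> cnorm q <= M ->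
  cnorm p <= M + d.
Proof. by have := cnormBD p q; lra. Qed.

(** A function with derivative of modulus at least 1 changes by at least |h| minus a remainder at
    most |h|/2, so it cannot be small at both ends of the step. *)
Lemma taylor_gap (p q l h : Cplx R) (K : R) : 1 <= cnorm l ->
  cnorm (q - p - l * h) <= K * cnorm h ^+ 2 -> 0 <= K -> 2 * (K + 1) * cnorm h <= 1 ->
  cnorm h / 2 <= cnorm p + cnorm q.
Proof.
move=> l1 H K0 Kh; have h0 := cnorm_ge0 h.
have lh : cnorm h <= cnorm (l * h) by rewrite cnormM ler_peMl.
have t1 : cnorm (l * h) <= cnorm (q - p) + cnorm (q - p - l * h).
  have {1}-> : l * h = (q - p) - (q - p - l * h) by ring.
  by apply: le_trans (cnormD _ _) _; rewrite cnormN.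
have t2 := cnormD q (- p); rewrite cnormN in t2.
have t3 : K * cnorm h ^+ 2 <= cnorm h / 2.
  by rewrite expr2 mulrA mulrC ler_wpM2l//; lra.
lra.
Qed.

(** For each pair of letters a second test point [b'] near [b] is chosen. The T-differences are
    uniformly bounded on one ball about [b], so [cauchy_taylor] lets the same [b'] work for all
    continuations [s] and [u]. *)
Lemma GT_criterion Om Om' Phi (b : 'I_N -> 'I_N -> Cplx R) :
  good_ifs Om Om' Phi -> bounded_set Om -> (forall k j, closure Om (b k j)) ->
  (forall k j s u, k != j -> 1 <= cnorm (cderiv (preschwarzian (fcomp Phi (k :: s))) (b k j) -
     cderiv (preschwarzian (fcomp Phi (j :: u))) (b k j))) ->
  GT Om Om' Phi.
Proof.
move=> gi bO Ob gap; have oV := ifs_domain_open gi.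
have [lam lP] := ifs_contraction_bound gi bO.
have [A A0 AP] := preschwarzian_bound gi bO.
have cT := preschwarzian_cocycle gi lP AP.
pose B := A / (1 - lam).
have B0 : 0 <= B.
  by have [/andP[_ l1] _] := lP; rewrite divr_ge0// subr_ge0 ltW.
have main (p : 'I_N * 'I_N) : exists q : Cplx R * R, [/\ closure Om q.1, 0 < q.2 &
    forall s u, p.1 != p.2 -> 2 * q.2 <=
      cnorm (preschwarzian (fcomp Phi (p.1 :: s)) (b p.1 p.2) -
             preschwarzian (fcomp Phi (p.2 :: u)) (b p.1 p.2)) +
      cnorm (preschwarzian (fcomp Phi (p.1 :: s)) q.1 -
             preschwarzian (fcomp Phi (p.2 :: u)) q.1)].
  case: p => k j /=; set b0 := b k j; have cb0 : closure Om b0 by exact: Ob.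
  have Vb0 := ifs_domain_closure gi cb0.
  have nearb i : exists2 d, 0 < d & forall z, cnorm (z - b0) < d ->
     cnorm (preschwarzian (Phi i) z) <= A + 1 /\ cnorm (cderiv (Phi i) z) <= 2.
    have [_ /continuous_cplxP c2 /continuous_cplxP c1 _ _] := ifs_ccont gi cb0 i.
    have [d1 d10 P1] := c1 1 ltr01; have [d2 d20 P2] := c2 1 ltr01.
    exists (Num.min d1 d2); first by rewrite lt_min d10.
    move=> z; rewrite lt_min => /andP[/P1 h1 /P2 h2].
    have q1 := AP i b0 cb0; have [/andP[_ l1] q2] := lP; have {}q2 := q2 i b0 cb0.
    split; first exact: (cnorm_near h1 q1).
    by apply: le_trans (cnorm_near h2 q2) _; rewrite lerD// ltW.
  have [dk dk0 Pk] := nearb k; have [dj dj0 Pj] := nearb j.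
  have [dv dv0 Pv] := (open_cplxP _).1 oV b0 Vb0.
  pose r := Num.min dv (Num.min dk dj).
  have r0 : 0 < r by rewrite !lt_min dv0 dk0.
  have [C [d [C0 d0 CP]]] := cauchy_taylor r0.
  pose A2 := 2 * (B * 2 + (A + 1)).
  have A20 : 0 <= A2 by rewrite /A2; apply: mulr_ge0 => //; apply: addr_ge0; [exact: mulr_ge0|exact: addr_ge0].
  have CA : 0 < 2 * (C * A2 + 1) by rewrite mulr_gt0// ltr_wpDl// mulr_ge0.
  (* The second entry is the smallness of the step that [taylor_gap] asks for with K = C * A2. *)
  have e0 : 0 < Num.min d (2 * (C * A2 + 1))^-1 by rewrite lt_min d0 invr_gt0.
  have [b' Ob' [b'b]] := closure_punctured (let: And4 o _ _ _ := gi in o) cb0 e0.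
  rewrite lt_min => /andP[b'd b'C].
  have bb0 : 0 < cnorm (b' - b0) by rewrite cnorm_gt0 subr_eq0.
  exists (b', cnorm (b' - b0) / 4); split=> /=; [exact: subset_closure|by rewrite divr_gt0|].
  move=> s u kj.
  pose f z := preschwarzian (fcomp Phi (k :: s)) z - preschwarzian (fcomp Phi (j :: u)) z.
  have hT w := preschwarzian_holo oV (fcomp_conformal w gi).
  have ball z : cnorm (z - b0) < r -> ifs_domain Om Om' Phi z.
    by rewrite lt_min => /andP[/Pv].
  have df z : ifs_domain Om Om' Phi z -> has_cderiv f z
     (cderiv (preschwarzian (fcomp Phi (k :: s))) z - cderiv (preschwarzian (fcomp Phi (j :: u))) z).
    by move=> Vz; exact: cderB (holo_has_cderiv (hT _) Vz) (holo_has_cderiv (hT _) Vz).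
  (* The ball about [b0] may leave the closure of Om, where the cocycle bound lives; one application
     of [Phi i] returns to Om, and the first letter is bounded by hand. *)
  have Tb i w z : ifs_domain Om Om' Phi z -> cnorm (preschwarzian (Phi i) z) <= A + 1 /\
      cnorm (cderiv (Phi i) z) <= 2 ->
      cnorm (preschwarzian (fcomp Phi (i :: w)) z) <= B * 2 + (A + 1).
    move=> Vz [h1 h2]; rewrite (preschwarzian_fcomp_cons i w gi Vz).
    apply: le_trans (cnormD _ _) _; rewrite cnormM; apply: lerD => //.
    apply: ler_pM; rewrite ?cnorm_ge0//; apply: (cocycle_bound cT _ A0).
    by apply: subset_closure; exact: Vz.2.
  have fb z : cnorm (z - b0) < r -> cnorm (f z) <= A2.
    move=> zr; have Vz := ball z zr; move: zr; rewrite !lt_min => /and3P[_ /Pk hk /Pj hj].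
    apply: le_trans (cnormD _ _) _; rewrite cnormN /A2 mulr_natl mulr2n.
    by apply: lerD; [exact: Tb Vz hk|exact: Tb Vz hj].
  have := CP f b0 A2 (fun w wr => cder_ex (df w (ball w wr))) fb (b' - b0) b'd.
  rewrite (cderivE (df b0 Vb0)) [b0 + _]addrC subrK => H.
  have -> : 2 * (cnorm (b' - b0) / 4) = cnorm (b' - b0) / 2 by field.
  apply: (taylor_gap (gap k j s u kj) H).
    exact: mulr_ge0.
  by rewrite mulrC -ler_pdivlMr// div1r ltW.
have [q qP] := choice main.
pose tau := \big[Num.min/1]_p (q p).2.
have tau0 : 0 < tau by apply/bigmin_gtP; split=> // p _; have [_ ? _] := qP p.
have [_ _ _ cP] := gi; split; first exact: cP.
apply: (@separation_gap R N (@preschwarzian R) Om Phi b (fun k j => (q (k, j)).1) tau tau0).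
- by move=> k j; split; [exact: Ob|have [h _ _] := qP (k, j); exact: h].
- by move=> a z; exact: (Tlimit gi bO).
- move=> k j s u kj; have [_ _ H] := qP (k, j); apply: le_trans (H s u kj).
  by rewrite ler_pM2l//; exact: bigmin_le.
Qed.

End SeparationCriteria.

(** * The separating perturbation *)

Section PeakFunctions.
Context {R : realType}.
Implicit Types (z w : Cplx R) (eta kap : R).

(** This is q_k, with eta = c_k nu^-3 and kap = nu^2. Keeping both as parameters makes the family
    closed under differentiation, which multiplies [eta] by [kap]. *)
Definition peak eta kap z0 z : Cplx R := mkc eta 0 * cexp (mkc kap 0 * (z - z0)).

Lemma peak_has_cderiv eta kap z0 z :
  has_cderiv (peak eta kap z0) z (peak (eta * kap) kap z0 z).
Proof.
have d := cderZ (mkc eta 0) (cder_comp (f := @cexp R) (cexp_has_cderiv _)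
  (cderZ (mkc kap 0) (cderB (cder_id z) (cder_cst z0 z)))).
apply: cder_eq d _; rewrite /peak subr0 mulr1.
have -> : mkc (eta * kap) 0 = mkc eta 0 * mkc kap 0 :> Cplx R.
  by apply: cplx_ext; rewrite !reimE /re /im /=; ring.
by rewrite mulrAC -mulrA.
Qed.

Lemma cnorm_peak eta kap z0 z :
  cnorm (peak eta kap z0 z) = `|eta| * expR (kap * (re z - re z0)).
Proof.
rewrite /peak cnormM cnorm_mkc0 cnorm_cexp; congr (_ * expR _).
by rewrite !reimE /re /im /= mul0r subr0.
Qed.

Lemma peak_le eta kap z0 z : 0 <= kap -> re z <= re z0 ->
  cnorm (peak eta kap z0 z) <= `|eta|.
Proof.
move=> k0 zz; rewrite cnorm_peak ler_piMr// -expR0 ler_expR.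
by rewrite mulr_ge0_le0// subr_le0.
Qed.

Lemma peak_center eta kap z0 : peak eta kap z0 z0 = mkc eta 0.
Proof. by rewrite /peak subrr mulr0 cexp0 mulr1. Qed.

(** The identity is split off so that the distance of [theta] from it is the integral of exp(peak) -
    1, which is of the order of [eta] on the half plane to the left of [z0]. *)
Definition theta eta kap z0 z : Cplx R :=
  z + entire_prim (fun z => cexp (peak eta kap z0 z) - 1) z0 z.

Lemma theta_integrand eta kap z0 z :
  derivable (fun z => cexp (peak eta kap z0 z) - 1) z 1.
Proof.
exact: cder_ex (cderB (cder_comp (f := @cexp R) (cexp_has_cderiv _) (peak_has_cderiv _ _ _ _))
  (cder_cst 1 z)).
Qed.

Lemma theta_has_cderiv eta kap z0 z :
  has_cderiv (theta eta kap z0) z (cexp (peak eta kap z0 z)).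
Proof.
have := cderD (cder_id z) (entire_prim_has_cderiv z0 z (@theta_integrand eta kap z0)).
by move=> /cder_eq; apply; rewrite addrC subrK.
Qed.

Lemma cderiv_theta eta kap z0 : cderiv (theta eta kap z0) = fun z => cexp (peak eta kap z0 z).
Proof. by apply/funext => z; exact: cderivE (theta_has_cderiv _ _ _ _). Qed.

Lemma theta_conformal eta kap z0 : conformal_on setT (theta eta kap z0).
Proof.
split=> z _; first exact: cder_ex (theta_has_cderiv _ _ _ _).
by rewrite cderiv_theta cexp_neq0.
Qed.

Lemma preschwarzian_theta eta kap z0 :
  preschwarzian (theta eta kap z0) = peak (eta * kap) kap z0.
Proof.
apply/funext => z; rewrite /preschwarzian cderiv_theta.
have d := cder_comp (f := @cexp R) (cexp_has_cderiv _) (peak_has_cderiv eta kap z0 z).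
by rewrite (cderivE d) mulrC mulKf// cexp_neq0.
Qed.

Lemma cderiv_preschwarzian_theta eta kap z0 :
  cderiv (preschwarzian (theta eta kap z0)) = peak (eta * kap * kap) kap z0.
Proof.
by rewrite preschwarzian_theta; apply/funext => z; exact: cderivE (peak_has_cderiv _ _ _ _).
Qed.

Lemma theta_near eta kap z0 z (d : R) :
  (forall h : Cplx R, cnorm h < d -> cnorm (cexp h - 1) <= 2 * cnorm h) ->
  0 <= eta < d -> 0 <= kap -> re z <= re z0 ->
  cnorm (theta eta kap z0 z - z) <= 8 * eta * cnorm (z - z0).
Proof.
move=> dP /andP[e0 ed] k0 zz; rewrite /theta addrC addKr.
have := entire_prim_le (M := 2 * eta) (@theta_integrand eta kap z0) (z0 := z0) (z := z).
move=> H; apply: le_trans (H _) _.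
  move=> w /andP[_]; rewrite (max_idPl zz) => wz.
  have pe := peak_le eta k0 wz; rewrite ger0_norm// in pe.
  by apply: le_trans (dP _ (le_lt_trans pe ed)) _; rewrite ler_wpM2l.
have h1 := re_le (z - z0); have h2 := im_le (z - z0); rewrite !reimE in h1 h2.
have -> : 8 * eta * cnorm (z - z0) = 2 * (2 * eta) * (cnorm (z - z0) + cnorm (z - z0)) by ring.
by rewrite ler_wpM2l ?lerD// !mulr_ge0.
Qed.

End PeakFunctions.

(** * Peak points and the perturbed maps *)

Section PeakPoints.
Context {R : realType} {N : nat}.
Implicit Types (Phi : 'I_N -> Cplx R -> Cplx R) (Om : set (Cplx R)).

(** A maximum principle for Re f at a point with nonzero derivative: some direction changes [f] by a
    positive real number to first order. *)
Lemma no_interior_max Om (f : Cplx R -> Cplx R) z : open Om -> Om z ->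
  derivable f z 1 -> cderiv f z != 0 -> exists2 w, Om w & re (f z) < re (f w).
Proof.
move=> /open_cplxP oO Oz /derivable_has_cderiv/has_cderivP df; set l := cderiv f z in df * => l0.
have ln : 0 < cnorm l by rewrite cnorm_gt0.
have [d d0 dP] := df _ (divr_gt0 ln (ltr0n _ 2)).
have [e e0 eO] := oO z Oz.
pose r := Num.min d e / 2.
have m0 : 0 < Num.min d e by rewrite lt_min d0.
have r0 : 0 < r by rewrite divr_gt0.
have [rd re'] : r < d /\ r < e.
  by apply/andP; rewrite -lt_min /r ltr_pdivrMr// mulr_natr mulr2n ltrDl.
(* The step [h] is chosen with l h = t > 0 and |h| = r; the remainder, at most |l| r / 2 = t/2,
   leaves an increase of the real part by at least t/2. *)
pose t := r * cnorm l; have t0 : 0 < t by rewrite mulr_gt0.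
pose h := mkc t 0 / l.
have hn : cnorm h = r.
  by rewrite cnormM cnormV cnorm_mkc0 gtr0_norm// /t mulfK// gt_eqF.
have lh : l * h = mkc t 0 by rewrite /h mulrC divfK.
exists (z + h); first by apply: eO; rewrite (addrC z) addrK hn.
have := dP h; rewrite hn lh => /(_ rd) H.
have := le_trans (re_le _) H; rewrite !reimE ler_norml => /andP[H1 _].
have {}H1 : - (cnorm l / 2 * r) <= re (f (z + h)) - re (f z) - t by exact: H1.
have E : cnorm l / 2 * r = t / 2 by rewrite /t; ring.
by move: H1; rewrite E; lra.
Qed.

(* A compact subset of Om which, for small d, contains the images of all the maps. *)
Definition inner Om (d : R) : set (Cplx R) :=
  [set z | closure Om z /\ forall w, cnorm (w - z) < d -> Om w].

Lemma inner_sub Om d z : 0 < d -> inner Om d z -> Om z.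
Proof. by move=> d0 [_]; apply; rewrite subrr cnorm0. Qed.

Lemma inner_compact Om d : bounded_set Om -> compact (inner Om d).
Proof.
move=> bO; apply: subclosed_compact (compact_closure bO) _; last by move=> z [].
move=> z /closure_cplxP cz; split.
  apply: closed_closure; apply/closure_cplxP => e /cz[w [Ow _] wz]; by exists w.
move=> w wz; have [|z' [_ H] zz'] := cz (d - cnorm (w - z)); first by rewrite subr_gt0.
by apply: H; have := cnorm_triangle w z z'; rewrite (cnormB z); lra.
Qed.

(** The images keep distance 2d from the outside of Om: the perturbation may spend one [d], and its
    images still lie in [inner Om d]. The drop [d'] is positive because a maximum over that compact
    set is taken at a point of Om, where [no_interior_max] applies. *)
Lemma peak_points Om Om' Phi : good_ifs Om Om' Phi -> bounded_set Om -> Om !=set0 ->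
  exists (b : 'I_N -> Cplx R) (d d' : R), [/\ 0 < d, 0 < d', forall k, closure Om (b k),
    forall k z, closure Om z -> re (Phi k z) <= re (Phi k (b k)) /\
      (forall w, cnorm (w - Phi k z) < d + d -> Om w) &
    forall k z, inner Om d z -> re (Phi k z) <= re (Phi k (b k)) - d'].
Proof.
move=> gi bO [z0 Oz0]; have cO := compact_closure bO.
have [oO _ _ cP] := gi.
have cl0 : closure Om !=set0 by exists z0; exact: subset_closure.
have cre k z : closure Om z -> {for z, continuous (fun w => re (Phi k w))}.
  move=> Oz; have [c _ _ _ _] := ifs_ccont gi Oz k.
  by apply: (@continuous_comp _ _ _ (Phi k) (@re R)); [exact: c|exact: continuous_re].
have [b bP] : {b : 'I_N -> Cplx R & forall k, closure Om (b k) /\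
    forall z, closure Om z -> re (Phi k z) <= re (Phi k (b k))}.
  apply: (@choice _ _ (fun k b => closure Om b /\
    forall z, closure Om z -> re (Phi k z) <= re (Phi k b))) => k.
  by have [c Oc cmax] := compact_max cl0 cO (cre k); exists c.
have [r rP] : {r : 'I_N -> R & forall k, 0 < r k /\
    forall z, closure Om z -> forall w, cnorm (w - Phi k z) < r k -> Om w}.
  apply: (@choice _ _ (fun k r => 0 < r /\
    forall z, closure Om z -> forall w, cnorm (w - Phi k z) < r -> Om w)) => k.
  have cK : compact (Phi k @` closure Om).
    apply: continuous_compact cO; apply: continuous_in_subspaceT => z /set_mem Oz.
    by have [c _ _ _ _] := ifs_ccont gi Oz k; exact: c.
  have [|r r0 rP] := compact_inner_radius cK oO.
    by move=> _ [z Oz <-]; have [_ Vz] := ifs_domain_closure gi Oz; exact: Vz.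
  by exists r; split=> // z Oz w wz; apply: (rP (Phi k z)) wz; exists z.
pose d : R := (\big[Num.min/1]_k r k) / 2.
have d20 : 0 < \big[Num.min/1]_k r k.
  by apply/bigmin_gtP; split=> // k _; have [] := rP k.
have d0 : 0 < d by rewrite divr_gt0.
have dr k : d + d <= r k by rewrite -splitr; exact: bigmin_le.
have cK := @inner_compact Om d bO.
have [s sP] : {s : 'I_N -> R & forall k, 0 < s k /\
    forall z, inner Om d z -> re (Phi k z) <= re (Phi k (b k)) - s k}.
  apply: (@choice _ _ (fun k s => 0 < s /\
    forall z, inner Om d z -> re (Phi k z) <= re (Phi k (b k)) - s)) => k.
  have [K0|K0] := pselect (inner Om d !=set0); last first.
    by exists 1; split=> // z Kz; exfalso; apply: K0; exists z.
  have [|c Kc cmax] := compact_max K0 cK (f := fun w => re (Phi k w)).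
    by move=> z [Oz _]; exact: cre.
  exists (re (Phi k (b k)) - re (Phi k c)); split; last first.
    by move=> z Kz; rewrite opprB addrC subrK; exact: cmax.
  have Oc := inner_sub d0 Kc.
  have Vc := ifs_domain_closure gi (subset_closure Oc).
  have cf := ifs_domain_conformal k gi.
  have [w Ow cw] := no_interior_max oO Oc (cf.1 c Vc) (cf.2 c Vc).
  by rewrite subr_gt0; apply: lt_le_trans cw _; apply: (bP k).2; exact: subset_closure.
pose d' := \big[Num.min/1]_k s k.
exists b, d, d'; split=> //.
- by apply/bigmin_gtP; split=> // k _; have [] := sP k.
- by move=> k; exact: (bP k).1.
- move=> k z Oz; split; first exact: (bP k).2.
  by move=> w wz; apply: ((rP k).2 z Oz w); apply: lt_le_trans wz _.
- move=> k z Kz; apply: le_trans ((sP k).2 z Kz) _.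
  by rewrite lerD2l lerN2; exact: bigmin_le.
Qed.

End PeakPoints.

Section Perturbation.
Context {R : realType}.
Implicit Types (f : Cplx R -> Cplx R) (U : set (Cplx R)) (z : Cplx R) (eta kap : R).

Lemma perturbed_rules U f eta kap z0 : open U -> conformal_on U f ->
  let psi := fun z => theta eta kap z0 (f z) in
  conformal_on U psi /\ forall z, U z ->
  [/\ cderiv psi z = cexp (peak eta kap z0 (f z)) * cderiv f z,
      preschwarzian psi z = peak (eta * kap) kap z0 (f z) * cderiv f z + preschwarzian f z &
      cderiv (preschwarzian psi) z =
        peak (eta * kap * kap) kap z0 (f z) * cderiv f z ^+ 2 +
        peak (eta * kap) kap z0 (f z) * cderiv (cderiv f) z + cderiv (preschwarzian f) z].
Proof.
move=> oU cf psi; have oT : open [set: Cplx R] by exact: openT.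
have ct := theta_conformal eta kap z0.
have UT z : U z -> [set: Cplx R] (f z) by [].
split; first exact: (conformal_on_comp oU oT ct cf UT).
move=> z Uz; split.
- apply: (etrans (cderivE (conformal_comp oU oT ct cf UT Uz))).
  by rewrite (cderiv_theta eta kap z0).
- apply: (etrans (preschwarzian_comp oU oT ct cf UT Uz)).
  by rewrite (preschwarzian_theta eta kap z0).
- apply: (etrans (cderiv_preschwarzian_comp oU oT ct cf UT Uz)).
  have e1 := congr1 (@^~ (f z)) (cderiv_preschwarzian_theta eta kap z0).
  have e2 := congr1 (@^~ (f z)) (preschwarzian_theta eta kap z0).
  exact: (congr2 (fun p q => p * cderiv f z ^+ 2 + q * cderiv (cderiv f) z +
    cderiv (preschwarzian f) z) e1 e2).
Qed.

Lemma norm_prod_le (p q : Cplx R) (a b : R) : cnorm p <= a -> cnorm q <= b ->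
  cnorm (p * q) <= a * b.
Proof. by move=> ? ?; rewrite cnormM ler_pM ?cnorm_ge0. Qed.

(** With psi'' = T_psi psi' and f'' = T_f f', the closeness of second derivatives follows from that
    of first derivatives and of T; in the letters used, x2 - y2 = p (x1 - y1) + r y1^2. *)
Lemma second_derivative_estimate (x1 y1 x2 y2 p q r : Cplx R) (e A : R) :
  x2 = p * x1 -> y2 = q * y1 -> p = r * y1 + q -> cnorm (x1 - y1) <= 2 * e ->
  cnorm p <= A -> cnorm r <= e -> cnorm y1 <= 1 -> cnorm (x2 - y2) <= A * (2 * e) + e.
Proof.
move=> -> -> pE xy pA re' y1'.
have -> : p * x1 - q * y1 = p * (x1 - y1) + r * y1 * y1 by rewrite pE; ring.
apply: le_trans (cnormD _ _) _; apply: lerD; first exact: norm_prod_le.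
by rewrite -[leRHS]mulr1; apply: norm_prod_le => //; rewrite -[leRHS]mulr1; exact: norm_prod_le.
Qed.

Lemma third_term_estimate (t p q r c : Cplx R) (e C B : R) : t = p + q * r + c ->
  cnorm q <= e -> cnorm r <= C -> cnorm c <= B -> cnorm (t - p) <= e * C + B.
Proof.
move=> -> qe rC cB; have -> : p + q * r + c - p = q * r + c by ring.
by apply: le_trans (cnormD _ _) _; apply: lerD => //; exact: norm_prod_le.
Qed.

Lemma sum_estimate (t p q : Cplx R) (G : R) : t = p + q -> cnorm p <= G -> cnorm (t - q) <= G.
Proof. by move=> ->; rewrite addrK. Qed.

(** All quantities visible to d_2 move by a multiple of [e]. The peak with amplitude eta * kap * kap
    is the only term that may be large, and the last estimate isolates it. *)
Lemma perturbed_estimates U f eta kap z0 z (e d lam A0 B0 C1 : R) :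
  open U -> conformal_on U f -> U z ->
  (forall h : Cplx R, cnorm h < d -> cnorm (cexp h - 1) <= 2 * cnorm h) ->
  0 <= kap -> 0 <= eta <= e -> 0 <= eta * kap <= e -> e < d ->
  re (f z) <= re z0 -> cnorm (cderiv f z) <= lam -> lam <= 1 ->
  cnorm (preschwarzian f z) <= A0 -> cnorm (cderiv (preschwarzian f) z) <= B0 ->
  cnorm (cderiv (cderiv f) z) <= C1 ->
  let psi := fun z => theta eta kap z0 (f z) in
  [/\ cnorm (psi z - f z) <= 8 * e * cnorm (f z - z0),
      cnorm (cderiv psi z - cderiv f z) <= 2 * e,
      cnorm (preschwarzian psi z) <= e + A0,
      cnorm (cderiv (cderiv psi) z - cderiv (cderiv f) z) <= (e + A0) * (2 * e) + e &
      cnorm (cderiv (preschwarzian psi) z -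
             peak (eta * kap * kap) kap z0 (f z) * cderiv f z ^+ 2) <= e * C1 + B0].
Proof.
move=> oU cf Uz dP k0 /andP[eta0 etae] /andP[ek0 eke] ed rz fl l1 TA TB fC psi.
have [cpsi /(_ z Uz)[E1 E2 E3]] := perturbed_rules eta kap z0 oU cf.
rewrite -/psi in cpsi E1 E2 E3.
have e0 : 0 <= e by exact: le_trans etae.
have f1 : cnorm (cderiv f z) <= 1 by exact: le_trans l1.
have p0 : cnorm (peak eta kap z0 (f z)) <= e.
  by apply: le_trans (peak_le _ k0 rz) _; rewrite ger0_norm.
have p1 : cnorm (peak (eta * kap) kap z0 (f z)) <= e.
  by apply: le_trans (peak_le _ k0 rz) _; rewrite ger0_norm.
have D1 : cnorm (cderiv psi z - cderiv f z) <= 2 * e.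
  rewrite E1 -[X in _ - X]mul1r -mulrBl -[leRHS]mulr1; apply: norm_prod_le => //.
  by apply: le_trans (dP _ (le_lt_trans p0 ed)) _; rewrite ler_wpM2l.
have T1 : cnorm (preschwarzian psi z) <= e + A0.
  rewrite E2; apply: le_trans (cnormD _ _) _; apply: lerD => //.
  by rewrite -[leRHS]mulr1; exact: norm_prod_le.
split; [|exact: D1|exact: T1| |].
- have := theta_near dP (_ : 0 <= eta < d) k0 rz; rewrite eta0 (le_lt_trans etae ed).
  move=> /(_ isT) H; apply: le_trans H _.
  by rewrite ler_wpM2r ?cnorm_ge0// ler_wpM2l.
- exact: (second_derivative_estimate (preschwarzianE cpsi Uz) (preschwarzianE cf Uz) E2 D1 T1 p1 f1).
- exact: (third_term_estimate E3 p1 fC TB).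
Qed.

End Perturbation.

(** * The gap for T' and density *)

Section DerivativeGap.
Context {R : realType} {N : nat}.
Implicit Types (Phi : 'I_N -> Cplx R -> Cplx R) (Om : set (Cplx R)).

(** T' of a single letter is required to be moderate on [K] only, whereas [z] may be a peak point
    outside it. This suffices because all letters after the first act at points of [K]. *)
Lemma word_derivative_close Om Om' Phi (K : set (Cplx R)) (lam A B : R) :
  good_ifs Om Om' Phi -> contraction_bound Om Phi lam -> 0 <= A -> 0 <= B ->
  (forall k z, closure Om z -> cnorm (preschwarzian (Phi k) z) <= A) ->
  (forall z, K z -> closure Om z) -> (forall k z, closure Om z -> K (Phi k z)) ->
  (forall k z, K z -> cnorm (cderiv (preschwarzian (Phi k)) z) <= B) ->
  let A' := A / (1 - lam) in
  forall k s z, closure Om z ->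
    cnorm (cderiv (preschwarzian (fcomp Phi (k :: s))) z - cderiv (preschwarzian (Phi k)) z)
      <= (B + A' * A) / (1 - lam) + A' * A.
Proof.
move=> gi lP A0 B0 AP KO OK BP A'; have [/andP[l0 l1] lb] := lP.
have l1' : 0 < 1 - lam by rewrite subr_gt0.
have A'0 : 0 <= A' by rewrite divr_ge0// ltW.
have Tb s z : closure Om z -> cnorm (preschwarzian (fcomp Phi s) z) <= A'.
  by move=> Oz; exact: (cocycle_bound (preschwarzian_cocycle gi lP AP) s A0 Oz).
have OO k z : closure Om z -> closure Om (Phi k z) by move=> Oz; exact: KO (OK k z Oz).
have f2 k z : closure Om z -> cnorm (cderiv (cderiv (Phi k)) z) <= A.
  move=> Oz; have Vz := ifs_domain_closure gi Oz.
  rewrite (preschwarzianE (ifs_domain_conformal k gi) Vz) -[leRHS]mulr1.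
  by apply: norm_prod_le; [exact: AP|exact: le_trans (lb k z Oz) (ltW l1)].
have sq k z : closure Om z -> cnorm (cderiv (Phi k) z ^+ 2) <= lam.
  move=> Oz; rewrite expr2 -[leRHS]mulr1; apply: norm_prod_le; first exact: lb.
  exact: le_trans (lb k z Oz) (ltW l1).
(* Fixed point of x -> lam x + A' A + B, the recursion satisfied by the bound for T' along words on
   [K]. *)
pose G := (B + A' * A) / (1 - lam).
have G0 : 0 <= G by apply: divr_ge0; [apply: addr_ge0 => //; exact: mulr_ge0 | exact: ltW].
have TK s z : K z -> cnorm (cderiv (preschwarzian (fcomp Phi s)) z) <= G.
  elim: s z => [|k s IH] z Kz.
    by rewrite [X in cnorm X](cderiv_preschwarzian_id z) cnorm0.
  have Oz := KO z Kz; have Vz := ifs_domain_closure gi Oz.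
  rewrite (cderiv_preschwarzian_fcomp_cons k s gi Vz).
  have GE : G = G * lam + A' * A + B by rewrite /G; field; rewrite gt_eqF.
  rewrite [leRHS]GE; apply: le_trans (cnormD _ _) _; apply: lerD (BP k z Kz).
  apply: le_trans (cnormD _ _) _; apply: lerD.
    by apply: norm_prod_le; [exact: (IH _ (OK k z Oz))|exact: sq].
  by apply: norm_prod_le; [exact: (Tb s _ (OO k z Oz))|exact: f2].
move=> k s z Oz; have Vz := ifs_domain_closure gi Oz.
apply: (sum_estimate (cderiv_preschwarzian_fcomp_cons k s gi Vz)).
apply: le_trans (cnormD _ _) _; apply: lerD.
  rewrite -/G -[leRHS]mulr1; apply: norm_prod_le; first exact: (TK _ _ (OK k z Oz)).
  exact: le_trans (sq k z Oz) (ltW l1).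
by apply: norm_prod_le; [exact: (Tb s _ (OO k z Oz))|exact: f2].
Qed.

End DerivativeGap.

Section Density.
Context {R : realType} {N : nat}.
Implicit Types (Phi Psi : 'I_N -> Cplx R -> Cplx R) (Om : set (Cplx R)).

Lemma supnorm_le Om (h : Cplx R -> Cplx R) (M : R) :
  (forall z, closure Om z -> cnorm (h z) <= M) -> (supnorm Om h <= M%:E)%E.
Proof. by move=> hM; apply: ge_ereal_sup => _ [z Oz <-]; rewrite lee_fin; exact: hM. Qed.

Lemma dist2_lt Om Phi Psi (e M0 M1 M2 : R) : 0 < e -> M0 + M1 + M2 < e ->
  (forall k z, closure Om z -> [/\ cnorm (Phi k z - Psi k z) <= M0,
     cnorm (cderiv (Phi k) z - cderiv (Psi k) z) <= M1 &
     cnorm (cderiv (cderiv (Phi k)) z - cderiv (cderiv (Psi k)) z) <= M2]) ->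
  (dist2 Om Phi Psi < e%:E)%E.
Proof.
move=> e0 Me H; apply/bigmax_ltP; split; first by rewrite lte_fin.
move=> k _; apply: (@le_lt_trans _ _ (M0%:E + M1%:E + M2%:E)%E); last by rewrite -!EFinD lte_fin.
apply: leeD; first apply: leeD; apply: supnorm_le => z /(H k z)[h0 h1 h2].
- exact: h0. - exact: h1. - exact: h2.
Qed.

(** Powers of a = 3/mu: for j < k one has c_k mu = 3 a^(k-1) >= 3 c_j >= c_j + 2. *)
Lemma separated_amplitudes (mu : R) : 0 < mu <= 1 ->
  exists (c : 'I_N -> R) (C : R), [/\ 0 < C, forall k, 1 <= c k <= C &
    forall k j : 'I_N, (j < k)%N -> c j + 2 <= c k * mu].
Proof.
move=> /andP[m0 m1]; pose a := 3 / mu.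
have a1 : 1 <= a by rewrite /a ler_pdivlMr//; lra.
have a0 : 0 < a by lra.
exists (fun k => a ^+ k), (a ^+ N); split; first exact: exprn_gt0.
  by move=> k; rewrite exprn_ege1// ler_weXn2l// ltnW.
move=> k j jk; have -> : a ^+ k * mu = 3 * a ^+ k.-1.
  rewrite -[in LHS](prednK (leq_ltn_trans (leq0n j) jk)) exprS /a; field.
  by rewrite gt_eqF.
have jk1 : a ^+ j <= a ^+ k.-1 by rewrite ler_weXn2l// -ltnS (prednK (leq_ltn_trans (leq0n j) jk)).
have : 1 <= a ^+ j by rewrite exprn_ege1.
lra.
Qed.

Lemma expR_decay (x y : R) : 0 < y -> x <= - y -> expR x <= y^-1.
Proof.
move=> y0 xy; have h : y <= expR (- x) by have := expR_ge1Dx (- x); lra.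
rewrite -[x]opprK expRN lef_pV2 ?posrE ?expR_gt0//.
Qed.

(** [P], [Q] stand for T' of two words, [P1], [Q1] for T' of their first letters, and [P2], [Q2] for
    the peak terms of those letters. *)
Lemma gap_alg (P Q P1 Q1 P2 Q2 : Cplx R) (G H p q L : R) :
  cnorm (P - P1) <= G -> cnorm (Q - Q1) <= G -> cnorm (P1 - P2) <= H ->
  cnorm (Q1 - Q2) <= H -> p <= cnorm P2 -> cnorm Q2 <= q ->
  L + 2 * G + 2 * H + q <= p -> L <= cnorm (P - Q).
Proof.
move=> h1 h2 h3 h4 h5 h6 h7.
have t1 := cnorm_triangle P2 P1 P; have t2 := cnorm_triangle P2 P 0.
have t3 := cnorm_triangle P Q 0; have t4 := cnorm_triangle Q Q1 Q2.
have t5 := cnorm_triangle Q Q2 0; move: t2 t3 t5; rewrite !subr0 => t2 t3 t5.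
by rewrite (cnormB P) in h1; rewrite (cnormB P1) in h3; lra.
Qed.

Lemma schwarzian_gap_alg (p q p1 q1 : Cplx R) (A : R) : cnorm p <= A -> cnorm q <= A ->
  A ^+ 2 + 1 <= cnorm (p1 - q1) ->
  1 <= cnorm (p1 - 2^-1 * p ^+ 2 - (q1 - 2^-1 * q ^+ 2)).
Proof.
move=> pA qA H.
have A0 : 0 <= A by apply: le_trans pA; exact: cnorm_ge0.
have n2 : cnorm (2^-1 : Cplx R) = 2^-1 by rewrite cnormV cnorm_nat.
have sq r : cnorm r <= A -> cnorm (2^-1 * r ^+ 2) <= A ^+ 2 / 2.
  move=> rA; rewrite cnormM n2 cnormX mulrC ler_wpM2r ?invr_ge0//.
  by rewrite lerXn2r ?nnegrE ?cnorm_ge0.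
have E : p1 - q1 = (p1 - 2^-1 * p ^+ 2 - (q1 - 2^-1 * q ^+ 2)) + (2^-1 * p ^+ 2 - 2^-1 * q ^+ 2).
  by ring.
have t1 := cnormD (p1 - 2^-1 * p ^+ 2 - (q1 - 2^-1 * q ^+ 2)) (2^-1 * p ^+ 2 - 2^-1 * q ^+ 2).
have t2 := cnormD (2^-1 * p ^+ 2) (- (2^-1 * q ^+ 2)); rewrite cnormN in t2.
rewrite -E in t1; have := sq p pA; have := sq q qA; lra.
Qed.

Lemma schwarzian_gap (f g : Cplx R -> Cplx R) z (A : R) :
  cnorm (preschwarzian f z) <= A -> cnorm (preschwarzian g z) <= A ->
  A ^+ 2 + 1 <= cnorm (cderiv (preschwarzian f) z - cderiv (preschwarzian g) z) ->
  1 <= cnorm (schwarzian f z - schwarzian g z).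
Proof. exact: schwarzian_gap_alg. Qed.

(** Once eps <= 1 every smallness condition is linear in [eps]; [E] collects the coefficients of the
    d_2 bound, and eps <= e / (2E) makes that bound strict. *)
Lemma small_parameter (C r lam d dexp e A0 L : R) : 0 < C -> 0 <= r -> lam < 1 -> 0 < d ->
  0 < dexp -> 0 < e -> 0 <= A0 ->
  exists nu, let eps := C / nu in
  [/\ 1 <= nu, L <= 2 * nu, 0 < eps /\ eps < dexp, eps <= 1 /\ lam + 2 * eps <= (1 + lam) / 2 &
     8 * eps * r < d /\ 8 * eps * r + 2 * eps + ((eps + A0) * (2 * eps) + eps) < e].
Proof.
move=> C0 r0 l1 d0 dx0 e0 A00.
pose E := 8 * r + 2 + 2 * (1 + A0) + 1.
have E0 : 0 < E by rewrite /E; lra.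
pose eb := Num.min (Num.min 1 (dexp / 2)) (Num.min ((1 - lam) / 4)
  (Num.min (d / (16 * (r + 1))) (e / (2 * E)))).
have r16 : 0 < 16 * (r + 1) by lra.
have eb0 : 0 < eb.
  by rewrite !lt_min ltr01 !divr_gt0 //=; lra.
have e1 : eb <= 1 by rewrite !ge_min lexx.
have e2 : eb <= dexp / 2 by rewrite !ge_min lexx !orbT.
have e3 : eb <= (1 - lam) / 4 by rewrite !ge_min lexx !orbT.
have e4 : eb <= d / (16 * (r + 1)) by rewrite !ge_min lexx !orbT.
have e5 : eb <= e / (2 * E) by rewrite !ge_min lexx !orbT.
pose nu := Num.max 1 (Num.max (C / eb) (L / 2)).
have n1 : 1 <= nu by rewrite !le_max lexx.
have n2 : C / eb <= nu by rewrite !le_max lexx !orbT.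
have n3 : L / 2 <= nu by rewrite !le_max lexx !orbT.
have nu0 : 0 < nu by lra.
exists nu => eps; have eps0 : 0 < eps by rewrite divr_gt0.
have epsb : eps <= eb by rewrite /eps ler_pdivrMr// mulrC -ler_pdivrMr.
have er : eps * (16 * (r + 1)) <= d by rewrite -ler_pdivlMr//; lra.
have eE : eps * (2 * E) <= e by rewrite -ler_pdivlMr ?mulr_gt0//; lra.
have ss : eps * eps <= eps.
  by apply: ler_piMl; [exact: ltW|exact: le_trans e1].
have eA : 0 <= eps * A0 by rewrite mulr_ge0// ltW.
split=> //; first lra; first by split=> //; lra.
  by split; lra.
have e8 : 0 <= eps * r by rewrite mulr_ge0// ltW.
split; first lra.
have : eps * E = 8 * eps * r + 2 * eps + 2 * eps + 2 * (eps * A0) + eps by rewrite /E; ring.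
have : eps * (2 * E) = 2 * (eps * E) by ring.
have : (eps + A0) * (2 * eps) = 2 * (eps * eps) + 2 * (eps * A0) by ring.
have : 0 < eps * E by rewrite mulr_gt0.
lra.
Qed.

End Density.

Section PerturbationExists.
Context {R : realType} {N : nat}.
Implicit Types (Phi Psi : 'I_N -> Cplx R -> Cplx R) (Om : set (Cplx R)).

Lemma image_diameter Om : bounded_set Om -> exists2 r : R, 0 <= r &
  forall z w, Om z -> Om w -> cnorm (z - w) <= r.
Proof.
move=> /bounded_cplxP[r rP]; exists (`|r| + `|r|); first exact: addr_ge0.
move=> z w /rP zr /rP wr; apply: le_trans (cnormD _ _) _; rewrite cnormN.
by apply: lerD; apply: le_trans (ler_norm _).
Qed.

Lemma separating_perturbation Om Om' Phi (e : R) : good_ifs Om Om' Phi ->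
  bounded_set Om -> Om !=set0 -> 0 < e ->
  exists Psi (b : 'I_N -> 'I_N -> Cplx R),
  [/\ good_ifs Om Om' Psi, (dist2 Om Phi Psi < e%:E)%E, forall k j, closure Om (b k j),
    forall k j s u, k != j ->
      1 <= cnorm (cderiv (preschwarzian (fcomp Psi (k :: s))) (b k j) -
                  cderiv (preschwarzian (fcomp Psi (j :: u))) (b k j)) &
    forall k j s u, k != j ->
      1 <= cnorm (schwarzian (fcomp Psi (k :: s)) (b k j) -
                  schwarzian (fcomp Psi (j :: u)) (b k j))].
Proof.
move=> gi bO nO e0; have cO := compact_closure bO.
have [oO oOp sub cP] := gi.
have [lam0 lP0] := ifs_contraction_bound gi bO.
have [/andP[lam00 lam01] lb0] := lP0.
have [A0 A00 A0P] := preschwarzian_bound gi bO.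
have [B0 B00 B0P] : exists2 B : R, 0 <= B & forall k z, closure Om z ->
    cnorm (cderiv (preschwarzian (Phi k)) z) <= B.
  apply: (compact_bounds cO) => k z Oz.
  by have [_ _ _ h _] := ifs_ccont gi Oz k; exact: h.
have [C1 C10 C1P] : exists2 B : R, 0 <= B & forall k z, closure Om z ->
    cnorm (cderiv (cderiv (Phi k)) z) <= B.
  apply: (compact_bounds cO) => k z Oz.
  by have [_ _ _ _ h] := ifs_ccont gi Oz k; exact: h.
have [bb [d [d' [d0 d'0 Ob peak1 peak2]]]] := peak_points gi bO nO.
have [r r0 rP] := image_diameter bO.
have [dx dx0 dxP] := @cexp_near1 R.
(* The peak of letter k enters T' multiplied by Phi_k'(b_k)^2; [mu] is the least modulus of these
   factors, capped at 1. *)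
pose mu : R := \big[Num.min/1]_(k : 'I_N) cnorm (cderiv (Phi k) (bb k) ^+ 2).
have cOp k : conformal_on Om' (Phi k).
  by have [h1 h2 _ _] := cP k; split; [exact: h1|exact: h2].
have mu01 : 0 < mu <= 1.
  rewrite bigmin_le_id andbT; apply/bigmin_gtP; split=> // k _.
  by rewrite cnorm_gt0 expf_neq0//; apply: (cOp k).2; exact/sub/Ob.
have muk k : mu <= cnorm (cderiv (Phi k) (bb k) ^+ 2) by exact: bigmin_le.
have [c [C [C0 cC cgap]]] := @separated_amplitudes R N mu mu01.
pose lam1 := (1 + lam0) / 2.
have lam1b : 0 <= lam1 < 1 by rewrite /lam1; clear -lam00 lam01; apply/andP; split; lra.
(* The constants up to [L] must be fixed before [nu]; since eps <= 1 will hold, 1 replaces [eps] in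
   [A1] and [H]. *)
pose A1 := 1 + A0; pose A' := A1 / (1 - lam1).
pose H := 1 * C1 + B0.
pose B1 := C * d'^-1 + H.
pose G := (B1 + A' * A1) / (1 - lam1) + A' * A1.
have A10 : 0 <= A1 by exact: addr_ge0.
have H0 : 0 <= H by apply: addr_ge0 => //; exact: mulr_ge0.
have B10 : 0 <= B1 by apply: addr_ge0 => //; apply: mulr_ge0; rewrite ?invr_ge0 ltW.
(* A'^2 + 1 is the gap in T' that leaves a gap 1 in S; the rest pays for the errors in [gap_alg].
   The amplitudes provide a margin 2 nu, so L <= 2 nu is what [nu] has to satisfy. *)
pose L := A' ^+ 2 + 1 + 2 * G + 2 * H.
have [nu [nu1 nuL [eps0 epsx] [eps1 epsl] [epsd epse]]] :=
  small_parameter L C0 r0 lam01 d0 dx0 e0 A00.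
set eps := C / nu in eps0 epsx eps1 epsl epsd epse.
have nu0 : 0 < nu by exact: lt_le_trans nu1.
have nun : nu != 0 by rewrite gt_eqF.
pose eta k := c k / nu ^+ 3; pose kap := nu ^+ 2.
have c0 k : 0 < c k by have /andP[h _] := cC k; exact: lt_le_trans h.
have kap0 : 0 <= kap by exact: sqr_ge0.
have ekE k : eta k * kap = c k / nu by rewrite /eta /kap; field.
have ekkE k : eta k * kap * kap = c k * nu by rewrite /eta /kap; field.
have ek k : 0 <= eta k * kap <= eps.
  rewrite ekE; apply/andP; split; first exact: divr_ge0 (ltW (c0 k)) (ltW nu0).
  rewrite /eps; apply: ler_wpM2r; first by rewrite invr_ge0 ltW.
  by have /andP[_ h] := cC k.
have et k : 0 <= eta k <= eps.
  have q0 : 0 <= eta k by exact: divr_ge0 (ltW (c0 k)) (exprn_ge0 _ (ltW nu0)).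
  apply/andP; split; first exact: q0.
  have /andP[_ h] := ek k; apply: le_trans h; apply: ler_peMr q0 _.
  by rewrite /kap exprn_ege1.
pose z0 k := Phi k (bb k).
pose Psi k z := theta (eta k) kap (z0 k) (Phi k z).
have est k z : closure Om z -> _ := fun Oz =>
  perturbed_estimates oOp (cOp k) (sub z Oz) dxP kap0 (et k) (ek k) epsx
    (peak1 k z Oz).1 (lb0 k z Oz) (ltW lam01) (A0P k z Oz) (B0P k z Oz) (C1P k z Oz).
have rules k := perturbed_rules (eta k) kap (z0 k) oOp (cOp k).
have Phi_in k z : closure Om z -> Om (Phi k z).
  by move=> Oz; have [_ Vz] := ifs_domain_closure gi Oz; exact: Vz.
have close0 k z : closure Om z -> cnorm (Psi k z - Phi k z) <= 8 * eps * r.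
  move=> Oz; have [h _ _ _ _] := est k z Oz; apply: le_trans h _.
  apply: ler_wpM2l; first by apply: mulr_ge0 => //; exact: ltW.
  exact: (rP _ _ (Phi_in k z Oz) (Phi_in k _ (Ob k))).
have lP1 k z : closure Om z -> cnorm (cderiv (Psi k) z) <= lam1.
  move=> Oz; have [_ h _ _ _] := est k z Oz; apply: le_trans epsl.
  rewrite -(subrK (cderiv (Phi k) z) (cderiv (Psi k) z)) addrC.
  by apply: le_trans (cnormD _ _) _; apply: lerD; [exact: lb0|exact: h].
have Psi_inner k z : closure Om z -> inner Om d (Psi k z).
  move=> Oz; have [_ ball] := peak1 k z Oz.
  have pd : cnorm (Psi k z - Phi k z) < d by exact: le_lt_trans (close0 k z Oz) epsd.
  split; first by apply: subset_closure; apply: ball; apply: lt_trans pd _; rewrite ltrDl.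
  move=> w wd; apply: ball; apply: le_lt_trans (cnorm_triangle _ (Psi k z) _) _.
  exact: ltrD.
have gi' : good_ifs Om Om' Psi.
  split; [exact: oO|exact: oOp|exact: sub|move=> k].
  have [[cf1 cf2] _] := rules k.
  split; [exact: cf1|exact: cf2| |].
  - by move=> z Oz; exact: (inner_sub d0 (Psi_inner k z Oz)).
  - by move=> z Oz; have /andP[_ l1] := lam1b; exact: le_lt_trans (lP1 k z Oz) l1.
have lP1' : contraction_bound Om Psi lam1 by split; [exact: lam1b|exact: lP1].
have A1P k z : closure Om z -> cnorm (preschwarzian (Psi k) z) <= A1.
  move=> Oz; have [_ _ h _ _] := est k z Oz; apply: le_trans h _.
  by rewrite lerD2r.
have main k z : closure Om z -> cnorm (cderiv (preschwarzian (Psi k)) z -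
    peak (c k * nu) kap (z0 k) (Phi k z) * cderiv (Phi k) z ^+ 2) <= H.
  move=> Oz; have [_ _ _ _ h] := est k z Oz; rewrite -ekkE; apply: le_trans h _.
  by rewrite lerD2r ler_wpM2r.
have f2 k z : closure Om z -> cnorm (cderiv (Phi k) z ^+ 2) <= 1.
  move=> Oz; rewrite expr2 -[leRHS]mulr1; have h := le_trans (lb0 k z Oz) (ltW lam01).
  exact: norm_prod_le.
have cn0 k : 0 <= c k * nu by apply: mulr_ge0; exact: ltW.
have B1P k z : inner Om d z -> cnorm (cderiv (preschwarzian (Psi k)) z) <= B1.
  move=> Kz; have Oz : closure Om z by exact: Kz.1.
  (* On the inner set the exponential is at most exp(- nu^2 d') <= 1 / (nu^2 d'), which more than
     cancels the amplitude c_k nu. *)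
  have p : cnorm (peak (c k * nu) kap (z0 k) (Phi k z) * cderiv (Phi k) z ^+ 2) <= C * d'^-1.
    rewrite -[leRHS]mulr1; apply: norm_prod_le (f2 k z Oz).
    rewrite cnorm_peak ger0_norm//.
    have kd : 0 < kap * d' by rewrite mulr_gt0// exprn_gt0.
    have h : kap * (re (Phi k z) - re (z0 k)) <= - (kap * d').
      by rewrite -mulrN ler_wpM2l// lerBlDl; exact: (peak2 k z Kz).
    have /andP[_ ckC] := cC k.
    apply: (@le_trans _ _ (c k * nu * (kap * d')^-1)).
      by rewrite ler_wpM2l//; exact: expR_decay.
    have -> : c k * nu * (kap * d')^-1 = c k * d'^-1 * nu^-1.
      by rewrite /kap; field; rewrite nun gt_eqF.
    apply: (@le_trans _ _ (c k * d'^-1)).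
      by rewrite ler_piMr ?invf_le1//; apply: mulr_ge0; rewrite ?invr_ge0 ltW.
    by rewrite ler_wpM2r// invr_ge0 ltW.
  have h := main k z Oz; rewrite -(subrK (peak (c k * nu) kap (z0 k) (Phi k z) * cderiv (Phi k) z ^+ 2)
    (cderiv (preschwarzian (Psi k)) z)) addrC.
  by apply: le_trans (cnormD _ _) _; exact: lerD.
have KO z : inner Om d z -> closure Om z by case.
have wclose := word_derivative_close gi' lP1' A10 B10 A1P KO Psi_inner B1P.
have gap (k j : 'I_N) s u : (j < k)%N -> A' ^+ 2 + 1 <=
    cnorm (cderiv (preschwarzian (fcomp Psi (k :: s))) (bb k) -
           cderiv (preschwarzian (fcomp Psi (j :: u))) (bb k)).
  move=> jk; have Obk := Ob k.
  apply: (gap_alg (wclose k s _ Obk) (wclose j u _ Obk) (main k _ Obk) (main j _ Obk)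
    (p := c k * nu * mu) (q := c j * nu)).
  - rewrite [peak _ _ _ _]peak_center cnormM cnorm_mkc0 ger0_norm//.
    by rewrite ler_wpM2l.
  - rewrite -[leRHS]mulr1; apply: norm_prod_le (f2 j _ Obk).
    apply: le_trans (peak_le _ kap0 (peak1 j _ Obk).1) _.
    by rewrite ger0_norm.
  - have h : (c j + 2) * nu <= c k * mu * nu by exact: (ler_wpM2r (ltW nu0) (cgap k j jk)).
    rewrite -/L; have -> : c k * nu * mu = c k * mu * nu by ring.
    by apply: le_trans h; rewrite mulrDl addrC lerD2l.
(* The test point is the peak of the larger letter, where its amplitude dominates even if the
   smaller letter peaks there as well. *)
pose b (k j : 'I_N) := bb (if (j < k)%N then k else j).
have gap' k j s u : k != j -> A' ^+ 2 + 1 <=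
    cnorm (cderiv (preschwarzian (fcomp Psi (k :: s))) (b k j) -
           cderiv (preschwarzian (fcomp Psi (j :: u))) (b k j)).
  rewrite /b; case: (ltngtP j k) => [jk _|kj _|jk]; first exact: gap.
    by rewrite cnormB; exact: gap.
  by rewrite (val_inj jk) eqxx.
have Obb k j : closure Om (b k j) by rewrite /b; case: ifP => _; exact: Ob.
exists Psi, b; split.
- exact: gi'.
- apply: (dist2_lt e0 epse) => k z Oz; have [_ h1 _ h2 _] := est k z Oz.
  split; rewrite cnormB; [exact: close0|exact: h1|exact: h2].
- exact: Obb.
- by move=> k j s u kj; apply: le_trans (gap' k j s u kj); rewrite lerDr sqr_ge0.
- move=> k j s u kj; apply: (schwarzian_gap _ _ (gap' k j s u kj)).
    exact: (cocycle_bound (preschwarzian_cocycle gi' lP1' A1P) (k :: s) A10 (Obb k j)).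
  exact: (cocycle_bound (preschwarzian_cocycle gi' lP1' A1P) (j :: u) A10 (Obb k j)).
Qed.

Lemma separated_systems_dense Om Om' : open Om -> open Om' -> closure Om `<=` Om' ->
  bounded_set Om -> Om !=set0 ->
  dense_in (dist2 Om) (@cifs R N Om Om') (@GT R N Om Om') /\
  dense_in (dist2 Om) (@cifs R N Om Om') (@GS R N Om Om').
Proof.
move=> oO oOp sub bO nO.
have H Phi (e : R) : cifs Om Om' Phi -> 0 < e -> exists2 Psi, GT Om Om' Psi /\ GS Om Om' Psi &
    (dist2 Om Phi Psi < e%:E)%E.
  move=> cP e0; have gi : good_ifs Om Om' Phi by split.
  have [Psi [b [gi' de Ob gT gS]]] := separating_perturbation gi bO nO e0.
  exists Psi; last exact: de.
  by split; [exact: (GT_criterion gi' bO Ob gT) | exact: (GS_criterion gi' bO Ob gS)].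
split; split.
- by move=> Phi [].
- by move=> Phi cP e e0; have [Psi [h _] de] := H Phi e cP e0; exists Psi.
- by move=> Phi [].
- by move=> Phi cP e e0; have [Psi [_ h] de] := H Phi e cP e0; exists Psi.
Qed.

End PerturbationExists.

(** * Almost every parameter *)

Section OuterMeasure.
Context {R : realType} {M : nat}.
Implicit Types (A B : set 'rV[R]_M) (a b : nat -> 'rV[R]_M).

Lemma box_vol_ge0 (a b : 'rV[R]_M) : 0 <= box_vol a b.
Proof. by apply: prodr_ge0 => k _; rewrite le_max lexx. Qed.

Lemma cover_vol_ge0 a b n : (0 <= (box_vol (a n) (b n))%:E)%E.
Proof. by rewrite lee_fin box_vol_ge0. Qed.

Lemma lebesgueM_ge0 A : (0 <= lebesgueM A)%E.
Proof.
apply: le_ereal_inf_tmp => _ [a [b [_ ->]]]; apply: nneseries_ge0 => n _ _.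
exact: cover_vol_ge0.
Qed.

Lemma lebesgueM_subset A B : A `<=` B -> (lebesgueM A <= lebesgueM B)%E.
Proof.
move=> AB; apply: ereal_inf_le_tmp => _ [a [b [Bab ->]]]; exists a, b; split=> //.
exact: subset_trans AB Bab.
Qed.

(** The two covers are interleaved into one sequence. With strict real upper bounds such covers
    exist outright, and the outer measure never has to be approximated by an additional error. *)
Lemma lebesgueM_setU A B (x y : R) : (lebesgueM A < x%:E)%E -> (lebesgueM B < y%:E)%E ->
  (lebesgueM (A `|` B) < (x + y)%:E)%E.
Proof.
move=> /ereal_inf_ltP[_ [a1 [b1 [Ac ->]]] Ax] /ereal_inf_ltP[_ [a2 [b2 [Bc ->]]] By].
pose pick (u1 u2 : nat -> 'rV[R]_M) n := if odd n then u2 n./2 else u1 n./2.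
pose a := pick a1 a2; pose b := pick b1 b2.
pose v1 n := ((box_vol (a1 n) (b1 n))%:E : \bar R); pose v2 n := ((box_vol (a2 n) (b2 n))%:E : \bar R).
pose v n := ((box_vol (a n) (b n))%:E : \bar R).
have v10 n : (0 <= v1 n)%E by exact: cover_vol_ge0.
have v20 n : (0 <= v2 n)%E by exact: cover_vol_ge0.
have v0 n : (0 <= v n)%E by exact: cover_vol_ge0.
(* An even number of interleaved terms splits into equally many terms of each cover; a partial sum
   to n is then bounded by the one to 2n. *)
have even_sum n : (\sum_(0 <= i < n.*2) v i = \sum_(0 <= i < n) v1 i + \sum_(0 <= i < n) v2 i)%E.
  elim: n => [|n IH]; first by rewrite !big_geq// adde0.
  rewrite doubleS !big_nat_recr//= IH.
  have -> : v n.*2 = v1 n by rewrite /v /a /b /pick odd_double doubleK.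
  have -> : v n.*2.+1 = v2 n by rewrite /v /a /b /pick /= odd_double /= uphalf_double.
  by rewrite -!addeA; congr (_ + _)%E; rewrite addeCA.
apply: (@le_lt_trans _ _ (\sum_(0 <= n <oo) v n)%E).
  apply: ge_ereal_inf; exists (\sum_(0 <= n <oo) v n)%E => //.
  exists a, b; split=> // t [/Ac[n _ tn]|/Bc[n _ tn]].
    by exists n.*2 => //; rewrite /a /b /pick odd_double doubleK.
  by exists n.*2.+1 => //; rewrite /a /b /pick /= odd_double /= uphalf_double.
apply: (@le_lt_trans _ _ (\sum_(0 <= n <oo) v1 n + \sum_(0 <= n <oo) v2 n)%E); last first.
  by rewrite EFinD; apply: lteD.
apply: lime_le; first by apply: is_cvg_nneseries => n _ _; exact: v0.
apply: nearW => n; apply: (@le_trans _ _ (\sum_(0 <= i < n.*2) v i)%E).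
  apply: lee_sum_nneg_natr; first by move=> k _ _; exact: v0.
  by rewrite -addnn leq_addr.
rewrite even_sum; apply: leeD.
  by apply: nneseries_lim_ge => k _ _; exact: v10.
by apply: nneseries_lim_ge => k _ _; exact: v20.
Qed.

(** Degenerate boxes have volume 0 as soon as there is a coordinate; in dimension 0 the empty
    product gives every box volume 1. *)
Lemma lebesgueM_set0 : (0 < M)%N -> lebesgueM (set0 : set 'rV[R]_M) = 0%E.
Proof.
move=> M0; apply/eqP; rewrite eq_le lebesgueM_ge0 andbT; apply: ge_ereal_inf.
exists 0%E => //; exists (fun=> 0), (fun=> 0); split; first by move=> t.
rewrite eseries0// => i _ _; rewrite /box_vol (bigD1 (Ordinal M0))//=.
by rewrite subrr maxxx mul0r.
Qed.

Lemma lebesgueM_bigcup (T : eqType) (s : seq T) (F : T -> set 'rV[R]_M) (x d : R) :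
  (0 < M)%N -> 0 < d -> (forall i, i \in s -> (lebesgueM (F i) < x%:E)%E) ->
  (lebesgueM [set t | exists2 i, i \in s & F i t] < ((size s)%:R * x + d)%:E)%E.
Proof.
move=> M0 d0; elim: s => [|i s IH] Fx.
  rewrite mul0r add0r (_ : [set t | _] = set0).
    by rewrite (lebesgueM_set0 M0) lte_fin.
  by apply/seteqP; split=> [t [j] | t] //; rewrite in_nil.
have -> : (size (i :: s))%:R * x + d = x + ((size s)%:R * x + d).
  by rewrite /= -natr1; ring.
apply: (@le_lt_trans _ _ (lebesgueM (F i `|` [set t | exists2 j, j \in s & F j t]))).
  apply: lebesgueM_subset => t [j]; rewrite inE => /orP[/eqP -> Ft|js Ft]; first by left.
  by right; exists j.
apply: lebesgueM_setU; first by apply: Fx; rewrite mem_head.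
by apply: IH => j js; apply: Fx; rewrite in_cons js orbT.
Qed.

End OuterMeasure.

(** * Counting and truncating words *)

Section Words.
Context {R : realType} {N : nat}.

Lemma words_of_length (l : nat) : exists2 s : seq (seq 'I_N), size s = (N ^ l)%N &
  forall w, size w = l -> w \in s.
Proof.
exists [seq tval t | t <- enum {: l.-tuple 'I_N}].
  by rewrite size_map -cardE card_tuple card_ord.
move=> w wl; have -> : w = tval (Tuple (introT eqP wl)) by [].
by apply: map_f; rewrite mem_enum.
Qed.

Lemma size_flatten_le (T : Type) (F : nat -> seq T) (s : seq nat) (X : nat) :
  (forall l, l \in s -> (size (F l) <= X)%N) ->
  (size (flatten [seq F l | l <- s]) <= size s * X)%N.
Proof.
elim: s => [//|l s IH] H; rewrite /= size_cat mulSn leq_add// ?H ?mem_head//.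
by apply: IH => k ks; apply: H; rewrite in_cons ks orbT.
Qed.

Lemma word_pairs (n : nat) : (0 < N)%N -> exists2 s : seq (seq 'I_N * seq 'I_N),
  (size s <= n * N ^ (n + n))%N &
  forall p q, (0 < size p <= n)%N -> size p = size q -> (p, q) \in s.
Proof.
move=> N0; have [W WP] : {W : nat -> seq (seq 'I_N) & forall l, size (W l) = (N ^ l)%N /\
    forall w, size w = l -> w \in W l}.
  apply: (@choice _ _ (fun l W => size W = (N ^ l)%N /\ forall w, size w = l -> w \in W)) => l.
  by have [s s1 s2] := words_of_length l; exists s.
exists (flatten [seq allpairs pair (W l) (W l) | l <- iota 1 n]).
  apply: leq_trans (size_flatten_le (X := (N ^ (n + n))%N) _) _; last by rewrite size_iota.
  move=> l; rewrite mem_iota add1n ltnS => /andP[_ ln].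
  by rewrite size_allpairs (WP l).1 -expnD leq_pexp2l// leq_add.
move=> p q /andP[p0 pn] pq; apply/flattenP.
exists (allpairs pair (W (size p)) (W (size p))).
  by apply: map_f; rewrite mem_iota add1n ltnS p0 pn.
by apply: allpairs_f; apply: (WP (size p)).2.
Qed.

(** The end of a word counts as a difference: a word longer than [n] and its prefix of length [n]
    first differ at position [n], counted from 0. *)
Lemma wedge_prefix (w : word N) (n : nat) : (forall k, wlen w = Some k -> (n < k)%N) ->
  wlen (wedge w (FinWord (wprefix w n))) = Some n.
Proof.
move=> nw; have sz : size (wprefix w n) = n.
  case: w nw => [s|a] /= nw; first by rewrite size_takel// ltnW// nw.
  by rewrite size_mkseq.
have agree k : (k < n)%N -> letter w k = letter (FinWord (wprefix w n)) k.
  case: w {nw sz} => [s|a] kn /=; first by rewrite !onthE map_take nth_take.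
  by rewrite onthE (nth_map (a 0%N)) ?size_mkseq// nth_mkseq.
have differ : letter w n != letter (FinWord (wprefix w n)) n.
  rewrite [letter (FinWord _) n]/= onth_default ?sz//.
  case: w nw {sz agree} => [s|a] /= nw //.
  by have := onthTE s n; rewrite nw//; case: (onth s n).
rewrite /wedge; case: pselect => [e|ne]; last first.
  by exfalso; apply: ne; exists n.
case: ex_minnP => m mdiff mmin; have -> : m = n.
  apply/eqP; rewrite eqn_leq mmin//= leqNgt; apply/negP => mn.
  by move: mdiff; rewrite agree// eqxx.
by rewrite /= sz.
Qed.

End Words.

Section AlmostEverySeparated.
Context {R : realType}.

Lemma powlen_le (beta : R) (N n : nat) (w w' : word N * word N) : 0 <= beta ->
  wlen (wedge w.1 w'.1) = Some n -> wlen (wedge w.2 w'.2) = Some n ->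
  rho beta w w' <= beta ^+ n.
Proof.
move=> b0 h1 h2; rewrite /rho; case: ifP => _; first exact: exprn_ge0.
by rewrite h1 h2 /= minnn.
Qed.

(** Short pairs are kept; in a longer pair, whose words have equal length, both are cut at [n].
    Since n > 0 the distinct first letters survive, so the cut pair is still in [Zset]. *)
Lemma truncated_pair (N n : nat) (beta : R) (w : word N * word N) : 0 <= beta -> (0 < n)%N ->
  Zset w -> exists p q, [/\ (0 < size p <= n)%N, size p = size q,
    Zset (FinWord p, FinWord q) &
    w = (FinWord p, FinWord q) \/ rho beta w (FinWord p, FinWord q) <= beta ^+ n].
Proof.
move=> b0 n0 Zw.
have long : (forall k, wlen w.1 = Some k -> (n < k)%N) ->
    exists p q, [/\ (0 < size p <= n)%N, size p = size q,
    Zset (FinWord p, FinWord q) &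
    w = (FinWord p, FinWord q) \/ rho beta w (FinWord p, FinWord q) <= beta ^+ n].
  move=> long1; have [len _ dif] := Zw.
  have long2 k : wlen w.2 = Some k -> (n < k)%N by rewrite -len; exact: long1.
  have sz (v : word N) : (forall k, wlen v = Some k -> (n < k)%N) -> size (wprefix v n) = n.
    case: v => [s|a] /= h; last exact: size_mkseq.
    by rewrite size_takel// ltnW// h.
  have hd (v : word N) : letter (FinWord (wprefix v n)) 0 = letter v 0.
    case: n n0 {long1 long2 sz} => // n' _; case: v => [s|a] //=.
    by case: s.
  exists (wprefix w.1 n), (wprefix w.2 n); split.
  - by rewrite sz// n0 /=.
  - by rewrite !sz.
  - split.
    + by rewrite /= !sz.
    + by rewrite /= sz//; case=> h; move: n0; rewrite h.
    + by rewrite [letter (_, _).1 _]hd [letter (_, _).2 _]hd.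
  - by right; apply: (powlen_le b0); exact: wedge_prefix.
case: w Zw long => -[s|a] [u|b] [] //= len nz dif long; last by apply: long.
have [sn|ns] := leqP (size s) n; last by apply: long => k [<-].
exists s, u; case: len => len; split=> //; last by left.
- by rewrite sn andbT lt0n; apply/eqP => s0; apply: nz; rewrite s0.
- by split=> //=; rewrite len.
Qed.

Lemma cenorm_le (m : nat) (v : 'rV[Cplx R]_m) (M : R) : 0 <= M ->
  (forall l, cnorm (v ord0 l) <= M) -> cenorm v <= m%:R * M.
Proof.
move=> M0 vM; rewrite /cenorm -[leRHS]ger0_norm ?mulr_ge0// -sqrtr_sqr ler_wsqrtr//.
apply: (@le_trans _ _ (\sum_(l < m) M ^+ 2)).
  by apply: ler_sum => l _; rewrite lerXn2r ?nnegrE ?cnorm_ge0.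
rewrite sumr_const card_ord exprMn -[leLHS]mulr_natl ler_wpM2r ?sqr_ge0//.
by rewrite -natrX ler_nat -mulnn; case: m {v vM} => // m; rewrite leq_pmulr.
Qed.

Lemma cenorm_ge (m : nat) (v : 'rV[Cplx R]_m) l : cnorm (v ord0 l) <= cenorm v.
Proof.
rewrite -[leLHS]ger0_norm ?cnorm_ge0// -sqrtr_sqr ler_wsqrtr//.
rewrite (bigD1 l)//= lerDl sumr_ge0// => k _; exact: sqr_ge0.
Qed.

(** One factor q^n absorbs [n] by Bernoulli's inequality for 1/q = 1 + h; the other tends to 0. *)
Lemma geometric_small (q C d : R) : 0 <= q < 1 -> 0 < d -> exists2 n, (0 < n)%N &
  n%:R * (q ^+ n * q ^+ n) * C <= d.
Proof.
move=> /andP[q0 q1] d0.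
have [->|qn0] := eqVneq q 0.
  by exists 1%N => //; rewrite expr1 mul0r mulr0 mul0r ltW.
have qp : 0 < q by rewrite lt_def qn0.
pose h := q^-1 - 1.
have h0 : 0 < h by rewrite subr_gt0 invf_gt1.
have bern n : q ^+ n * (1 + n%:R * h) <= 1.
  elim: n => [|n IH]; first by rewrite expr0 mul0r addr0 mulr1.
  apply: le_trans IH; rewrite exprSr -mulrA ler_wpM2l ?exprn_ge0// -natr1.
  have qh : q * h = 1 - q by rewrite /h mulrBr divff// mulr1.
  have -> : q * (1 + (n%:R + 1) * h) = q + (n%:R + 1) * (q * h) by ring.
  rewrite qh -subr_ge0.
  have -> : 1 + n%:R * h - (q + (n%:R + 1) * (1 - q)) = n%:R * (h - (1 - q)) by ring.
  apply: mulr_ge0 => //; rewrite -qh (_ : h - q * h = (1 - q) * h); last by ring.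
  by apply: mulr_ge0; [rewrite subr_ge0 ltW|exact: ltW].
have nq n : n%:R * q ^+ n <= h^-1.
  rewrite -[leRHS]mul1r ler_pdivlMr//; apply: le_trans (bern n).
  have -> : q ^+ n * (1 + n%:R * h) = n%:R * q ^+ n * h + q ^+ n by ring.
  by rewrite lerDl exprn_ge0.
pose K := h^-1 * `|C| + 1.
have hV : 0 <= h^-1 by rewrite invr_ge0 ltW.
have K0 : 0 < K by apply: ltr_wpDl => //; exact: mulr_ge0.
have : (fun n => K * q ^+ n) @ \oo --> 0 by apply: cvg_geometric; rewrite ger0_norm.
move=> /cvgrPdist_lt/(_ d d0)[n _ H]; exists n.+1 => //.
have := H n.+1 (leqnSn n); rewrite /= sub0r normrN => /(le_lt_trans (ler_norm _))/ltW.
apply: le_trans; have qn := exprn_ge0 n.+1 q0.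
apply: (@le_trans _ _ (n.+1%:R * (q ^+ n.+1 * q ^+ n.+1) * `|C|)).
  by rewrite ler_wpM2l ?ler_norm// !mulr_ge0.
have -> : n.+1%:R * (q ^+ n.+1 * q ^+ n.+1) * `|C| = (n.+1%:R * q ^+ n.+1) * `|C| * q ^+ n.+1 by ring.
rewrite ler_wpM2r//; apply: (@le_trans _ _ (h^-1 * `|C|)); first by rewrite ler_wpM2r.
by rewrite /K lerDl.
Qed.

Lemma ratio_lt1 (N m : nat) (lam : R) : (0 < N)%N -> 0 < lam < 1 ->
  ln N%:R / (2 * ln lam^-1) < m%:R -> N%:R * lam ^+ (2 * m) < 1.
Proof.
move=> N0 /andP[l0 l1]; have Np : 0 < N%:R :> R by rewrite ltr0n.
have ll : 0 < ln lam^-1 by rewrite ln_gt0// invf_gt1.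
rewrite ltr_pdivrMr ?mulr_gt0// => H.
have Lp : 0 < lam ^+ (2 * m) by exact: exprn_gt0.
rewrite -ltr_pdivlMr// div1r -ltr_ln ?posrE ?invr_gt0//.
rewrite -exprVn lnXn ?invr_gt0// -[ltRHS]mulr_natl natrM mulrAC mulrC; exact: H.
Qed.

(** Supplies the positivity of [lam], which is known only to exceed this maximum. *)
Lemma lambda_max_gt0 (N : nat) (Om : set (Cplx R)) (Phi : 'I_N -> Cplx R -> Cplx R) (k : 'I_N) :
  Om !=set0 -> (forall z, Om z -> cderiv (Phi k) z != 0) -> (0 < lambda_max Om Phi)%E.
Proof.
move=> [z Oz] d0; apply: (@lt_le_trans _ _ (supnorm Om (cderiv (Phi k)))).
  apply: (@lt_le_trans _ _ (cnorm (cderiv (Phi k) z))%:E).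
    by rewrite lte_fin cnorm_gt0; exact: d0.
  by apply: supnorm_ge; exact: subset_closure.
exact: le_bigmax.
Qed.

Lemma almost_every_separated (N : nat) (Om Om' : set (Cplx R)) (lam : R) (m M : nat)
    (y : 'I_m -> Cplx R) (B : set 'rV[R]_M) (K : R)
    (Phit : 'rV[R]_M -> 'I_N -> Cplx R -> Cplx R) :
  (0 < N)%N -> (0 < M)%N -> 0 < lam < 1 -> (0 < m)%N -> N%:R * lam ^+ (2 * m) < 1 ->
  (forall l, Om (y l)) -> (forall t, B t -> cifs Om Om' (Phit t)) ->
  (forall (u : R) w, 0 < u -> Zset w ->
    (lebesgueM [set t | B t /\ (cenorm (Fdiff Om y (Phit t) w) <= u)%R]
       <= (K * u ^+ (2 * m))%:E)%E) ->
  (forall t w w', B t -> Zset w -> Zset w' ->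
    cenorm (Fdiff Om y (Phit t) w - Fdiff Om y (Phit t) w')
      <= K * rho (lam ^+ 2) w w') ->
  lebesgueM [set t | B t /\ ~ GS Om Om' (Phit t)] = 0%E.
Proof.
move=> N0 M0 /andP[l0 l1] m0 q1 Oy BS meas lip.
apply/eqP; rewrite eq_le lebesgueM_ge0 andbT; apply/lee_addgt0Pr => d d0; rewrite add0e.
pose q := N%:R * lam ^+ (2 * m).
have q0 : 0 <= q by apply: mulr_ge0 => //; apply: exprn_ge0; exact: ltW.
have q01 : 0 <= q < 1 by rewrite q0; exact: q1.
(* The threshold for truncated pairs is m K1 e: each coordinate is at most [e] before truncation and
   moves by at most |K| e, and [m] is the crude factor from coordinates to the Euclidean norm. *)
pose K1 := `|K| + 1.
have K10 : 0 < K1 by rewrite ltr_wpDl.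
pose c := m%:R * K1.
have c0 : 0 < c by rewrite mulr_gt0// ltr0n.
have d20 : 0 < d / 2 by rewrite divr_gt0.
have [n n0 nd] := geometric_small (K1 * c ^+ (2 * m)) q01 d20.
(* One scale for two purposes: the level below which a bad parameter pushes some pair, and the value
   that [rho] cannot exceed when a pair is truncated at [n]. *)
pose e := (lam ^+ 2) ^+ n.
have e0 : 0 < e by rewrite !exprn_gt0.
pose u := c * e; have u0 : 0 < u by exact: mulr_gt0.
have [s ss sP] := word_pairs n N0.
pose Zf (pq : seq 'I_N * seq 'I_N) : word N * word N := (FinWord pq.1, FinWord pq.2).
(* Membership in [Zset] is part of the set, so list entries that are not admissible pairs contribute
   the empty set. *)
pose F pq := [set t | [/\ Zset (Zf pq), B t & cenorm (Fdiff Om y (Phit t) (Zf pq)) <= u]].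
pose x := K1 * u ^+ (2 * m).
have x0 : 0 < x by rewrite mulr_gt0// exprn_gt0.
have Fx pq : pq \in s -> (lebesgueM (F pq) < x%:E)%E.
  move=> _; have [Zpq|nZ] := pselect (Zset (Zf pq)); last first.
    have -> : F pq = set0 by apply/seteqP; split=> t // -[Zt _ _]; case: (nZ Zt).
    by rewrite (lebesgueM_set0 M0) lte_fin.
  apply: (@le_lt_trans _ _ (K * u ^+ (2 * m))%:E); last first.
    by rewrite lte_fin ltr_pM2r ?exprn_gt0// /K1 (le_lt_trans (ler_norm _))// ltrDl.
  apply: le_trans (meas u _ u0 Zpq); apply: lebesgueM_subset => t [_ Bt Ft].
  by split.
have := lebesgueM_bigcup M0 d20 Fx; set U := [set t | _] => Ux.
apply: (@le_trans _ _ (lebesgueM U)).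
  apply: lebesgueM_subset => t [Bt nG].
  have [w Zw we] : exists2 w, Zset w &
      (supnorm Om (Sproj Om (Phit t) w.1 \- Sproj Om (Phit t) w.2)%R < e%:E)%E.
    have : ~~ (0 < ereal_inf [set supnorm Om (Sproj Om (Phit t) w.1 \- Sproj Om (Phit t) w.2)%R
                   | w in @Zset N])%E.
      by apply/negP => h; apply: nG; split; [exact: BS|exact: h].
    rewrite -leNgt => h; have : (ereal_inf [set supnorm Om (Sproj Om (Phit t) w.1 \- Sproj Om (Phit t) w.2)%R
                   | w in @Zset N] < e%:E)%E by apply: le_lt_trans h _; rewrite lte_fin.
    by move=> /ereal_inf_ltP[_ [w Zw <-] we]; exists w.
  have Fw l : cnorm (Fdiff Om y (Phit t) w ord0 l) <= e.
    rewrite mxE -lee_fin; apply: le_trans (ltW we).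
    exact: (supnorm_ge (fun z => Sproj Om (Phit t) w.1 z - Sproj Om (Phit t) w.2 z)
      (subset_closure (Oy l))).
  have [p [r [pn pr Zpr H]]] := truncated_pair (sqr_ge0 lam) n0 Zw.
  exists (p, r); first exact: sP.
  split=> //; rewrite /u /c -mulrA.
  apply: cenorm_le; first by apply: mulr_ge0; exact: ltW.
  move=> l; have K1e : e <= K1 * e by apply: ler_peMl; [exact: ltW|rewrite /K1 lerDr].
  case: H => [wE|H]; first by have := Fw l; rewrite wE => h; exact: le_trans h K1e.
  rewrite -(subrK (Fdiff Om y (Phit t) w ord0 l) (Fdiff Om y (Phit t) (Zf (p, r)) ord0 l)).
  apply: le_trans (cnormD _ _) _; rewrite mulrDl mul1r; apply: lerD (Fw l).
  rewrite cnormB; have := cenorm_ge (Fdiff Om y (Phit t) w - Fdiff Om y (Phit t) (Zf (p, r))) l.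
  rewrite !mxE => h; apply: le_trans h _; apply: le_trans (lip t w _ Bt Zw Zpr) _.
  apply: (@le_trans _ _ (`|K| * rho (lam ^+ 2) w (Zf (p, r)))).
    by rewrite ler_wpM2r ?ler_norm// /rho; case: ifP => // _; case: minlen => [k|] //=; rewrite !exprn_ge0// ltW.
  by rewrite ler_wpM2l.
apply: ltW; apply: lt_le_trans Ux _; rewrite lee_fin [d in X in _ <= X]splitr lerD2r.
apply: le_trans nd.
have -> : x = K1 * c ^+ (2 * m) * (lam ^+ (2 * m)) ^+ (n + n).
  rewrite /x /u exprMn mulrA; congr (_ * _).
  by rewrite /e -!exprM; congr (_ ^+ _); rewrite addnn -mul2n mulnC.
have -> : n%:R * (q ^+ n * q ^+ n) * (K1 * c ^+ (2 * m)) =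
  (n * N ^ (n + n))%:R * (K1 * c ^+ (2 * m) * (lam ^+ (2 * m)) ^+ (n + n)).
  by rewrite -exprD /q exprMn natrM natrX; ring.
by rewrite ler_wpM2r ?ler_nat// !mulr_ge0 ?exprn_ge0// ltW.
Qed.

End AlmostEverySeparated.

Theorem theorem10p10 (R : realType) (N : nat) (hN : (2 <= N)%N)
    (Om Om' : set (Cplx R))
    (hOm : Jordan_domain Om) (hOm' : simply_connected_domain Om')
    (hsub : closure Om `<=` Om') :
  [/\ dense_in (dist2 Om) (@cifs R N Om Om') (@GT R N Om Om'),
      dense_in (dist2 Om) (@cifs R N Om Om') (@GS R N Om Om')
    & forall (Phi : 'I_N -> Cplx R -> Cplx R) (lam : R) (m : nat)
        (y : 'I_m -> Cplx R) (B : set 'rV[R]_(2 * m * N)) (K : R)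
        (Phit : 'rV[R]_(2 * m * N) -> 'I_N -> Cplx R -> Cplx R),
      cifs Om Om' Phi ->
      (lambda_max Om Phi < lam%:E)%E -> lam < 1 ->
      (0 < m)%N -> ln N%:R / (2 * ln lam^-1) < m%:R ->
      (forall l, Om (y l)) ->
      euclidean_ball B ->
      (forall t, B t -> cifs Om Om' (Phit t)) ->
      (forall (u : R) w, 0 < u -> Zset w ->
        (lebesgueM [set t | B t /\ (cenorm (Fdiff Om y (Phit t) w) <= u)%R]
           <= (K * u ^+ (2 * m))%:E)%E) ->
      (forall t w w', B t -> Zset w -> Zset w' ->
        cenorm (Fdiff Om y (Phit t) w - Fdiff Om y (Phit t) w')
          <= K * rho (lam ^+ 2) w w') ->
      lebesgueM [set t | B t /\ ~ GS Om Om' (Phit t)] = 0%E].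
Proof.
have [[nO oO _] bO _] := hOm.
have [[_ oO' _] _] := hOm'.
have [dT dS] := separated_systems_dense (N := N) oO oO' hsub bO nO.
split; [exact: dT|exact: dS|].
move=> Phi lam m y B K Phit SPhi lamPhi lam1 m0 hm Oy _ BS meas lip.
have N0 : (0 < N)%N by apply: leq_trans hN.
have lam0 : 0 < lam.
  rewrite -lte_fin; apply: lt_trans lamPhi.
  apply: (lambda_max_gt0 (k := Ordinal N0) nO) => z Oz.
  by have [_ d0 _ _] := SPhi (Ordinal N0); apply/d0/hsub/subset_closure.
have lam01 : 0 < lam < 1 by rewrite lam0.
have M0 : (0 < 2 * m * N)%N by rewrite !muln_gt0 m0 N0.
exact: (almost_every_separated N0 M0 lam01 m0 (ratio_lt1 N0 lam01 hm) Oy BS meas lip).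
Qed.
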